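(* There is a fixed polynomial $p$ (with nonnegative coefficients) such that the following holds. Let $n,k\ge 1$, $d\ge 0$ be integers, $\lambda\in\mathbb{R}$, $\sigma\in(0,1/2)$ and $\delta\in(0,1)$. Let $\mathcal{D}$ be a labelled distribution on $\{0,1\}^n\times\{0,1\}$ whose marginal $\mathcal{D}_{\mathbf{x}}$ is a $(\sigma,\lambda)$-smooth MRF with known dependency graph $G$ of maximum degree at most $d$, and whose labels are $y=f(x)$ for an unknown $k$-junta $f:\{0,1\}^n\to\{0,1\}$. Let $$N\ \ge\ p\big(\log n,\ e^{\lambda(d+k)},\ 2^{d+k},\ \sigma^{-k},\ 1/\delta\big).$$ Then there is a choice of threshold $\tau$ (depending only on $\delta,\lambda,\sigma,k,d$) such that the algorithm LearnJunta$(S,G,\tau)$, run on a set $S$ of $N$ i.i.d. samples from $\mathcal{D}$, runs in time at most $\mathrm{poly}(n,N)$ and, with probability at least $1-\delta$ over the samples and the smoothing of $\mathcal{D}_{\mathbf{x}}$, outputs a hypothesis $\hat f$ that equals $f$ exactly (equivalently $\Pr_{(x,y)\sim\mathcal{D}}[\hat f(x)\ne y]=0$). In particular, when $d,k\le O(\log n)$ and $\lambda,\sigma$ are constants independent of $n$, the number of samples and the running time may be taken polynomial in $n$ and $1/\delta$.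
   Context: **Smooth MRF.** A Markov Random Field (MRF) on $\{0,1\}^n$ with factorization polynomial $\psi$ (a real multilinear polynomial in $x_1,\dots,x_n$) is the distribution with $\Pr[X=x]\propto \exp(\psi(x))$, $x\in\{0,1\}^n$. $\partial_i\psi$ is the formal partial derivative in $x_i$, and $\|\cdot\|_1$ of a polynomial is the sum of absolute values of its coefficients. For $\lambda\in\mathbb{R}$, $\sigma\in(0,1/2)$, a $(\sigma,\lambda)$-smooth MRF is a (random) MRF with factorization $\psi(x)=\bar\psi(x)+\sum_{i=1}^n\Delta_i x_i$, where $\bar\psi$ is a fixed (adversarially chosen) multilinear polynomial with $\|\partial_i\bar\psi\|_1\le\lambda$ for all $i\in[n]$, and $\Delta_i=\log(1+\alpha_i)$ with $\alpha_1,\dots,\alpha_n$ i.i.d. uniform on $[-\sigma,\sigma]$. ''The smoothing'' refers to the randomness of $\alpha=(\alpha_1,\dots,\alpha_n)$; $\bar\psi$, $G$ and $f$ are fixed before $\alpha$ is drawn. **Dependency graph.** A graph $G$ on $[n]$ is a dependency graph of $D$ if for $X\sim D$ and every $i$, $X_i$ is conditionally independent of the remaining coordinates given $\{X_j: j\in N_G(i)\}$, where $N_G(i)$ is the set of neighbours of $i$. (Equivalently, since the density is positive, $\psi$ is a sum of functions each depending only on the coordinates in a clique of $G$; changing the linear part of $\psi$ does not affect this.) **Junta.** $f:\{0,1\}^n\to\{0,1\}$ is a $k$-junta if there are $S\subseteq[n]$, $|S|=k$, and $g:\{0,1\}^k\to\{0,1\}$ with $f(x)=g(x_S)$. **Labelled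 distribution.** $(x,y)\sim\mathcal{D}$ is drawn by sampling $x\sim\mathcal{D}_{\mathbf{x}}$ and setting $y=f(x)$. **Restrictions.** A restriction is $\rho\in\{0,1,*\}^n$, with $\mathrm{supp}(\rho)=\{i:\rho_i\ne *\}$. For a (multi)set $S$ of samples $(x,y)$, $S_\rho$ is the subset of those with $x_j=\rho_j$ for all $j\in\mathrm{supp}(\rho)$; $\mathbb{E}_{S_\rho}$ is the average over $S_\rho$ (empirical quantities over an empty set are taken to be $0$). **Algorithm FindRelevantVariables$(S,G,\tau)$.** Start with $\mathrm{Rel}=\emptyset$. For each $i\in[n]$ and each restriction $\rho$ with $\mathrm{supp}(\rho)=N_G(i)$, compute $I_S(i,\rho)=\big|\mathbb{E}_{S_\rho}[yx_i]-\mathbb{E}_{S_\rho}[y]\,\mathbb{E}_{S_\rho}[x_i]\big|$; if $I_S(i,\rho)>\tau$, add $i$ to $\mathrm{Rel}$. Return $\mathrm{Rel}$. **Algorithm LearnJunta$(S,G,\tau)$.** Compute $\mathrm{Rel}=$ FindRelevantVariables$(S,G,\tau)$; return an empirical risk minimizer $\hat f$ on $S$ among all functions $\{0,1\}^n\to\{0,1\}$ depending only on the coordinates in $\mathrm{Rel}$. *)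

(* Defs.v *)
From HB Require Import structures.
(* The notations of mpoly clash with those of mathcomp-analysis. *)
From mathcomp Require Import -(notations) mpoly.
From mathcomp Require Import all_boot all_order all_algebra.
From mathcomp Require Import all_classical all_reals all_analysis.

Set Implicit Arguments.
Unset Strict Implicit.
Unset Printing Implicit Defensive.

Import Order.TTheory GRing.Theory Num.Theory.
Local Open Scope ring_scope.

Notation mvar R i := (mpolyX R (mnm1 i)).

Definition norm1 (R : realType) (n : nat) (p : mpoly n R) : R :=
  \sum_(m <- msupp p) `|mcoeff m p|.

Definition multilinear (R : realType) (n : nat) (p : mpoly n R) : Prop :=
  forall m, m \in msupp p -> forall i : 'I_n, (m i <= 1)%N.

Definition nonneg_coeffs (R : realType) (n : nat) (p : mpoly n R) : Prop :=
  forall m, 0 <= mcoeff m p.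

Definition eval2 (R : realType) (p : mpoly 2 R) (a b : R) : R :=
  meval (tnth [tuple a; b]) p.

Definition eval5 (R : realType) (p : mpoly 5 R) (a b c d e : R) : R :=
  meval (tnth [tuple a; b; c; d; e]) p.

Definition cube (n : nat) := {ffun 'I_n -> bool}.

Definition energy (R : realType) (n : nat) (psi : mpoly n R) (x : cube n) : R :=
  meval (fun i => (x i)%:R) psi.

Definition mrf (R : realType) (n : nat) (psi : mpoly n R) (x : cube n) : R :=
  expR (energy psi x) / \sum_(z : cube n) expR (energy psi z).

Definition smoothed (R : realType) (n : nat) (psibar : mpoly n R)
    (alpha : 'I_n -> R) : mpoly n R :=
  psibar + \sum_(i < n) ln (1 + alpha i) *: mvar R i.

Definition prob (R : realType) (n : nat) (mu : cube n -> R)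
    (A : pred (cube n)) : R :=
  \sum_(x | A x) mu x.

Definition cprob (R : realType) (n : nat) (mu : cube n -> R)
    (A B : pred (cube n)) : R :=
  prob mu [predI A & B] / prob mu B.

Definition simple_graph (n : nat) (G : rel 'I_n) : Prop :=
  symmetric G /\ irreflexive G.

Definition nbrs (n : nat) (G : rel 'I_n) (i : 'I_n) : {set 'I_n} :=
  [set j | G i j].

Definition max_degree_le (n : nat) (G : rel 'I_n) (d : nat) : Prop :=
  forall i, (#|nbrs G i| <= d)%N.

Definition agree (n : nat) (V : {set 'I_n}) (x z : cube n) : bool :=
  [forall i in V, z i == x i].

Definition dependency_graph (R : realType) (n : nat) (mu : cube n -> R)
    (G : rel 'I_n) : Prop :=
  forall (i : 'I_n) (x : cube n),
    let N := nbrs G i in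
    let W := ~: (i |: N) in
    cprob mu [predI agree [set i] x & agree W x] (agree N x) =
    cprob mu (agree [set i] x) (agree N x) * cprob mu (agree W x) (agree N x).

Definition is_junta (n k : nat) (f : cube n -> bool) : Prop :=
  exists (S : {set 'I_n}) (cardS : #|S| = k) (g : cube k -> bool),
    forall x : cube n,
      f x = g [ffun j => x (enum_val (cast_ord (esym cardS) j))].

Definition example (n : nat) : Type := (cube n * bool)%type.

Definition labelled (R : realType) (n : nat) (mu : cube n -> R)
    (f : cube n -> bool) (z : example n) : R :=
  mu z.1 * (z.2 == f z.1)%:R.

Definition iid (R : realType) (n N : nat) (D : example n -> R)
    (S : N.-tuple (cube n * bool)) : R :=
  \prod_(j < N) D (tnth S j).

(* [None] is the star *)
Definition restriction (n : nat) := {ffun 'I_n -> option bool}.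

Definition rsupp (n : nat) (rho : restriction n) : {set 'I_n} :=
  [set i | rho i != None].

Definition consistent (n : nat) (rho : restriction n) (x : cube n) : bool :=
  [forall j in rsupp rho, rho j == Some (x j)].

Definition restrict (n : nat) (S : seq (example n)) (rho : restriction n) :=
  [seq z <- S | consistent rho z.1].

(* equal to 0 on the empty sample, since 0^-1 = 0 *)
Definition average (R : realType) (n : nat) (S : seq (example n))
    (g : example n -> R) : R :=
  (\sum_(z <- S) g z) / (size S)%:R.

Definition influence (R : realType) (n : nat) (S : seq (example n))
    (i : 'I_n) (rho : restriction n) : R :=
  let Srho := restrict S rho in
  `| average Srho (fun z => (z.2)%:R * (z.1 i)%:R)
     - average Srho (fun z => (z.2)%:R) * average Srho (fun z => (z.1 i)%:R) |.

Definition find_relevant_variables (R : realType) (n : nat)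
    (S : seq (example n)) (G : rel 'I_n) (tau : R) : {set 'I_n} :=
  [set i | [exists rho : restriction n,
              (rsupp rho == nbrs G i) && (tau < influence R S i rho)]].

Definition depends_only (n : nat) (V : {set 'I_n})
    (h : {ffun cube n -> bool}) : bool :=
  [forall x, forall z, agree V x z ==> (h x == h z)].

Definition empirical_risk (R : realType) (n : nat) (S : seq (example n))
    (h : {ffun cube n -> bool}) : R :=
  average S (fun z => (h z.1 != z.2)%:R).

(* The tie-breaking among empirical risk minimizers is not specified:
   [learn_junta S G tau h] says that [h] is a possible output. *)
Definition learn_junta (R : realType) (n : nat) (S : seq (example n))
    (G : rel 'I_n) (tau : R) (h : {ffun cube n -> bool}) : bool :=
  let Rel := find_relevant_variables S G tau in
  depends_only Rel h &&
  [forall g : {ffun cube n -> bool}, depends_only Rel g ==>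
     (empirical_risk R S h <= empirical_risk R S g)].

(* The memory has index registers holding natural numbers, and two-dimensional
   arrays of real numbers, both named by natural numbers. Every node of an
   expression that is evaluated costs one unit, and so does every assignment,
   sequencing step and branching. Programs do not mention real constants other
   than integers, so that a program is a finite object independent of its
   inputs. *)

Inductive iexp : Type :=
| INum of nat
| IReg of nat
| IAdd of iexp & iexp
| ISub of iexp & iexp.

Inductive rexp : Type :=
| RNum of int
| RGet of nat & iexp & iexp
| RAdd of rexp & rexp
| RSub of rexp & rexp
| RMul of rexp & rexp
| RDiv of rexp & rexp.

Inductive bexp : Type :=
| BLtI of iexp & iexp
| BLtR of rexp & rexp.

Inductive cmd : Type :=
| Skip
| ISet of nat & iexp
| RSet of nat & iexp & iexp & rexp
| Seq of cmd & cmd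
| If of bexp & cmd & cmd
| While of bexp & cmd.

Record store (R : Type) : Type :=
  Store { ireg : nat -> nat; rmem : nat -> nat -> nat -> R }.

Section Semantics.
Variable R : realType.
Implicit Type s : store R.

Fixpoint ieval s (e : iexp) : nat :=
  match e with
  | INum m => m
  | IReg v => ireg s v
  | IAdd e1 e2 => (ieval s e1 + ieval s e2)%N
  | ISub e1 e2 => (ieval s e1 - ieval s e2)%N
  end.

Fixpoint icost (e : iexp) : nat :=
  match e with
  | INum _ | IReg _ => 1
  | IAdd e1 e2 | ISub e1 e2 => (icost e1 + icost e2).+1
  end.

Fixpoint reval s (e : rexp) : R :=
  match e with
  | RNum z => z%:~R
  | RGet a i j => rmem s a (ieval s i) (ieval s j)
  | RAdd e1 e2 => reval s e1 + reval s e2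
  | RSub e1 e2 => reval s e1 - reval s e2
  | RMul e1 e2 => reval s e1 * reval s e2
  | RDiv e1 e2 => reval s e1 / reval s e2
  end.

Fixpoint rcost (e : rexp) : nat :=
  match e with
  | RNum _ => 1
  | RGet _ i j => (icost i + icost j).+1
  | RAdd e1 e2 | RSub e1 e2 | RMul e1 e2 | RDiv e1 e2 => (rcost e1 + rcost e2).+1
  end.

Definition beval s (b : bexp) : bool :=
  match b with
  | BLtI e1 e2 => (ieval s e1 < ieval s e2)%N
  | BLtR e1 e2 => reval s e1 < reval s e2
  end.

Definition bcost (b : bexp) : nat :=
  match b with
  | BLtI e1 e2 => (icost e1 + icost e2).+1
  | BLtR e1 e2 => (rcost e1 + rcost e2).+1
  end.

Definition iset s (v m : nat) : store R :=
  Store (fun w => if w == v then m else ireg s w) (rmem s).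

Definition rset s (a i j : nat) (r : R) : store R :=
  Store (ireg s) (fun a' i' j' =>
    if [&& a' == a, i' == i & j' == j] then r else rmem s a' i' j').

(* [exec c s t s'] : started in [s], [c] halts in [s'] after [t] steps. *)
Inductive exec : cmd -> store R -> nat -> store R -> Prop :=
| ExecSkip s : exec Skip s 1 s
| ExecISet s v e : exec (ISet v e) s (icost e).+1 (iset s v (ieval s e))
| ExecRSet s a i j e :
    exec (RSet a i j e) s (icost i + icost j + rcost e).+1
      (rset s a (ieval s i) (ieval s j) (reval s e))
| ExecSeq c1 c2 s s1 s2 t1 t2 :
    exec c1 s t1 s1 -> exec c2 s1 t2 s2 -> exec (Seq c1 c2) s (t1 + t2).+1 s2
| ExecIfTrue b c1 c2 s s1 t :
    beval s b -> exec c1 s t s1 -> exec (If b c1 c2) s (bcost b + t).+1 s1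
| ExecIfFalse b c1 c2 s s1 t :
    ~~ beval s b -> exec c2 s t s1 -> exec (If b c1 c2) s (bcost b + t).+1 s1
| ExecWhileTrue b c s s1 s2 t1 t2 :
    beval s b -> exec c s t1 s1 -> exec (While b c) s1 t2 s2 ->
    exec (While b c) s (bcost b + t1 + t2).+1 s2
| ExecWhileFalse b c s :
    ~~ beval s b -> exec (While b c) s (bcost b).+1 s.

Section InputOutput.
Variable n : nat.

Definition bit (x : cube n) (i : nat) : R :=
  if insub i is Some i' then (x i')%:R else 0.

Definition adj (G : rel 'I_n) (i j : nat) : R :=
  if (insub i, insub j) is (Some i', Some j') then (G i' j')%:R else 0.

(* Index registers 0 and 1 hold n and the number of samples. Array 0 holds the
   sample points (one per row), array 1 their labels (in column 0), array 2 the
   adjacency matrix, array 3 the threshold (in cell (0, 0)). *)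
Definition input_store (S : seq (example n)) (G : rel 'I_n) (tau : R) : store R :=
  let z j := nth ([ffun=> false], false) S j in
  Store (fun v => match v with 0 => n | 1 => size S | _ => 0 end)
    (fun a i j => match a with
       | 0 => bit (z i).1 j
       | 1 => if j == 0 then ((z i).2)%:R else 0
       | 2 => adj G i j
       | 3 => if (i == 0) && (j == 0) then tau else 0
       | _ => 0
       end).

Definition load_query s (x : cube n) : store R :=
  Store (ireg s) (fun a i j => if a == 4 then bit x j else rmem s a i j).

Definition answer s : R := rmem s 5 0 0.

(* A hypothesis is returned as the final memory of [learn], from which the
   program [predict] evaluates it at any given point. *)
Definition implements_within (learn predict : cmd) (S : seq (example n))
    (G : rel 'I_n) (tau T : R) : Prop :=
  exists t s h,
    [/\ exec learn (input_store S G tau) t s, t%:R <= T,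
        learn_junta S G tau h &
        forall x : cube n, exists t' s',
          [/\ exec predict (load_query s x) t' s', t'%:R <= T &
              answer s' = (h x)%:R]].

End InputOutput.
End Semantics.

Lemma ltN_self (R : realType) (a : R) (a0 : 0 < a) : - a < a.
Proof. by rewrite (lt_trans _ a0)// oppr_lt0. Qed.

Definition iid_uniform (R : realType) (n : nat) (sigma : R) (sigma0 : 0 < sigma)
    (disp : measure_display) (Omega : measurableType disp)
    (P : probability Omega R) (alpha : 'I_n -> {RV P >-> R}) : Prop :=
  (forall i (A : set R), measurable A ->
     distribution P (alpha i) A = uniform_prob (ltN_self sigma0) A) /\
  (forall A : 'I_n -> set R, (forall i, measurable (A i)) ->
     P [set w | forall i, A i (alpha i w)]%classic =
     (\prod_(i < n) fine (P (alpha i @^-1` A i)%classic))%:E).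

(* The joint probability, over alpha and then over N samples drawn independently
   given alpha, that every possible output of the algorithm equals f. *)
Definition success_probability (R : realType) (n N : nat) (psibar : mpoly n R)
    (G : rel 'I_n) (f : {ffun cube n -> bool}) (tau : R)
    (disp : measure_display) (Omega : measurableType disp)
    (P : probability Omega R) (alpha : 'I_n -> {RV P >-> R}) : \bar R :=
  (\int[P]_w
     (\sum_(S : N.-tuple (cube n * bool) | [forall h, learn_junta S G tau h ==> (h == f)])
        iid (labelled (mrf (smoothed psibar (fun i => alpha i w))) f) S)%:E)%E.

Definition learns_within (R : realType) (learn predict : cmd) (n k d : nat)
    (lambda sigma : R) (sigma0 : 0 < sigma) (delta tau : R) (N : nat) (T : R) : Prop :=
  forall (psibar : mpoly n R) (G : rel 'I_n) (f : {ffun cube n -> bool}),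
    multilinear psibar ->
    (forall i, norm1 (mderiv i psibar) <= lambda) ->
    simple_graph G -> max_degree_le G d ->
    (forall alpha : 'I_n -> R, (forall i, - sigma <= alpha i <= sigma) ->
       dependency_graph (mrf (smoothed psibar alpha)) G) ->
    is_junta k f ->
    (forall S : N.-tuple (cube n * bool), implements_within learn predict S G tau T) /\
    (forall (disp : measure_display) (Omega : measurableType disp)
       (P : probability Omega R) (alpha : 'I_n -> {RV P >-> R}),
       iid_uniform sigma0 alpha ->
       ((1 - delta)%:E <= success_probability N psibar G f tau alpha)%E).

Definition sample_bound (R : realType) (p : mpoly 5 R) (n k d : nat)
    (lambda sigma delta : R) : R :=
  eval5 p (ln n%:R) (expR (lambda * (d + k)%N%:R)) (2 ^+ (d + k)%N) (sigma ^- k) delta^-1.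

(* Main.v *)
Require Import Defs.
From mathcomp Require Import -(notations) mpoly.
From mathcomp Require Import all_boot all_order all_algebra.
From mathcomp Require Import all_classical all_reals all_analysis.
From mathcomp Require Import zify ring lra.

(* Given X_{N(i)} = rho, the coordinate X_i is independent of the others, so the
   conditional covariance of f and X_i is Var(X_i | rho) E[D_i f | rho], where
   D_i f = f(x_i = 1) - f(x_i = 0). It vanishes if f does not depend on x_i.
   Otherwise choose rho compatible with a point where D_i f <> 0. Up to its
   normalization, E[D_i f | rho] is a multilinear polynomial in the at most k
   variables 1 + alpha_j with j relevant, and one of its coefficients is large.
   For a linear polynomial a + b y of a uniform y, the mean of (1 + |a + b y|)^{-1/2}
   is at most K (1 + |a|)^{-1/2} and K (1 + |b|)^{-1/2} with K = O(sigma^{-1/2}).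
   Eliminating one variable at a time bounds the mean of (1 + |P|/t)^{-1/2} for
   the polynomial P, and by Markov's inequality P is rarely small.

   To avoid products of measures, alpha is replaced by the lower corner of its
   cell in a fine uniform grid, so that all averages are finite sums; the error is
   a factor tending to 1 with the mesh. Hoeffding's inequality then gives the
   empirical covariances and shows that all patterns on the relevant coordinates
   are sampled, which determines the empirical risk minimizer. *)

(** Eliminating variables by a union bound, each step keeping a fraction of order sigma eps / k of
    the coefficient except with probability eps / k, would put 1/delta to the power k into the
    sample size. A negative moment loses only a constant factor K per variable and is converted into
    a probability once, so delta enters with a fixed exponent. The power -1/2 is integrable at 0,
    and K^2 = O(1/sigma) is what yields sigma^{-k}. The moment is taken relative to a scale t that
    must not depend on the variables being eliminated, whereas the mass of the restriction does.
    Hence t is built from the mass computed with those variables set to 1, which is within a factor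
    2^k of the true mass. A grid average behaves like an integral only if one grid step changes a +
    b y by a bounded amount. This is the condition sigma |b| <= M that accompanies the averaging
    lemmas; M is chosen last and does not enter the final bounds. *)

Import Order.TTheory GRing.Theory Num.Theory.
Local Open Scope ring_scope.

Set Implicit Arguments.
Unset Strict Implicit.
Unset Printing Implicit Defensive.

(** * The program *)

Section Programs.
Variable R : realType.
Implicit Types (s : store R) (Q : store R -> Prop).

(** Total correctness with a time budget. The budget is an upper bound, so costs can be rounded up
    at every composition. *)
Definition runs (c : cmd) s (T : nat) Q : Prop :=
  exists t s', [/\ exec c s t s', (t <= T)%N & Q s'].

Lemma runs_weaken (c : cmd) s (T T' : nat) Q Q' :
  runs c s T Q -> (T <= T')%N -> (forall s', Q s' -> Q' s') -> runs c s T' Q'.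
Proof.
move=> [t [s' [ex tT Qs]]] TT' QQ'; exists t, s'; split => //.
- exact: leq_trans TT'.
- exact: QQ'.
Qed.

Lemma runs_skip s Q : Q s -> runs Skip s 1 Q.
Proof. by move=> Qs; exists 1%N, s; split => //; constructor. Qed.

Lemma runs_iset s v e Q :
  Q (iset s v (ieval s e)) -> runs (ISet v e) s (icost e).+1 Q.
Proof.
by move=> Qs; exists (icost e).+1, (iset s v (ieval s e)); split => //; constructor.
Qed.

Lemma runs_rset s a i j e Q :
  Q (rset s a (ieval s i) (ieval s j) (reval s e)) ->
  runs (RSet a i j e) s (icost i + icost j + rcost e).+1 Q.
Proof.
by move=> Qs; do 2 eexists; split; [constructor|exact: leqnn|exact: Qs].
Qed.

Lemma runs_seq c1 c2 s (T1 T2 : nat) Q1 Q :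
  runs c1 s T1 Q1 -> (forall s1, Q1 s1 -> runs c2 s1 T2 Q) ->
  runs (Seq c1 c2) s (T1 + T2).+1 Q.
Proof.
move=> [t1 [s1 [ex1 tT1 Qs1]]] H2; have [t2 [s2 [ex2 tT2 Qs2]]] := H2 _ Qs1.
exists (t1 + t2).+1, s2; split => //; last by rewrite ltnS leq_add.
exact: ExecSeq ex1 ex2.
Qed.

Lemma runs_if b c1 c2 s (T : nat) Q :
  (beval s b -> runs c1 s T Q) -> (~~ beval s b -> runs c2 s T Q) ->
  runs (If b c1 c2) s (bcost b + T).+1 Q.
Proof.
move=> H1 H2; case: (boolP (beval s b)) => hb.
- have [t [s' [ex tT Qs]]] := H1 hb; exists (bcost b + t).+1, s'.
  by split => //; [exact: ExecIfTrue|rewrite ltnS leq_add2l].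
- have [t [s' [ex tT Qs]]] := H2 hb; exists (bcost b + t).+1, s'.
  by split => //; [exact: ExecIfFalse|rewrite ltnS leq_add2l].
Qed.

Definition For (r B : nat) (body : cmd) : cmd :=
  Seq (ISet r (INum 0))
    (While (BLtI (IReg r) (IReg B)) (Seq body (ISet r (IAdd (IReg r) (INum 1))))).

(** A round costs 9 besides its body: 4 for the guard and the loop, 1 for sequencing, 4 for the
    increment. The remaining 7 are the initial assignment, one sequencing step and the failing
    guard. The invariant is stated at the loop head and pins the counter, which the body must return
    unchanged. *)
Lemma runs_for (I : nat -> store R -> Prop) (r B m T : nat) body s :
  (forall k s', I k s' -> ireg s' r = k /\ ireg s' B = m) ->
  I 0%N (iset s r 0) ->
  (forall k s', (k < m)%N -> I k s' ->
     runs body s' T (fun s'' => ireg s'' r = k /\ I k.+1 (iset s'' r k.+1))) ->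
  runs (For r B body) s (m * (T + 9) + 7) (I m).
Proof.
move=> Ireg I0 Istep.
have loop k s' : (k <= m)%N -> I k s' ->
  runs (While (BLtI (IReg r) (IReg B)) (Seq body (ISet r (IAdd (IReg r) (INum 1)))))
    s' ((m - k) * (T + 9) + 4) (I m).
  move: {2}(m - k)%N (erefl (m - k)%N) => u.
  elim: u k s' => [|u IH] k s' hu km Ik; have [hr hB] := Ireg _ _ Ik.
    have -> : k = m by lia.
    rewrite subnn; exists 4%N, s'; split => //.
      by apply: (@ExecWhileFalse R (BLtI (IReg r) (IReg B))) => /=; rewrite hr hB; lia.
    by have <- : k = m by lia.
  have klm : (k < m)%N by lia.
  have [t [s1 [ex tT [hr1 Ik1]]]] := Istep _ _ klm Ik.
  have hu' : (m - k.+1)%N = u by lia.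
  have [t2 [s2 [ex2 tT2 Im]]] := IH k.+1 (iset s1 r k.+1) hu' klm Ik1.
  exists (3 + (t + 4).+1 + t2).+1, s2; split => //; last by nia.
  apply: (@ExecWhileTrue R (BLtI (IReg r) (IReg B))) ex2 => /=.
    by rewrite hr hB.
  apply: ExecSeq ex _.
  have -> : iset s1 r k.+1 = iset s1 r (ieval s1 (IAdd (IReg r) (INum 1))).
    by rewrite /= hr1 addn1.
  exact: (ExecISet _ _ (IAdd (IReg r) (INum 1))).
apply: (@runs_weaken _ _ (2 + (m * (T + 9) + 4)).+1 _ (I m)) => //; last lia.
apply: (@runs_seq _ _ _ 2 _ (I 0%N)); first exact: (runs_iset (e := INum 0)).
by move=> s1 I1; have := loop 0%N s1 (leq0n _) I1; rewrite subn0.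
Qed.

(** Frame condition: only the listed registers and arrays may have changed. *)
Definition same (rs arrs : seq nat) s s' : Prop :=
  (forall v, v \notin rs -> ireg s' v = ireg s v) /\
  (forall a, a \notin arrs -> forall i j, rmem s' a i j = rmem s a i j).

Lemma same_trans rs arrs s1 s2 s3 :
  same rs arrs s1 s2 -> same rs arrs s2 s3 -> same rs arrs s1 s3.
Proof.
move=> [r1 m1] [r2 m2]; split=> [v vr|a am i j]; first by rewrite r2 ?r1.
by rewrite m2 ?m1.
Qed.

Lemma same_sub rs arrs rs' arrs' s s' :
  {subset rs <= rs'} -> {subset arrs <= arrs'} ->
  same rs arrs s s' -> same rs' arrs' s s'.
Proof.
move=> sr sa [r m]; split=> [v vr|a aa]; first by apply: r; apply: contra vr; apply: sr.
by apply: m; apply: contra aa; apply: sa.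
Qed.

Lemma same_iset rs arrs s s' v k :
  v \in rs -> same rs arrs s s' -> same rs arrs s (iset s' v k).
Proof.
move=> vr [r m]; split=> // w wr /=; rewrite r//.
by case: eqP => // wv; rewrite wv vr in wr.
Qed.

Lemma same_rset rs arrs s s' a i j x :
  a \in arrs -> same rs arrs s s' -> same rs arrs s (rset s' a i j x).
Proof.
move=> ar [r m]; split=> // b br i' j' /=; rewrite m//.
by case: eqP => // ba; rewrite ba ar in br.
Qed.

Local Notation i0 := (INum 0).

(** A conjunction is a product of factors 1 - e with e in {0, 1}. A sum over matching samples then
    becomes an unfiltered sum with 0/1 factors, without branching. *)
Definition flag_prog (e : rexp) : cmd :=
  Seq (RSet 8 i0 i0 (RNum 1))
    (For 5 0 (RSet 8 i0 i0 (RMul (RGet 8 i0 i0) (RSub (RNum 1) e)))).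

Lemma runs_flag e s (E : nat -> R) (m : nat) :
  ireg s 0 = m ->
  (forall s', same [:: 5] [:: 8] s s' -> reval s' e = E (ireg s' 5)) ->
  runs (flag_prog e) s (12 + m * (rcost e + 18))
    (fun s' => same [:: 5] [:: 8] s s' /\ rmem s' 8 0 0 = \prod_(j < m) (1 - E j)).
Proof.
move=> sm He.
set Q1 := fun s' => same [:: 5] [:: 8] s s' /\ rmem s' 8 0 0 = 1.
apply: (@runs_weaken _ _ (4 + (m * ((rcost e + 9) + 9) + 7)).+1 _
   (fun s' => ireg s' 5 = m /\ same [:: 5] [:: 8] s s' /\ rmem s' 8 0 0 = \prod_(j < m) (1 - E j)));
  [|lia|by move=> s' []].
apply: (@runs_seq _ _ _ 4 _ Q1); first by apply: runs_rset; split=> //; exact: same_rset.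
move=> s1 [sm1 v1].
apply: (@runs_for (fun k s' => ireg s' 5 = k /\ same [:: 5] [:: 8] s s' /\ rmem s' 8 0 0 = \prod_(j < k) (1 - E j))).
- by move=> k s' [h5 [[hr _] _]]; split => //; rewrite hr.
- split => //; split; first exact: same_iset.
  by rewrite /= v1 big_ord0.
- move=> k s' km [h5 [hs hv]].
  apply: (runs_weaken (T := (1 + 1 + rcost (RMul (RGet 8 i0 i0) (RSub (RNum 1) e))).+1));
    [|by move=> /=; lia|move=> s'' H; exact: H].
  apply: runs_rset; split => //; split => //; split.
    by apply: same_iset => //; apply: same_rset.
  by rewrite /= hv He// h5 big_ord_recr.
Qed.

Fixpoint zeros_prog (m : nat) : cmd :=
  if m is m'.+1 then Seq (zeros_prog m') (RSet 7 (INum m') i0 (RNum 0)) else Skip.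

Lemma runs_zeros m s :
  runs (zeros_prog m) s (5 * m + 1)
    (fun s' => same [::] [:: 7] s s' /\ forall c, (c < m)%N -> rmem s' 7 c 0 = 0).
Proof.
elim: m => [|m IH]; first exact: runs_skip.
apply: (@runs_weaken _ _ ((5 * m + 1) + 4).+1); [|by lia|move=> s'; apply].
apply: runs_seq IH _ => s1 [hs hz].
apply: (runs_rset (i := INum m) (j := i0) (e := RNum 0)); split.
  exact: same_rset.
move=> c; rewrite ltnS leq_eqVlt /= => /orP[/eqP->|cm]; first by rewrite !eqxx.
by rewrite hz// ltn_eqF.
Qed.

(** Unrolled rather than looped: the number m of sums is fixed with the program (4 in [learn_cmd], 1
    in [predict_cmd]), and each sum has its own expression as weight. *)
Fixpoint adds_prog (m : nat) (w : nat -> rexp) : cmd :=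
  if m is m'.+1 then
    Seq (adds_prog m' w)
      (RSet 7 (INum m') i0 (RAdd (RGet 7 (INum m') i0) (RMul (RGet 8 i0 i0) (w m'))))
  else Skip.

Lemma runs_adds m (w : nat -> rexp) s (W : nat -> R) :
  (forall s' c, (c < m)%N -> same [::] [:: 7] s s' -> reval s' (w c) = W c) ->
  runs (adds_prog m w) s (\sum_(c < m) (rcost (w c) + 12) + 1)
    (fun s' => same [::] [:: 7] s s' /\
       (forall c, (c < m)%N -> rmem s' 7 c 0 = rmem s 7 c 0 + rmem s 8 0 0 * W c) /\
       (forall c, (m <= c)%N -> rmem s' 7 c 0 = rmem s 7 c 0)).
Proof.
elim: m => [|m IH] hw; first by apply: (runs_weaken (runs_skip _)); [|lia|move=> s'; apply].
have {}IH := IH (fun s' c cm => hw s' c (ltnW cm)).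
apply: (@runs_weaken _ _ ((\sum_(c < m) (rcost (w c) + 12) + 1) + (rcost (w m) + 11)).+1);
  [|by rewrite big_ord_recr /=; lia|move=> s'; apply].
apply: runs_seq IH _ => s1 [hs [hz hz']].
apply: (runs_weaken (T := (1 + 1 + rcost (RAdd (RGet 7 (INum m) i0) (RMul (RGet 8 i0 i0) (w m)))).+1));
  [|by move=> /=; lia|move=> s'' H; exact: H].
apply: runs_rset; split; first exact: same_rset.
rewrite /= (hw s1 m)// (hs.2 8)// hz'//; split => c.
  rewrite ltnS leq_eqVlt => /orP[/eqP->|cm]; first by rewrite !eqxx.
  by rewrite hz// ltn_eqF.
by move=> mc; rewrite gtn_eqF//= hz'// ltnW.
Qed.

Definition acc_prog (e : rexp) (m : nat) (w : nat -> rexp) : cmd :=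
  Seq (zeros_prog m) (For 4 1 (Seq (flag_prog e) (adds_prog m w))).

Definition acc_cost (e : rexp) (m : nat) (w : nat -> rexp) (n N : nat) : nat :=
  5 * m + 9 + N * (n * (rcost e + 18) + \sum_(c < m) (rcost (w c) + 12) + 23).

(** The hypotheses on [e] and [w] cover every store that can occur during the accumulation; their
    values there may depend only on the loop indices in registers 4 and 5. *)
Lemma runs_acc e m w s (E W : nat -> nat -> R) (n N : nat) :
  ireg s 0 = n -> ireg s 1 = N ->
  (forall s', same [:: 4; 5] [:: 7; 8] s s' ->
     reval s' e = E (ireg s' 4) (ireg s' 5)) ->
  (forall s' c, (c < m)%N -> same [:: 4; 5] [:: 7; 8] s s' ->
     reval s' (w c) = W c (ireg s' 4)) ->
  runs (acc_prog e m w) s (acc_cost e m w n N)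
    (fun s' => same [:: 4; 5] [:: 7; 8] s s' /\
       forall c, (c < m)%N ->
         rmem s' 7 c 0 = \sum_(b < N) (\prod_(j < n) (1 - E b j)) * W c b).
Proof.
move=> sn sN hE hW.
pose I k s' := ireg s' 4 = k /\ (same [:: 4; 5] [:: 7; 8] s s' /\
  forall c, (c < m)%N ->
    rmem s' 7 c 0 = \sum_(b < k) (\prod_(j < n) (1 - E b j)) * W c b).
pose T1 := (12 + n * (rcost e + 18) + (\sum_(c < m) (rcost (w c) + 12) + 1)).+1.
apply: (@runs_weaken _ _ ((5 * m + 1) + (N * (T1 + 9) + 7)).+1 _ (I N));
  [|by rewrite /acc_cost /T1; nia|by move=> s' []].
apply: runs_seq (runs_zeros _ _) _ => s1 [hs1 hz1].
have hs1' : same [:: 4; 5] [:: 7; 8] s s1.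
  by apply: same_sub hs1 => // x; rewrite !inE => ->.
apply: (@runs_for I).
- by move=> k s' [h4 [[hr _] _]]; split => //; rewrite hr.
- split => //; split; first exact: same_iset.
  by move=> c cm /=; rewrite hz1// big_ord0.
- move=> k s' km [h4 [hs hv]].
  have [hr hm] := hs.
  apply: runs_seq.
    apply: (@runs_flag _ _ (E k)); first by rewrite hr.
    move=> s2 hs2; rewrite hE.
      by rewrite (hs2.1 4)// h4.
    by apply: same_trans hs _; apply: same_sub hs2 => x; rewrite !inE => ->; rewrite ?orbT.
  move=> s2 [hs2 hf].
  have hs2' : same [:: 4; 5] [:: 7; 8] s s2.
    by apply: same_trans hs _; apply: same_sub hs2 => x; rewrite !inE => ->; rewrite ?orbT.
  have h42 : ireg s2 4 = k by rewrite (hs2.1 4).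
  apply: (runs_weaken (runs_adds (W := fun c => W c k) _)) => //.
    move=> s3 c cm hs3; rewrite hW//.
      by rewrite (hs3.1 4)// h42.
    by apply: same_trans hs2' _; apply: same_sub hs3 => x; rewrite !inE => // ->; rewrite ?orbT.
  move=> s3 [hs3 [hv3 _]]; split; first by rewrite (hs3.1 4).
  split => //; split.
    apply: same_iset => //.
    by apply: same_trans hs2' _; apply: same_sub hs3 => x; rewrite !inE => // ->; rewrite ?orbT.
  move=> c cm /=; rewrite hv3// (hs2.2 7)// hv// hf big_ord_recr//=.
Qed.

End Programs.

(** On bits this is 1 if they differ and 0 otherwise. *)
Definition sq_diff (e1 e2 : rexp) : rexp := RMul (RSub e1 e2) (RSub e1 e2).

(* Registers 2, 3, 4, 5 are the loop indices i, a, b, j: variable i is tested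
   against the restriction given by sample a on the neighbours of i. All other
   restrictions match no sample, hence have influence 0. Array 6 receives the
   indicator of Rel, array 7 the accumulated sums, and array 8 the indicator,
   a product over j, that sample b matches the restriction. *)
Definition learn_mismatch : rexp :=
  RMul (RGet 2 (IReg 2) (IReg 5))
    (sq_diff (RGet 0 (IReg 3) (IReg 5)) (RGet 0 (IReg 4) (IReg 5))).

Definition learn_weight (c : nat) : rexp :=
  match c with
  | 0 => RNum 1
  | 1 => RGet 1 (IReg 4) (INum 0)
  | 2 => RGet 0 (IReg 4) (IReg 2)
  | _ => RMul (RGet 1 (IReg 4) (INum 0)) (RGet 0 (IReg 4) (IReg 2))
  end.

Definition average_exp (c : nat) : rexp :=
  RDiv (RGet 7 (INum c) (INum 0)) (RGet 7 (INum 0) (INum 0)).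

Definition covariance_exp : rexp :=
  RSub (average_exp 3) (RMul (average_exp 1) (average_exp 2)).

Definition mark_relevant : cmd := RSet 6 (IReg 2) (INum 0) (RNum 1).

Definition threshold_exp : rexp := RGet 3 (INum 0) (INum 0).

(** The influence is an absolute value, so the covariance is compared with the threshold under both
    signs. *)
Definition test_restriction : cmd :=
  Seq (acc_prog learn_mismatch 4 learn_weight)
    (If (BLtR threshold_exp covariance_exp) mark_relevant
      (If (BLtR threshold_exp (RSub (RNum 0) covariance_exp)) mark_relevant Skip)).

Definition learn_cmd : cmd :=
  For 2 0 (Seq (RSet 6 (IReg 2) (INum 0) (RNum 0)) (For 3 1 test_restriction)).

Definition predict_mismatch : rexp :=
  RMul (RGet 6 (IReg 5) (INum 0))
    (sq_diff (RGet 4 (INum 0) (IReg 5)) (RGet 0 (IReg 4) (IReg 5))).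

(** A label counts as a vote 1 or -1, and the sign of the sum gives the majority among the samples
    that agree with the query on [Rel]. *)
Definition predict_weight (c : nat) : rexp :=
  RSub (RMul (RNum 2) (RGet 1 (IReg 4) (INum 0))) (RNum 1).

Definition predict_cmd : cmd :=
  Seq (acc_prog predict_mismatch 1 predict_weight)
    (If (BLtR (RNum 0) (RGet 7 (INum 0) (INum 0)))
      (RSet 5 (INum 0) (INum 0) (RNum 1)) (RSet 5 (INum 0) (INum 0) (RNum 0))).

(** * Correctness and cost of the two programs *)

Section ProgramCorrectness.
Variables (R : realType) (n : nat).
Implicit Types (S : seq (example n)) (G : rel 'I_n) (V : {set 'I_n}) (x : cube n).

Lemma bitE x (j : 'I_n) : bit R x j = (x j)%:R.
Proof. by rewrite /bit valK. Qed.

Lemma prod_mismatch (E : nat -> R) (p u v : 'I_n -> bool) :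
  (forall j : 'I_n, E j = (p j)%:R * (((u j)%:R - (v j)%:R) * ((u j)%:R - (v j)%:R))) ->
  \prod_(j < n) (1 - E j) = [forall j, p j ==> (v j == u j)]%:R.
Proof.
move=> hE; case: forallP => [H|H].
  apply: big1 => j _; rewrite hE; have /implyP := H j.
  case: (p j); last by rewrite !mul0r subr0.
  by move=> /(_ isT)/eqP->; rewrite subrr !mulr0 subr0.
have /existsP[j] : [exists j, ~~ (p j ==> (v j == u j))].
  by rewrite -negb_forall; apply/forallP.
rewrite negb_imply (bigD1 j)//= hE => /andP[-> ].
case: (u j); case: (v j) => //= _;
by rewrite ?(subr0, sub0r, mulrNN, mul1r, subrr, mul0r).
Qed.

(** The default element is the one of [input_store], so that memory and list access agree at every
    index. *)
Definition nth_example S (b : nat) : example n := nth ([ffun=> false], false) S b.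

Lemma sum_examples S (P : pred (example n)) (F W : nat -> R) (g : example n -> R) :
  (forall b : nat, F b = (P (nth_example S b))%:R) ->
  (forall b : nat, W b = g (nth_example S b)) ->
  \sum_(b < size S) F b * W b = \sum_(z <- S | P z) g z.
Proof.
move=> hF hW; rewrite (big_nth ([ffun=> false], false)) big_mkord [RHS]big_mkcond /=.
apply: eq_bigr => b _; rewrite hF hW /nth_example.
by case: (P _); rewrite (mul1r, mul0r).
Qed.

Definition project (V : {set 'I_n}) (x : cube n) : restriction n :=
  [ffun j => if j \in V then Some (x j) else None].

Lemma rsupp_project V x : rsupp (project V x) = V.
Proof. by apply/setP => j; rewrite inE ffunE; case: (j \in V). Qed.

Lemma consistent_project V x z : consistent (project V x) z = agree V x z.
Proof.
rewrite /consistent /agree rsupp_project; apply: eq_forallb_in => j jV.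
by rewrite ffunE jV; apply/eqP/eqP => [[->]|->].
Qed.

Lemma consistent_is_project (rho : restriction n) x :
  consistent rho x -> rho = project (rsupp rho) x.
Proof.
move=> /forall_inP H; apply/ffunP => j; rewrite ffunE.
case: ifPn => [/H/eqP//|]; by rewrite inE negbK => /eqP.
Qed.

Lemma influence_outside S i (rho : restriction n) :
  Defs.restrict S rho = [::] -> influence R S i rho = 0.
Proof. by move=> Se; rewrite /influence Se /average !big_nil !mul0r subr0 normr0. Qed.

(** As tau >= 0, a restriction whose influence exceeds it is matched by some sample and is that
    sample's projection. *)
Lemma mem_relevant S G (tau : R) i : 0 <= tau ->
  (i \in find_relevant_variables S G tau) =
  has (fun a => tau < influence R S i (project (nbrs G i) (nth_example S a).1))
      (iota 0 (size S)).
Proof.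
move=> tau0; rewrite inE; apply/existsP/hasP.
- move=> [rho /andP[/eqP supp ltau]].
  have : Defs.restrict S rho != [::].
    by apply: contraTneq ltau => /influence_outside ->; rewrite -leNgt.
  case E : (Defs.restrict S rho) => [//|z r] _.
  have : z \in Defs.restrict S rho by rewrite E inE eqxx.
  rewrite mem_filter => /andP[/consistent_is_project rz zS].
  exists (index z S); first by rewrite mem_iota /= index_mem.
  by rewrite /nth_example nth_index// -supp -rz.
- move=> [a _ ltau]; exists (project (nbrs G i) (nth_example S a).1).
  by rewrite rsupp_project eqxx.
Qed.

Lemma average_restrict S (rho : restriction n) (g : example n -> R) :
  average (Defs.restrict S rho) g =
  (\sum_(z <- S | consistent rho z.1) g z) / \sum_(z <- S | consistent rho z.1) 1.
Proof.
rewrite /average /Defs.restrict !big_filter; congr (_ / _).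
by rewrite size_filter -sum1_count natr_sum.
Qed.

Definition majority S V : {ffun cube n -> bool} :=
  [ffun x => 0 < \sum_(z <- S | agree V x z.1) ((2 * (z.2)%:R - 1) : R)].

Lemma agree_eql V x x' : agree V x x' -> agree V x =1 agree V x'.
Proof.
move=> /forall_inP H y; apply: eq_forallb_in => j jV.
by rewrite (eqP (H _ jV)).
Qed.

Lemma agree_project V x y : agree V x y = (project V x == project V y).
Proof.
apply/forall_inP/eqP => [H|H j jV].
  by apply/ffunP => j; rewrite !ffunE; case: ifP => // /H/eqP->.
by have := congr1 (fun f : restriction n => f j) H; rewrite !ffunE jV => -[->].
Qed.

Lemma majority_depends S V : depends_only V (majority S V).
Proof.
apply/forallP => x; apply/forallP => y; apply/implyP => axy.
by rewrite !ffunE; under eq_bigl => z do rewrite (agree_eql axy).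
Qed.

Lemma depends_onlyP V (h : {ffun cube n -> bool}) :
  reflect (forall x y, agree V x y -> h x = h y) (depends_only V h).
Proof.
apply: (iffP forallP) => [H x y axy|H x].
  by have /forallP/(_ y)/implyP/(_ axy)/eqP := H x.
by apply/forallP => y; apply/implyP => /H->.
Qed.

(** The risk splits over the classes of samples with the same projection to V. A function depending
    only on V is constant on a class, where the majority label makes the fewest errors. *)
Lemma majority_erm S V (g : {ffun cube n -> bool}) : depends_only V g ->
  empirical_risk R S (majority S V) <= empirical_risk R S g.
Proof.
move=> /depends_onlyP dg; have /depends_onlyP dm := majority_depends S V.
rewrite /empirical_risk /average ler_wpM2r ?invr_ge0//.
rewrite (partition_big (fun z : example n => project V z.1) xpredT)//=.
rewrite [leRHS](partition_big (fun z : example n => project V z.1) xpredT)//=.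
apply: ler_sum => rho _.
have [[u pu]|nu] := pselect (exists u, project V u = rho); last first.
  by rewrite !big_pred0// => z; apply/eqP => pz; apply: nu; exists z.1.
have eqh (h : {ffun cube n -> bool}) : (forall x y, agree V x y -> h x = h y) ->
    \sum_(z <- S | project V z.1 == rho) ((h z.1 != z.2)%:R : R) =
    \sum_(z <- S | agree V u z.1) (h u != z.2)%:R.
  move=> dh; rewrite (eq_bigl (fun z : example n => agree V u z.1)); last first.
    by move=> z; rewrite agree_project pu eq_sym.
  by apply: eq_bigr => z az; rewrite (dh _ _ az).
rewrite !eqh// {eqh}.
have [->//|ne] := eqVneq (majority S V u) (g u).
have : majority S V u = (0 < \sum_(z <- S | agree V u z.1) ((2 * (z.2)%:R - 1) : R)).
  by rewrite ffunE.
(* The sum of the votes is the number of errors of answering false minus that of answering true. *)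
have eqd : \sum_(z <- S | agree V u z.1) ((2 * (z.2)%:R - 1) : R) =
  \sum_(z <- S | agree V u z.1) (false != z.2)%:R - \sum_(z <- S | agree V u z.1) (true != z.2)%:R.
  rewrite -sumrB; apply: eq_bigr => z _; case: z.2 => /=; ring.
rewrite eqd; move: ne; case: (majority S V u); case: (g u) => // _ /esym.
  by rewrite subr_gt0 => /ltW.
by move/negbT; rewrite -leNgt subr_le0.
Qed.

Definition learn_round_cost (N : nat) : nat := acc_cost learn_mismatch 4 learn_weight n N + 90.

Section Learn.
Variables (S : seq (example n)) (G : rel 'I_n) (tau : R).
Local Notation N := (size S).
Local Notation init := (input_store S G tau).

Definition infl (i : 'I_n) (a : nat) : R :=
  influence R S i (project (nbrs G i) (nth_example S a).1).

Lemma runs_test_restriction (s : store R) (i : 'I_n) (a : nat) :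
  same [:: 2; 3; 4; 5] [:: 6; 7; 8] init s -> ireg s 2 = i -> ireg s 3 = a ->
  runs test_restriction s (learn_round_cost N)
    (fun s' => same [:: 4; 5] [:: 6; 7; 8] s s' /\
       forall k, rmem s' 6 k 0 =
         if (k == i) && (tau < infl i a) then 1 else rmem s 6 k 0).
Proof.
move=> hs hi ha.
pose E b (j : nat) : R := adj R G i j * ((bit R (nth_example S a).1 j - bit R (nth_example S b).1 j) *
   (bit R (nth_example S a).1 j - bit R (nth_example S b).1 j)).
pose W c b : R := match c with
  | 0 => 1
  | 1 => ((nth_example S b).2)%:R
  | 2 => ((nth_example S b).1 i)%:R
  | _ => ((nth_example S b).2)%:R * ((nth_example S b).1 i)%:R end.
apply: (@runs_weaken R _ _ (acc_cost learn_mismatch 4 learn_weight n N + 80).+1);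
  [|by rewrite /learn_round_cost; lia|move=> s' H; exact: H].
apply: runs_seq.
  apply: (@runs_acc R _ _ _ _ E W).
  - by rewrite hs.1.
  - by rewrite hs.1.
  - move=> s' h'; rewrite /= !h'.2// !hs.2//= (h'.1 2)// hi (h'.1 3)// ha.
    by rewrite /E.
  - by move=> s' [|[|[|[|c]]]] //= _ h'; rewrite ?(h'.2)// ?(hs.2)//= ?(h'.1 2)// ?hi ?bitE.
move=> s1 [hs1 hv].
have hs1' : same [:: 4; 5] [:: 6; 7; 8] s s1.
  by apply: same_sub hs1 => // x; rewrite !inE => /orP[]->; rewrite ?orbT.
have sumE c : (c < 4)%N -> rmem s1 7 c 0 =
    \sum_(z <- S | consistent (project (nbrs G i) (nth_example S a).1) z.1)
      (match c with 0 => 1 | 1 => (z.2)%:R | 2 => (z.1 i)%:R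
       | _ => (z.2)%:R * (z.1 i)%:R end : R).
  move=> c4; rewrite hv//.
  apply: (@sum_examples S (fun z => consistent (project (nbrs G i) (nth_example S a).1) z.1)
    (fun b => \prod_(j < n) (1 - E b j)) (W c)
    (fun z => match c with 0 => 1 | 1 => (z.2)%:R | 2 => (z.1 i)%:R
       | _ => (z.2)%:R * (z.1 i)%:R end)) => b; last by case: c c4 => [|[|[|[|]]]].
  rewrite (@prod_mismatch _ (fun j => j \in nbrs G i) (fun j => (nth_example S a).1 j)
     (fun j => (nth_example S b).1 j)); first by rewrite consistent_project.
  by move=> j; rewrite /E /adj !valK !bitE inE.
have covE : `|reval s1 covariance_exp| = infl i a.
  rewrite /infl /influence /= !average_restrict (sumE 0%N)// (sumE 1%N)// (sumE 2)// (sumE 3)//.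
have tauE : reval s1 threshold_exp = tau by rewrite /= hs1.2// hs.2.
have hmark T : (4 <= T)%N -> tau < infl i a -> runs mark_relevant s1 T (fun s' => same [:: 4; 5] [:: 6; 7; 8] s s' /\
       forall k, rmem s' 6 k 0 =
         if (k == i) && (tau < infl i a) then 1 else rmem s 6 k 0).
  move=> hT lt; apply: (fun H => @runs_weaken R _ _ 4 T _ _ H hT (fun s' => id)).
  apply: runs_rset; split; first exact: same_rset.
  by move=> k /=; rewrite lt andbT (hs1.1 2)// hi andbT (hs1.2 6).
apply: (fun H1 H2 H3 => @runs_weaken R _ _ _ 80 _ _ (@runs_if R _ _ _ _ 40 _ H1 H2) H3 (fun s' => id)); last by rewrite /=; lia.
  rewrite /beval tauE => lt; apply: hmark => //.
  by rewrite -covE (lt_le_trans lt)// ler_norm.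
rewrite /beval tauE -leNgt => le1.
apply: (fun H1 H2 H3 => @runs_weaken R _ _ _ 40 _ _ (@runs_if R _ _ _ _ 4 _ H1 H2) H3 (fun s' => id)); last by rewrite /=; lia.
  rewrite /beval tauE [reval s1 (RSub _ _)]/= sub0r => lt; apply: hmark => //.
  by rewrite -covE (lt_le_trans lt)// -normrN ler_norm.
rewrite /beval tauE [reval s1 (RSub _ _)]/= sub0r -leNgt => le2.
apply: (@runs_weaken R _ _ 1 4 _ _ _ _ (fun s' => id)) => //.
apply: runs_skip; split => // k.
have -> : (tau < infl i a) = false.
  by apply/negbTE; rewrite -leNgt -covE ler_norml; apply/andP; split; [rewrite lerNl|].
by rewrite andbF (hs1.2 6).
Qed.

Definition learn_cost : nat := n * (N * (learn_round_cost N + 9) + 21) + 7.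

Lemma runs_learn : 0 <= tau ->
  runs learn_cmd init learn_cost
    (fun s' => same [:: 2; 3; 4; 5] [:: 6; 7; 8] init s' /\
       forall j : 'I_n, rmem s' 6 j 0 = (j \in find_relevant_variables S G tau)%:R).
Proof.
move=> tau0.
pose I k s' := ireg s' 2 = k /\ (same [:: 2; 3; 4; 5] [:: 6; 7; 8] init s' /\
  forall j : 'I_n, (j < k)%N -> rmem s' 6 j 0 = (j \in find_relevant_variables S G tau)%:R).
apply: (@runs_weaken R _ _ (n * ((4 + (N * (learn_round_cost N + 9) + 7)).+1 + 9) + 7) _ (I n)).
- apply: (@runs_for R I).
  + by move=> k s' [h2 [hs _]]; rewrite (hs.1 0%N).
  + by split => //; split => //; exact: same_iset.
  move=> k s' kn [h2 [hs hrel]].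
  pose i := Ordinal kn.
  apply: runs_seq.
    apply: (@runs_rset R _ _ _ _ _ (fun s1 => same [:: 3; 4; 5] [:: 6; 7; 8] s' s1 /\
       forall j, rmem s1 6 j 0 = if j == i then 0 else rmem s' 6 j 0)).
    split; first exact: same_rset.
    by move=> j; rewrite /= h2 andbT.
  move=> s1 [hs1 hv1].
  (* Inner invariant: cell i of array 6 records whether one of the first a samples has already given
     an influence above the threshold. *)
  pose J a s2 := ireg s2 3 = a /\ (same [:: 3; 4; 5] [:: 6; 7; 8] s' s2 /\
    forall j, rmem s2 6 j 0 = if j == i then (has (fun a => tau < infl i a) (iota 0 a))%:R
       else rmem s' 6 j 0).
  have sub : forall s2, same [:: 3; 4; 5] [:: 6; 7; 8] s' s2 -> same [:: 2; 3; 4; 5] [:: 6; 7; 8] init s2.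
    move=> s2 h; apply: same_trans hs _; apply: same_sub h => // x.
    by rewrite !inE; lia.
  apply: (@runs_weaken R _ _ (N * (learn_round_cost N + 9) + 7) _ (J N)) => //.
  + apply: (@runs_for R J).
    * by move=> a s2 [h3 [h _]]; rewrite (h.1 1%N)// (hs.1 1%N).
    * by split => //; split => //; exact: same_iset.
    move=> a s2 aN [h3 [h hv]].
    have h22 : ireg s2 2 = i by rewrite h.1.
    apply: (runs_weaken (runs_test_restriction (sub _ h) h22 h3)) => // s3 [hs3 hv3].
    split; first by rewrite hs3.1.
    split => //; split.
      apply: same_iset => //; apply: same_trans h _; apply: same_sub hs3 => // x.
      by rewrite !inE; lia.
    move=> j; rewrite -[a.+1]addn1 iotaD has_cat /= hv3 hv orbF add0n.
    case: eqP => //= ji.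
    by case: (tau < _); rewrite ?orbT ?orbF.
  move=> s2 [h3 [h hv]]; split; first by rewrite h.1.
  split => //; split; first exact/same_iset/sub.
  move=> j jk /=; rewrite hv.
  case: eqP => [ji|ji].
    have -> : j = i by apply: val_inj.
    by rewrite mem_relevant.
  by apply: hrel; move: jk; rewrite ltnS leq_eqVlt => /orP[/eqP|//].
- by rewrite /learn_cost; lia.
- by move=> s' [_ [hs H]]; split => // j; apply: H.
Qed.

Definition predict_cost : nat := acc_cost predict_mismatch 1 predict_weight n N + 20.

Lemma runs_predict (s : store R) V (x : cube n) :
  same [:: 2; 3; 4; 5] [:: 6; 7; 8] init s ->
  (forall j : 'I_n, rmem s 6 j 0 = (j \in V)%:R) ->
  runs predict_cmd (load_query s x) predict_cost
    (fun s' => answer s' = (majority S V x)%:R).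
Proof.
move=> hs hV.
pose E b (j : nat) : R := rmem s 6 j 0 * ((bit R x j - bit R (nth_example S b).1 j) *
   (bit R x j - bit R (nth_example S b).1 j)).
pose W (c b : nat) : R := 2 * ((nth_example S b).2)%:R - 1.
apply: (@runs_weaken R _ _ (acc_cost predict_mismatch 1 predict_weight n N + 15).+1);
  [|by rewrite /predict_cost; lia|move=> s' H; exact: H].
apply: runs_seq.
  apply: (@runs_acc R _ _ _ _ E W).
  - by rewrite /= hs.1.
  - by rewrite /= hs.1.
  - by move=> s' h'; rewrite /= !h'.2//= (hs.2 0%N).
  - by move=> s' c _ h'; rewrite /= (h'.2 1%N)//= (hs.2 1%N).
move=> s1 [hs1 hv].
have sumE : rmem s1 7 0 0 = \sum_(z <- S | agree V x z.1) ((2 * (z.2)%:R - 1) : R).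
  rewrite hv//; apply: (@sum_examples _ (fun z : example n => agree V x z.1)
    (fun b => \prod_(j < n) (1 - E b j)) (W 0%N) (fun z : example n => 2 * (z.2)%:R - 1)) => // b.
  apply: (@prod_mismatch _ (fun j => j \in V) (fun j => x j)
     (fun j => (nth_example S b).1 j)).
  by move=> j; rewrite /E hV !bitE.
apply: (fun H1 H2 H3 => @runs_weaken R _ _ _ 15 _ _ (@runs_if R _ _ _ _ 4 _ H1 H2) H3 (fun s' => id)); last (by rewrite /=; lia);
  rewrite /= sumE => lt; apply: (@runs_weaken R _ _ 4 4 _ _ _ _ (fun s' => id)) => //;
  apply: runs_rset; rewrite /answer /= ffunE ?lt//.
by rewrite (negbTE lt).
Qed.

End Learn.

Theorem implements_learn_junta (S : seq (example n)) (G : rel 'I_n) (tau T : R) :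
  0 <= tau ->
  (learn_cost S)%:R <= T -> (predict_cost S)%:R <= T ->
  implements_within learn_cmd predict_cmd S G tau T.
Proof.
move=> tau0 T1 T2.
have [t [s [ex tT [hs hrel]]]] := runs_learn S G tau0.
exists t, s, (majority S (find_relevant_variables S G tau)); split => //.
- by apply: le_trans T1; rewrite ler_nat.
- apply/andP; split; first exact: majority_depends.
  by apply/forallP => g; apply/implyP => dg; apply: majority_erm.
- move=> x; have [t' [s' [ex' tT' ans]]] := runs_predict x hs hrel.
  by exists t', s'; split => //; apply: le_trans T2; rewrite ler_nat.
Qed.

(** Each of the n N pairs of a variable and a sample costs one pass over the N samples and their n
    coordinates. The summands 1 absorb lower-order terms, and 400 is a generous bound for the
    constants. *)
Lemma program_costs (S : seq (example n)) :
  (learn_cost S <= 400 * ((1 + n) ^ 2 * (1 + size S) ^ 2))%N /\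
  (predict_cost S <= 400 * ((1 + n) ^ 2 * (1 + size S) ^ 2))%N.
Proof.
rewrite /learn_cost /predict_cost /learn_round_cost /acc_cost !big_ord_recr !big_ord0 /=.
move: (size S) => N; split; nia.
Qed.

End ProgramCorrectness.

(** * Hoeffding's inequality on finite sample spaces *)

Section Hoeffding.
Variables (R : realType) (Z : finType).

(** Independence of the samples: it gives the total mass 1 of a sample distribution as well as the
    factorization of the exponential moment. *)
Lemma sum_tuple_prod (N : nat) (F : Z -> R) :
  \sum_(S : N.-tuple Z) \prod_(j < N) F (tnth S j) = (\sum_z F z) ^+ N.
Proof.
transitivity (\prod_(j < N) \sum_z F z); last by rewrite prodr_const card_ord.
rewrite bigA_distr_bigA /=.
rewrite (reindex (fun f : {ffun 'I_N -> Z} => [tuple f j | j < N])) /=; last first.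
  exists (fun S : N.-tuple Z => [ffun j => tnth S j]) => [f _|S _].
    by apply/ffunP => j; rewrite ffunE tnth_mktuple.
  by apply: eq_from_tnth => j; rewrite tnth_mktuple ffunE.
by apply: eq_bigr => f _; apply: eq_bigr => j _; rewrite tnth_mktuple.
Qed.

(** From exp (-y) >= 1 - y one gets exp y <= 1 / (1 - y), and (1 + y + 2 y^2) (1 - y) - 1 = y^2 (1 -
    2 y) is nonnegative. *)
Lemma expR_le_quadratic (y : R) : `|y| <= 2^-1 -> expR y <= 1 + y + 2 * y ^+ 2.
Proof.
rewrite ler_norml => /andP[y1 y2].
have h : 1 - y <= expR (- y) by have := expR_ge1Dx (- y); lra.
have e : expR y * expR (- y) = 1 by rewrite -expRD subrr expR0.
have ey := expR_gt0 y.
have h1 : expR y * (1 - y) <= 1 by rewrite -[leRHS]e ler_wpM2l ?expR_ge0.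
have h2 : 1 <= (1 + y + 2 * y ^+ 2) * (1 - y).
  rewrite -subr_ge0.
  have -> : (1 + y + 2 * y ^+ 2) * (1 - y) - 1 = y ^+ 2 * (1 - 2 * y) by ring.
  by apply: mulr_ge0; [exact: sqr_ge0|lra].
have p : 0 < 1 - y by lra.
by rewrite -(ler_pM2r p) (le_trans h1).
Qed.

Variable D : Z -> R.
Hypotheses (D0 : forall z, 0 <= D z) (D1 : \sum_z D z = 1).

Lemma chernoff_bound (N : nat) (X : Z -> R) (eps : R) :
  (forall z, `|X z| <= 1) -> \sum_z D z * X z = 0 -> 0 < eps <= 2 ->
  \sum_(S : N.-tuple Z | N%:R * eps <= \sum_(j < N) X (tnth S j))
     \prod_(j < N) D (tnth S j) <= expR (- (N%:R * eps ^+ 2 / 8)).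
Proof.
(* This t minimizes the exponent - t eps + 2 t^2, with value - eps^2 / 8; eps <= 2 keeps t within
   the range of [expR_le_quadratic]. *)
move=> X1 X0 /andP[e0 e2]; pose t := eps / 4.
have t0 : 0 < t by rewrite /t; lra.
have mgf : \sum_z D z * expR (t * X z) <= expR (2 * t ^+ 2).
  apply: (@le_trans _ _ (\sum_z (D z + t * (D z * X z) + D z * (2 * t ^+ 2)))).
    apply: ler_sum => z _; have := X1 z => Xz.
    have -> : D z + t * (D z * X z) + D z * (2 * t ^+ 2) =
       D z * (1 + t * X z + 2 * t ^+ 2) by ring.
    rewrite ler_wpM2l//.
    apply: (le_trans (expR_le_quadratic _)).
      rewrite normrM (gtr0_norm t0); apply: (@le_trans _ _ (t * 1)).
        by rewrite ler_pM2l.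
      by rewrite /t; lra.
    have : X z ^+ 2 <= 1 by rewrite -real_normK ?num_real// expr_le1.
    by rewrite exprMn => X2; have := sqr_ge0 t; nra.
  rewrite !big_split /= -mulr_sumr X0 mulr0 addr0 -mulr_suml D1 mul1r.
  exact: expR_ge1Dx.
apply: (@le_trans _ _ (expR (- (t * (N%:R * eps))) *
    \sum_(S : N.-tuple Z) \prod_(j < N) (D (tnth S j) * expR (t * X (tnth S j))))).
  rewrite mulr_sumr big_mkcond /=; apply: ler_sum => S _.
  have P0 : 0 <= \prod_(j < N) D (tnth S j) by apply: prodr_ge0.
  rewrite big_split /= -expR_sum -mulr_sumr; case: ifPn => h; last first.
    by rewrite !mulr_ge0 ?expR_ge0.
  rewrite mulrCA -expRD ler_peMr// -[leLHS]expR0 ler_expR addrC subr_ge0.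
  by rewrite ler_pM2l.
rewrite (@sum_tuple_prod N (fun z => D z * expR (t * X z))).
apply: (@le_trans _ _ (expR (- (t * (N%:R * eps))) * expR (2 * t ^+ 2) ^+ N)).
  rewrite ler_wpM2l ?expR_ge0// lerXn2r ?nnegrE ?expR_ge0//.
  by apply: sumr_ge0 => z _; rewrite mulr_ge0 ?expR_ge0.
rewrite -expRM_natl -expRD ler_expR /t.
by rewrite le_eqVlt; apply/orP; left; apply/eqP; field.
Qed.

Lemma hoeffding (N : nat) (h : Z -> R) (eps : R) :
  (forall z, 0 <= h z <= 1) -> 0 < eps <= 2 ->
  \sum_(S : N.-tuple Z | N%:R * eps <= `|\sum_(j < N) h (tnth S j) - N%:R * \sum_z D z * h z|)
     \prod_(j < N) D (tnth S j) <= 2 * expR (- (N%:R * eps ^+ 2 / 8)).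
Proof.
move=> h01 e02; pose m := \sum_z D z * h z.
have m01 : 0 <= m <= 1.
  rewrite /m sumr_ge0/=; last by move=> z _; rewrite mulr_ge0//; case/andP: (h01 z).
  rewrite -D1; apply: ler_sum => z _; rewrite -[leRHS]mulr1 ler_wpM2l//.
  by case/andP: (h01 z).
have bnd z : `|h z - m| <= 1.
  by have /andP[? ?] := h01 z; case/andP: m01 => ? ?; rewrite ler_norml; lra.
have mean : \sum_z D z * (h z - m) = 0.
  under eq_bigr do rewrite mulrBr.
  by rewrite sumrB -mulr_suml D1 mul1r subrr.
have c1 := @chernoff_bound N (fun z => h z - m) eps bnd mean e02.
have c2 : \sum_(S : N.-tuple Z | N%:R * eps <= \sum_(j < N) (m - h (tnth S j)))
     \prod_(j < N) D (tnth S j) <= expR (- (N%:R * eps ^+ 2 / 8)).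
  apply: (@chernoff_bound N (fun z => m - h z)) => //.
    by move=> z; rewrite distrC.
  transitivity (- \sum_z D z * (h z - m)); last by rewrite mean oppr0.
  rewrite -sumrN; apply: eq_bigr => z _; ring.
have -> : 2 * expR (- (N%:R * eps ^+ 2 / 8)) =
  expR (- (N%:R * eps ^+ 2 / 8)) + expR (- (N%:R * eps ^+ 2 / 8)) by ring.
apply: le_trans (lerD c1 c2).
rewrite big_mkcond [X in _ <= X + _]big_mkcond [X in _ <= _ + X]big_mkcond -big_split /=.
apply: ler_sum => S _.
have P0 : 0 <= \prod_(j < N) D (tnth S j) by apply: prodr_ge0.
rewrite !sumrB !sumr_const !card_ord -/m -[m *+ N]mulr_natl.
rewrite ler_normr opprB.
do 3 case: ifPn => //=; rewrite ?addr0 ?add0r ?lerDl// => *; lra.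
Qed.

End Hoeffding.

(** * Conditional covariances under a dependency graph *)

Lemma ler_sum_uniq_sub (R : realType) (I : eqType) (s t : seq I) (F : I -> R) :
  uniq s -> uniq t -> {subset s <= t} -> (forall i, 0 <= F i) ->
  \sum_(i <- s) F i <= \sum_(i <- t) F i.
Proof.
move=> us ut st F0; elim: s t us ut st => [|x s IH] t us ut st.
  by rewrite big_nil sumr_ge0.
move: us => /= /andP[xs us]; have xt : x \in t by apply: st; rewrite inE eqxx.
rewrite big_cons [leRHS](big_rem x)//=.
rewrite lerD2l; apply: IH => //; first exact: rem_uniq.
move=> y ys; rewrite mem_rem_uniq// !inE st ?inE ?ys ?orbT// andbT.
by apply: contraNneq xs => <-.
Qed.

Section Cube.
Variable n : nat.
Implicit Types (x u : cube n) (i j : 'I_n) (V : {set 'I_n}).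

Definition set_coord x i (b : bool) : cube n := [ffun j => if j == i then b else x j].

Definition flipc i x : cube n := set_coord x i (~~ x i).

Lemma flipc_i i x : flipc i x i = ~~ x i.
Proof. by rewrite ffunE eqxx. Qed.

Lemma flipc_ne i j x : j != i -> flipc i x j = x j.
Proof. by rewrite ffunE => /negbTE->. Qed.

Lemma flipcK i : involutive (flipc i).
Proof.
move=> x; apply/ffunP => j; have [->|ji] := eqVneq j i; first by rewrite !flipc_i negbK.
by rewrite !flipc_ne.
Qed.

Lemma agreeP V (x z : cube n) : reflect (forall j, j \in V -> z j = x j) (agree V x z).
Proof. by apply: (iffP forall_inP) => H j jV; apply/eqP; rewrite H. Qed.

Lemma agree_flipc V x i u : i \notin V -> agree V x (flipc i u) = agree V x u.
Proof.
move=> iV; apply: eq_forallb_in => j jV; rewrite flipc_ne//.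
by apply: contraNneq iV => <-.
Qed.

Lemma agreeU V V' x u : agree (V :|: V') x u = agree V x u && agree V' x u.
Proof.
apply/agreeP/andP => [H|[/agreeP H1 /agreeP H2] j].
  by split; apply/agreeP => j jV; apply: H; rewrite inE jV ?orbT.
by rewrite inE => /orP[/H1|/H2].
Qed.

Lemma agree1 i x u : agree [set i] x u = (u i == x i).
Proof.
apply/agreeP/eqP => [H|H j]; first by apply: H; rewrite inE.
by rewrite inE => /eqP->.
Qed.

Lemma agree_refl V x : agree V x x.
Proof. by apply/agreeP. Qed.

Lemma agree_sub V V' x u : V \subset V' -> agree V' x u -> agree V x u.
Proof. by move=> /fintype.subsetP s /agreeP H; apply/agreeP => j /s/H. Qed.

End Cube.

Section FlipBound.
Variables (R : realType) (n : nat) (mu : cube n -> R) (L : R).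
Implicit Types (x u : cube n) (i j : 'I_n) (V : {set 'I_n}).
Hypotheses (mu0 : forall x, 0 <= mu x) (L0 : 0 <= L).
Hypothesis muL : forall i x, mu (flipc i x) <= L * mu x.

Lemma sum_flipc (P : pred (cube n)) i (F : cube n -> R) :
  (forall u, P (flipc i u) = P u) ->
  \sum_(u | P u) F u = \sum_(u | P u && u i) (F u + F (flipc i u)).
Proof.
move=> hP; rewrite (bigID (fun u : cube n => u i)) /= [RHS]big_split /=; congr (_ + _).
rewrite (reindex_inj (inv_inj (flipcK i))) /=; apply: eq_bigl => u.
by rewrite hP flipc_i negbK.
Qed.

(** The half of the event where u j differs from x j is carried by the flip onto the other half,
    whose mass therefore accounts for it up to the factor L. *)
Lemma prob_agree_step V x j :
  prob mu (agree V x) <= (1 + L) * prob mu (agree (j |: V) x).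
Proof.
have [jV|jV] := boolP (j \in V).
  rewrite (_ : j |: V = V); last first.
    by apply/setP => l; rewrite !inE; case: eqP => // ->.
  by rewrite ler_peMl ?lerDl// sumr_ge0.
rewrite /prob (bigID (fun u : cube n => u j == x j)) /= mulrDl mul1r.
have e : \sum_(u | agree V x u && (u j == x j)) mu u = \sum_(u | agree (j |: V) x u) mu u.
  by apply: eq_bigl => u; rewrite agreeU agree1 andbC.
rewrite e lerD2l -e (reindex_inj (inv_inj (flipcK j))) /= mulr_sumr.
rewrite (eq_bigl (fun u => agree V x u && (u j == x j))); last first.
  by move=> u; rewrite agree_flipc// flipc_i; case: (u j); case: (x j).
by apply: ler_sum.
Qed.

Lemma prob_agree_ge V (s : {set 'I_n}) x :
  (1 + L)^-1 ^+ #|s| * prob mu (agree V x) <= prob mu (agree (s :|: V) x).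
Proof.
have L1 : 0 < 1 + L by rewrite ltr_pwDl.
rewrite cardE (_ : s :|: V = [set j in enum s] :|: V); last first.
  by apply/setP => j; rewrite !inE mem_enum.
elim: (enum s) => [|j r IH] /=.
  rewrite expr0 mul1r (_ : _ :|: V = V)//.
  by apply/setP => j; rewrite !inE.
rewrite exprS -mulrA ler_pdivrMl//.
apply: le_trans IH _.
rewrite (_ : [set j0 in j :: r] :|: V = j |: ([set j0 in r] :|: V)).
  exact: prob_agree_step.
by apply/setP => i; rewrite !inE orbA.
Qed.

End FlipBound.

Section Covariance.
Variables (R : realType) (n : nat) (mu : cube n -> R) (G : rel 'I_n).
Implicit Types (x u : cube n).
Hypotheses (mu_gt0 : forall x, 0 < mu x) (irrG : irreflexive G).
Hypothesis depG : dependency_graph mu G.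

Lemma prob_agree_gt0 V x : 0 < prob mu (agree V x).
Proof.
rewrite /prob (bigD1 x) ?agree_refl//= ltr_pwDl//.
by apply: sumr_ge0 => u _; exact: ltW.
Qed.

(** The events in [dependency_graph] are small: agreement on i, its neighbours and the rest singles
    out x, and without i it leaves x and [flipc i x]. Clearing the denominators gives the
    identity. *)
Lemma dependency_product i x :
  mu x * prob mu (agree (nbrs G i) x) =
  prob mu (agree (i |: nbrs G i) x) * (mu x + mu (flipc i x)).
Proof.
have iN : i \notin nbrs G i by rewrite inE irrG.
have predIE (A B : pred (cube n)) u : [predI A & B] u = A u && B u by [].
have := depG i x; rewrite /cprob /=.
have p0 := prob_agree_gt0 (nbrs G i) x.
set P := prob mu (agree _ x) in p0 *.
have -> : prob mu [predI [predI agree [set i] x & agree (~: (i |: nbrs G i)) x] & agree (nbrs G i) x] = mu x.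
  rewrite /prob (big_pred1 x)// => u; rewrite !predIE -!agreeU.
  apply/agreeP/eqP => [H|->//]; apply/ffunP => j; apply: H.
  by rewrite !inE; case: (j == i); case: (G i j).
have -> : prob mu [predI agree [set i] x & agree (nbrs G i) x] = prob mu (agree (i |: nbrs G i) x).
  by apply: eq_bigl => u; rewrite agreeU predIE.
have -> : prob mu [predI agree (~: (i |: nbrs G i)) x & agree (nbrs G i) x] = mu x + mu (flipc i x).
  rewrite /prob (eq_bigl (agree (~: [set i]) x)); last first.
    move=> u; rewrite predIE -agreeU; congr agree; apply/setP => j; rewrite !inE.
    by case: eqP => [->|_]; rewrite ?irrG//; case: (G i j).
  rewrite (bigD1 x) ?agree_refl//= (big_pred1 (flipc i x))// => u /=.
  apply/andP/eqP => [[/agreeP H ux]|->].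
    apply/ffunP => j; have [->|ji] := eqVneq j i.
      rewrite flipc_i; case: (boolP (u i == x i)) => [/eqP h|]; last by case: (u i); case: (x i).
      case/eqP: ux; apply/ffunP => l; have [->//|li] := eqVneq l i.
      by apply: H; rewrite !inE.
    by rewrite flipc_ne//; apply: H; rewrite !inE.
  rewrite agree_flipc ?agree_refl ?inE ?eqxx//; split=> //.
  by apply/eqP => /ffunP/(_ i); rewrite flipc_i; case: (x i).
move=> /(congr1 (fun t => t * (P * P))).
by rewrite mulrA divfK ?gt_eqF// mulf_div divfK ?mulf_neq0 ?gt_eqF.
Qed.

Definition derivative (f : cube n -> bool) i u : R :=
  (f (set_coord u i true))%:R - (f (set_coord u i false))%:R.

Lemma derivative_flipc f i u : derivative f i (flipc i u) = derivative f i u.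
Proof.
by congr ((f _)%:R - (f _)%:R); apply/ffunP => j; rewrite !ffunE; case: eqP.
Qed.

Lemma derivativeE f i u : u i -> derivative f i u = (f u)%:R - (f (flipc i u))%:R.
Proof.
move=> ui; congr ((f _)%:R - (f _)%:R); apply/ffunP => j; rewrite !ffunE.
  by case: eqP => [->|].
by rewrite ui.
Qed.

Lemma covariance_derivative (f : cube n -> bool) i x :
  let A := agree (nbrs G i) x in
  let p := prob mu A in
  (\sum_(u | A u) mu u * ((f u)%:R * (u i)%:R)) / p
    - (\sum_(u | A u) mu u * (f u)%:R) / p * ((\sum_(u | A u) mu u * (u i)%:R) / p) =
  (prob mu [pred u | A u & u i] / p) * (prob mu [pred u | A u & ~~ u i] / p) *
  ((\sum_(u | A u) mu u * derivative f i u) / p).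
Proof.
move=> A p.
have iN : i \notin nbrs G i by rewrite inE irrG.
have hA u : A (flipc i u) = A u by rewrite /A agree_flipc.
have p0 : 0 < p by apply: prob_agree_gt0.
set m1 := prob mu [pred u | A u & u i]; set m0 := prob mu [pred u | A u & ~~ u i].
have pE : p = m1 + m0 by rewrite /p /prob (bigID (fun u : cube n => u i)).
(* By [dependency_product], every pair u, [flipc i u] in A shares its mass in the same ratio m1 :
   m0. With r as the common factor, all sums below run over the points where the i-th bit is
   true. *)
pose r u := (mu u + mu (flipc i u)) / p.
have mu1 u : A u -> u i -> mu u = m1 * r u /\ mu (flipc i u) = m0 * r u.
  move=> Au ui.
  have pu : prob mu (agree (nbrs G i) u) = p.
    by apply: eq_bigl => v; rewrite /A !agree_project; move: Au; rewrite /A agree_project => /eqP->.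
  have e1 : prob mu (agree (i |: nbrs G i) u) = m1.
    apply: eq_bigl => v; rewrite agreeU agree1 ui /= andbC; congr (_ && _); last by case: (v i).
    by rewrite /A !agree_project; move: Au; rewrite /A agree_project => /eqP->.
  have h1 : mu u = m1 * r u.
    have := dependency_product i u; rewrite pu e1 => h.
    by rewrite /r mulrA -h mulfK// gt_eqF.
  split => //.
  have h2 : mu u + mu (flipc i u) = p * r u by rewrite /r mulrC divfK// gt_eqF.
  by move: h2; rewrite pE mulrDl -h1 => /addrI.
pose P1 u := A u && u i.
pose a := \sum_(u | P1 u) r u * (f u)%:R.
pose b := \sum_(u | P1 u) r u * (f (flipc i u))%:R.
have ui0 u : u i -> flipc i u i = false by rewrite flipc_i => ->.
have -> : \sum_(u | A u) mu u * ((f u)%:R * (u i)%:R) = m1 * a.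
  rewrite (sum_flipc _ hA) mulr_sumr; apply: eq_bigr => u /andP[Au ui].
  by have [-> _] := mu1 u Au ui; rewrite ui0// ui mulr1 !mulr0 addr0 mulrA.
have -> : \sum_(u | A u) mu u * (f u)%:R = m1 * a + m0 * b.
  rewrite (sum_flipc _ hA) !mulr_sumr -big_split; apply: eq_bigr => u /andP[Au ui].
  by have [-> ->] := mu1 u Au ui; rewrite /= !mulrA.
have -> : \sum_(u | A u) mu u * (u i)%:R = m1.
  rewrite (sum_flipc _ hA); apply: eq_bigr => u /andP[Au ui].
  by rewrite ui0// ui mulr1 mulr0 addr0.
have -> : \sum_(u | A u) mu u * derivative f i u = p * (a - b).
  rewrite (sum_flipc _ hA) /a /b -sumrB mulr_sumr; apply: eq_bigr => u /andP[Au ui].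
  have [-> ->] := mu1 u Au ui.
  by rewrite derivative_flipc derivativeE// pE; ring.
(* With p = m1 + m0, the difference p m1 a - (m1 a + m0 b) m1 equals m1 m0 (a - b). *)
by rewrite pE; field; rewrite -pE gt_eqF.
Qed.

Variable L : R.
Hypotheses (L0 : 0 <= L) (muL : forall i x, mu (flipc i x) <= L * mu x).

Lemma conditional_coord_ge i x (b : bool) :
  (1 + L)^-1 <= prob mu [pred u | agree (nbrs G i) x u & u i == b]
                 / prob mu (agree (nbrs G i) x).
Proof.
have iN : i \notin nbrs G i by rewrite inE irrG.
have p0 := prob_agree_gt0 (nbrs G i) x.
rewrite ler_pdivlMr//.
have := @prob_agree_ge R n mu L (fun u => ltW (mu_gt0 u)) L0 muL (nbrs G i) [set i] (set_coord x i b).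
rewrite cards1 expr1.
have agx u : agree (nbrs G i) (set_coord x i b) u = agree (nbrs G i) x u.
  apply: eq_forallb_in => j jN; rewrite ffunE ifN//.
  by apply: contraNneq iN => ji; rewrite -[X in X \in _]ji.
rewrite (_ : prob mu (agree (nbrs G i) (set_coord x i b)) = prob mu (agree (nbrs G i) x)); last exact: eq_bigl.
move=> /le_trans; apply; rewrite le_eqVlt; apply/orP; left; apply/eqP.
by apply: eq_bigl => u /=; rewrite agreeU agree1 ffunE eqxx agx andbC.
Qed.

Lemma covariance_ge (f : cube n -> bool) i x :
  let A := agree (nbrs G i) x in
  let p := prob mu A in
  (1 + L)^-1 ^+ 2 * `|(\sum_(u | A u) mu u * derivative f i u) / p| <=
  `|(\sum_(u | A u) mu u * ((f u)%:R * (u i)%:R)) / p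
    - (\sum_(u | A u) mu u * (f u)%:R) / p * ((\sum_(u | A u) mu u * (u i)%:R) / p)|.
Proof.
rewrite /= covariance_derivative [leRHS]normrM ler_wpM2r//.
have k0 : 0 <= (1 + L)^-1 by rewrite invr_ge0 addr_ge0.
have h1 := conditional_coord_ge i x true; have h0 := conditional_coord_ge i x false.
have e1 : prob mu [pred u | agree (nbrs G i) x u & u i] = prob mu [pred u | agree (nbrs G i) x u & u i == true].
  by apply: eq_bigl => u /=; case: (u i).
have e0 : prob mu [pred u | agree (nbrs G i) x u & ~~ u i] = prob mu [pred u | agree (nbrs G i) x u & u i == false].
  by apply: eq_bigl => u /=; case: (u i).
rewrite e1 e0 ger0_norm; first by rewrite expr2; apply: ler_pM.
by apply: mulr_ge0; [exact: le_trans k0 h1|exact: le_trans k0 h0].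
Qed.

End Covariance.

(** * Smoothed weights *)

Section Weights.
Variables (R : realType) (n : nat).
Implicit Types (psi : mpoly n R) (x : cube n) (i j : 'I_n) (beta : 'I_n -> R).

(** Only the monomials containing x_i change, each by at most 1. Their coefficients reappear in the
    derivative, multiplied by an exponent that is at least 1. *)
Lemma energy_flipc psi i x :
  `|energy psi (flipc i x) - energy psi x| <= norm1 (mderiv i psi).
Proof.
rewrite /energy !mevalE -sumrB.
pose mon x m : R := \prod_j (x j)%:R ^+ (m : multinom n) j.
have mon01 y m : mon y m = 0 \/ mon y m = 1.
  rewrite /mon; have [/forallP H|] := boolP [forall j, (m j == 0%N) || y j].
    right; apply: big1 => j _; have := H j; case: (y j) => [_|]; first by rewrite expr1n.
    by rewrite orbF => /eqP->.
  rewrite negb_forall => /existsP[j]; rewrite negb_or => /andP[mj yj]; left.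
  by rewrite (bigD1 j)//= (negbTE yj) expr0n (negbTE mj) mul0r.
apply: le_trans (ler_norm_sum _ _ _) _.
apply: (@le_trans _ _ (\sum_(m <- msupp psi | m i != 0%N) `|mcoeff m psi|)).
  rewrite [leRHS]big_mkcond; apply: ler_sum => m _.
  rewrite -mulrBr normrM -/(mon _ m) -/(mon x m); case: ifPn => mi.
    rewrite -[leRHS]mulr1 ler_wpM2l//.
    by case: (mon01 (flipc i x) m) => ->; case: (mon01 x m) => ->;
      rewrite ?subrr ?subr0 ?sub0r ?normrN ?normr0 ?normr1.
  rewrite (_ : mon (flipc i x) m = mon x m) ?subrr ?normr0 ?mulr0//.
  apply: eq_bigr => j _; have [->|ji] := eqVneq j i; last by rewrite flipc_ne.
  by move: mi; rewrite negbK => /eqP->; rewrite !expr0.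
rewrite /norm1.
have subK (m : multinom n) : m i != 0%N -> mnm_add (mnm_sub m (mnm1 i)) (mnm1 i) = m.
  by move=> mi; rewrite submK// lep1mP.
have coef (m : multinom n) : m i != 0%N ->
    mcoeff (mnm_sub m (mnm1 i)) (mderiv i psi) = mcoeff m psi *+ (m i).
  move=> mi; rewrite mcoeff_deriv subK//; congr (_ *+ _).
  by rewrite mnmE mnm1E eqxx subn1 prednK// lt0n.
have step : \sum_(m <- msupp psi | m i != 0%N) `|mcoeff m psi| <=
    \sum_(m <- [seq mnm_sub m (mnm1 i) | m : multinom n <- msupp psi & m i != 0%N]) `|mcoeff m (mderiv i psi)|.
  rewrite [leRHS]big_map big_filter; apply: ler_sum => m mi.
  by rewrite coef// normrMn -mulr_natr ler_peMr// ler1n lt0n.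
apply: (le_trans step); apply: ler_sum_uniq_sub => //.
- rewrite map_inj_in_uniq ?filter_uniq ?msupp_uniq// => m m'.
  rewrite !mem_filter => /andP[mi _] /andP[mi' _] /(congr1 (fun m => mnm_add m (mnm1 i))).
  by rewrite !subK.
- move=> m' /mapP[m]; rewrite mem_filter => /andP[mi ms] ->.
  by rewrite mcoeff_msupp coef// mulrn_eq0 negb_or mi -mcoeff_msupp.
Qed.

(** The unnormalized density with beta_j = 1 + alpha_j = exp Delta_j. In these variables it is a
    polynomial of degree at most 1 in each beta_j, which is why the smoothing is expressed through
    log (1 + alpha). *)
Definition weight psi beta x : R :=
  expR (energy psi x) * \prod_j (if x j then beta j else 1).

Lemma weight_gt0 psi beta x : (forall j, 0 < beta j) -> 0 < weight psi beta x.
Proof.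
move=> b0; rewrite mulr_gt0 ?expR_gt0//; apply: prodr_gt0 => j _.
by case: ifP.
Qed.

Lemma mrf_smoothedE psi (alpha : 'I_n -> R) x : (forall j, 0 < 1 + alpha j) ->
  mrf (smoothed psi alpha) x =
  weight psi (fun j => 1 + alpha j) x / \sum_z weight psi (fun j => 1 + alpha j) z.
Proof.
move=> a0.
have E y : expR (energy (smoothed psi alpha) y) = weight psi (fun j => 1 + alpha j) y.
  rewrite /energy /smoothed /weight mevalD raddf_sum /= expRD; congr (_ * _).
  rewrite expR_sum; apply: eq_bigr => j _; rewrite mevalZ mevalXU.
  by case: (y j); rewrite ?mulr1 ?mulr0 ?expR0 ?lnK ?posrE.
by rewrite /mrf E; congr (_ / _); apply: eq_bigr => y _; rewrite E.
Qed.

(** The flip changes the energy by at most lambda and the product by beta_i or its inverse, which is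
    at most 2. *)
Lemma weight_flipc psi beta lambda i x :
  (forall j, norm1 (mderiv j psi) <= lambda) -> (forall j, 2^-1 <= beta j <= 2) ->
  weight psi beta (flipc i x) <= 2 * expR lambda * weight psi beta x.
Proof.
move=> hl hb; rewrite /weight (bigD1 i)//= [in leRHS](bigD1 i)//= flipc_i.
have -> : \prod_(j < n | j != i) (if flipc i x j then beta j else 1) =
          \prod_(j < n | j != i) (if x j then beta j else 1).
  by apply: eq_bigr => j ji; rewrite flipc_ne.
set P := \prod_(j < n | j != i) _.
have P0 : 0 <= P.
  apply: prodr_ge0 => j _; case: ifP => // _; case/andP: (hb j) => h _.
  by apply: le_trans h.
have e : expR (energy psi (flipc i x)) <= expR lambda * expR (energy psi x).
  rewrite -expRD ler_expR -lerBlDr.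
  by apply: le_trans (hl i); apply: le_trans (energy_flipc _ _ _); exact: ler_norm.
have b : (if ~~ x i then beta i else 1) <= 2 * (if x i then beta i else 1).
  by have /andP[? ?] := hb i; case: (x i) => /=; lra.
have b0 : 0 <= (if ~~ x i then beta i else 1).
  by have /andP[? ?] := hb i; case: (x i) => /=; lra.
rewrite [leRHS](_ : _ = (expR lambda * expR (energy psi x)) *
   ((2 * (if x i then beta i else 1)) * P)); last by ring.
by apply: ler_pM; rewrite ?expR_ge0 ?mulr_ge0// ler_wpM2r.
Qed.

End Weights.

(** * Anti-concentration of multilinear polynomials on a grid *)

Section AntiConcentration.
Variable R : realType.
Implicit Types (a b y h sigma : R).

Lemma ler_of_sqr a b : 0 <= b -> a ^+ 2 <= b ^+ 2 -> a <= b.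
Proof. by move=> b0 h; rewrite leNgt; apply/negP => ba; nra. Qed.

Definition inv_sqrt1 y : R := (Num.sqrt (1 + `|y|))^-1.

(* An odd antiderivative of [inv_sqrt1], up to a factor 2. *)
Definition signed_sqrt y : R :=
  if 0 <= y then Num.sqrt (1 + y) - 1 else 1 - Num.sqrt (1 - y).

Lemma inv_sqrt1_ge0 y : 0 <= inv_sqrt1 y.
Proof. by rewrite invr_ge0 sqrtr_ge0. Qed.

Lemma sqrt1_ge1 y : 0 <= y -> 1 <= Num.sqrt (1 + y).
Proof. by move=> y0; rewrite -[leLHS]sqrtr1 ler_sqrt ?addr_ge0// lerDl. Qed.

Lemma signed_sqrtN y : signed_sqrt (- y) = - signed_sqrt y.
Proof.
rewrite /signed_sqrt oppr_ge0 opprK.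
have [y0|y0|->] := ltgtP y 0; rewrite ?lexx ?oppr0 ?addr0 ?subr0 ?sqrtr1 ?subrr ?oppr0//.
  by rewrite opprB.
by rewrite opprB.
Qed.

Lemma signed_sqrt_ge0 y : 0 <= y -> 0 <= signed_sqrt y.
Proof. by move=> y0; rewrite /signed_sqrt y0 subr_ge0 sqrt1_ge1. Qed.

Lemma signed_sqrt_mono y y' : y <= y' -> signed_sqrt y <= signed_sqrt y'.
Proof.
move=> yy'; have [y0|y0] := leP 0 y.
  by rewrite /signed_sqrt y0 (le_trans y0 yy') lerD2r ler_sqrt; lra.
have [y'0|y'0] := leP 0 y'.
  apply: (@le_trans _ _ 0); last exact: signed_sqrt_ge0.
  by rewrite -oppr_ge0 -signed_sqrtN signed_sqrt_ge0// oppr_ge0 ltW.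
rewrite /signed_sqrt ifN -?ltNge// ifN -?ltNge// lerD2l lerN2 ler_sqrt; lra.
Qed.

Lemma signed_sqrt_incr y h : 0 <= y -> 0 < h <= 2 ->
  h * inv_sqrt1 y <= 4 * (signed_sqrt (y + h) - signed_sqrt y).
Proof.
move=> y0 /andP[h0 h2]; have yh0 : 0 <= y + h by lra.
rewrite /signed_sqrt /inv_sqrt1 y0 yh0 ger0_norm//.
have -> : Num.sqrt (1 + (y + h)) - 1 - (Num.sqrt (1 + y) - 1) =
   Num.sqrt (1 + (y + h)) - Num.sqrt (1 + y) by ring.
have s1 := sqrt1_ge1 y0.
set s := Num.sqrt (1 + y) in s1 *; set r := Num.sqrt (1 + (y + h)).
have es : s ^+ 2 = 1 + y by rewrite sqr_sqrtr// addr_ge0.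
have er : r ^+ 2 = 1 + (y + h) by rewrite sqr_sqrtr//; lra.
have r0 : 0 <= r by apply: sqrtr_ge0.
have rs : s <= r by rewrite ler_sqrt; lra.
rewrite ler_pdivrMr; last lra.
(* Since s >= 1 and h <= 2, r^2 = s^2 + h <= 3 s^2. Then h = (r - s) (r + s) is at most 3 s (r -
   s). *)
have r3 : r <= 2 * s.
  have s20 : 0 <= 2 * s by lra.
  by apply: ler_of_sqr => //; rewrite exprMn er es; lra.
have eh : h = (r - s) * (r + s) by rewrite -subr_sqr er es; ring.
rewrite {1}eh; nra.
Qed.

(** The increment over the step pointing away from 0 suffices, forward for y >= 0 and backward for y
    < 0. The two-sided window covers both cases. *)
Lemma signed_sqrt_incr2 y h : 0 < h <= 2 ->
  h * inv_sqrt1 y <= 4 * (signed_sqrt (y + h) - signed_sqrt (y - h)).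
Proof.
move=> /[dup] hh /andP[h0 h2].
have m1 : signed_sqrt (y - h) <= signed_sqrt y by apply: signed_sqrt_mono; lra.
have m2 : signed_sqrt y <= signed_sqrt (y + h) by apply: signed_sqrt_mono; lra.
have [y0|y0] := leP 0 y.
  apply: le_trans (signed_sqrt_incr y0 hh) _; lra.
have ny0 : 0 <= - y by lra.
have := signed_sqrt_incr ny0 hh.
have -> : - y + h = - (y - h) by ring.
rewrite !signed_sqrtN /inv_sqrt1 normrN; lra.
Qed.

Lemma signed_sqrt_le y : 0 <= y -> signed_sqrt y <= Num.sqrt y.
Proof.
move=> y0; rewrite /signed_sqrt y0 lerBlDr.
apply: ler_of_sqr; first by rewrite addr_ge0 ?sqrtr_ge0.
rewrite sqrrD !sqr_sqrtr//; last lra.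
by have := sqrtr_ge0 y; lra.
Qed.

(** Hoelder continuity of exponent 1/2, from the subadditivity of the square root; the factor 2 is
    for intervals containing 0. *)
Lemma signed_sqrt_range y y' : y <= y' ->
  signed_sqrt y' - signed_sqrt y <= 2 * Num.sqrt (y' - y).
Proof.
wlog y'0 : y y' / 0 <= y' => [hw yy'|yy'].
  have [|y'0] := leP 0 y'; first by move=> /hw; apply.
  have := hw (- y') (- y); rewrite !signed_sqrtN !opprK.
  have -> : - y + y' = y' - y by ring.
  have -> : - signed_sqrt y + signed_sqrt y' = signed_sqrt y' - signed_sqrt y by ring.
  by apply; lra.
have [y0|y0] := leP 0 y.
  have d0 : 0 <= y' - y by lra.
  have := sqrtr_ge0 (y' - y).
  suff : Num.sqrt (1 + y') <= Num.sqrt (1 + y) + Num.sqrt (y' - y).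
    by rewrite /signed_sqrt y0 y'0; lra.
  apply: ler_of_sqr; first by rewrite addr_ge0 ?sqrtr_ge0.
  rewrite sqrrD !sqr_sqrtr//; try lra.
  have : 0 <= Num.sqrt (1 + y) * Num.sqrt (y' - y) by rewrite mulr_ge0 ?sqrtr_ge0.
  lra.
have h1 : signed_sqrt y' <= Num.sqrt (y' - y).
  by apply: le_trans (signed_sqrt_le y'0) _; rewrite ler_sqrt; lra.
have ny0 : 0 <= - y by lra.
have h2 : - signed_sqrt y <= Num.sqrt (y' - y).
  rewrite -signed_sqrtN.
  by apply: le_trans (signed_sqrt_le ny0) _; rewrite ler_sqrt; lra.
lra.
Qed.

Definition gridpt (sigma : R) (M m : nat) : R := - sigma + 2 * sigma * m%:R / M%:R.

Lemma telescope_two_step (F : nat -> R) (M : nat) :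
  \sum_(m < M) (F m.+2 - F m) = F M.+1 + F M - F 1%N - F 0%N.
Proof.
elim: M => [|M IH]; first by rewrite big_ord0; ring.
by rewrite big_ord_recr /= IH; ring.
Qed.

Lemma inv_sqrt1N y : inv_sqrt1 (- y) = inv_sqrt1 y.
Proof. by rewrite /inv_sqrt1 normrN. Qed.

(** Multiplied by the step h, the sum is a Riemann sum. Each term is at most four times an increment
    of [signed_sqrt] over two steps; these telescope, and the range over a length of about 2 sigma b
    is of order sqrt (sigma b). The condition sigma b <= M says h <= 2. *)
Lemma grid_sum_pos (a b sigma : R) (M : nat) : 0 < sigma -> (0 < M)%N ->
  0 < b -> sigma * b <= M%:R ->
  \sum_(m < M) inv_sqrt1 (a + b * (1 + gridpt sigma M m)) <=
  M%:R * (16 / Num.sqrt (sigma * b)).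
Proof.
move=> s0 M0 b0 bM; have MR : 0 < M%:R :> R by rewrite ltr0n.
pose h := 2 * (sigma * b) / M%:R.
have sb : 0 < sigma * b by rewrite mulr_gt0.
have h02 : 0 < h <= 2.
  apply/andP; split; first by rewrite divr_gt0// mulr_gt0.
  by rewrite ler_pdivrMr//; lra.
have /andP[h0 h2] := h02.
pose y0 := a + b * (1 - sigma).
have yE m : a + b * (1 + gridpt sigma M m) = y0 + m%:R * h.
  by rewrite /gridpt /y0 /h; field; rewrite gt_eqF.
pose F k := signed_sqrt (y0 - h + k%:R * h).
have le1 : h * \sum_(m < M) inv_sqrt1 (a + b * (1 + gridpt sigma M m)) <=
    4 * (F M.+1 + F M - F 1%N - F 0%N).
  rewrite -telescope_two_step !mulr_sumr; apply: ler_sum => m _.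
  apply: le_trans (signed_sqrt_incr2 _ h02) _; rewrite yE /F.
  have -> : y0 + m%:R * h + h = y0 - h + m.+2%:R * h by rewrite -addn2 natrD; ring.
  by have -> : y0 + m%:R * h - h = y0 - h + m%:R * h by ring.
have mono k l : (k <= l)%N -> F k <= F l.
  by move=> kl; apply: signed_sqrt_mono; rewrite lerD2l ler_wpM2r ?ler_nat// ltW.
have rng : F M.+1 - F 0%N <= 2 * Num.sqrt (M.+1%:R * h).
  have := @signed_sqrt_range (y0 - h + 0%:R * h) (y0 - h + M.+1%:R * h).
  have -> : y0 - h + M.+1%:R * h - (y0 - h + 0%:R * h) = M.+1%:R * h by ring.
  apply; rewrite lerD2l ler_wpM2r ?ler_nat//; exact: ltW.
have mM := mono M M.+1 (leqnSn M); have m01 := mono 0%N 1%N isT.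
have s4 : Num.sqrt (M.+1%:R * h) <= 2 * Num.sqrt (sigma * b).
  have -> : 2 * Num.sqrt (sigma * b) = Num.sqrt (4 * (sigma * b)).
    rewrite [RHS]sqrtrM//; congr (_ * _).
    by rewrite (_ : 4 = 2 ^+ 2 :> R) ?sqrtr_sqr ?ger0_norm// -natrX.
  rewrite ler_sqrt; last by rewrite mulr_ge0// ltW.
  have -> : 4 * (sigma * b) = (M%:R + M%:R) * h by rewrite /h; field; rewrite gt_eqF.
  by rewrite ler_wpM2r ?(ltW h0)// -natrD ler_nat; lia.
have sq : Num.sqrt (sigma * b) ^+ 2 = sigma * b by rewrite sqr_sqrtr// ltW.
have sq0 : 0 < Num.sqrt (sigma * b) by rewrite sqrtr_gt0.
rewrite -(ler_pM2l h0); apply: (le_trans le1).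
set s := Num.sqrt (sigma * b) in s4 sq sq0 *.
(* 32 = 4 (increments) times 2 (two-step telescoping) times 2 ([signed_sqrt_range]) times 2 (M + 1
   <= 4 M / 2). *)
have -> : h * (M%:R * (16 / s)) = 32 * s.
  by rewrite /h -sq; field; rewrite !gt_eqF.
lra.
Qed.

(** Half of it is 16 sqrt (2 / sigma), which turns the bound 16 / sqrt (sigma |b|) into one by (1 +
    |b|)^{-1/2} when |b| > 1, as 1 + |b| <= 2 |b|. The other factor 2 is a reserve for the intercept
    estimate. *)
Definition growth sigma : R := Num.sqrt (8 * 16 ^+ 2 / sigma).

Section Grid.
Variables (sigma : R) (M : nat).
Hypotheses (s0 : 0 < sigma) (s2 : sigma < 2^-1) (M0 : (0 < M)%N).

Lemma growth_gt0 : 0 < growth sigma.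
Proof. by rewrite sqrtr_gt0 divr_gt0// mulr_gt0// exprn_gt0. Qed.

Lemma growth_sqr : growth sigma ^+ 2 = 8 * 16 ^+ 2 / sigma.
Proof. by rewrite sqr_sqrtr// divr_ge0 ?(ltW s0)// mulr_ge0// sqr_ge0. Qed.

Lemma le_inv_sqrt1 (c y y' : R) : 0 <= c -> 1 + `|y'| <= c ^+ 2 * (1 + `|y|) ->
  inv_sqrt1 y <= c * inv_sqrt1 y'.
Proof.
move=> c0 H; rewrite /inv_sqrt1.
have p1 : 0 < Num.sqrt (1 + `|y|) by rewrite (lt_le_trans ltr01)// sqrt1_ge1.
have p2 : 0 < Num.sqrt (1 + `|y'|) by rewrite (lt_le_trans ltr01)// sqrt1_ge1.
rewrite -[leLHS]mul1r ler_pdivrMr// mulrAC ler_pdivlMr// mul1r.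
apply: ler_of_sqr; first by rewrite mulr_ge0// ltW.
by rewrite exprMn !sqr_sqrtr ?addr_ge0.
Qed.

Lemma gridpt_bounds m : (m < M)%N -> - sigma <= gridpt sigma M m <= sigma - 2 * sigma / M%:R.
Proof.
move=> mM; have MR : 0 < M%:R :> R by rewrite ltr0n.
rewrite /gridpt lerDl divr_ge0 ?mulr_ge0 ?(ltW s0) ?(ltW MR)//=.
rewrite -lerBrDl [leRHS](_ : _ = 2 * sigma * (M%:R - 1) / M%:R); last by field; rewrite gt_eqF.
rewrite ler_wpM2r ?invr_ge0 ?(ltW MR)// ler_wpM2l ?mulr_ge0 ?(ltW s0)//.
by rewrite lerBrDr natr1 ler_nat.
Qed.

(** For |b| <= 1 the right side exceeds the trivial bound 1 on each term; otherwise [grid_sum_pos]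
    applies, up to a reflection of the sign. *)
Lemma grid_avg_slope (a b : R) : sigma * `|b| <= M%:R ->
  \sum_(m < M) inv_sqrt1 (a + b * (1 + gridpt sigma M m)) <=
  M%:R * (growth sigma / 2 * inv_sqrt1 b).
Proof.
move: (s0) (s2) => sg0 sg2 bM.
have [q qE q1] : exists2 q : R, 16 ^+ 2 = q & 1 <= q.
  by exists (16 ^+ 2) => //; rewrite expr_ge1// ler1n.
have K2 : 2 * 1 <= growth sigma.
  rewrite mulr1; apply: ler_of_sqr; rewrite ?(ltW growth_gt0)// growth_sqr.
  by rewrite qE ler_pdivlMr//; lra.
have [b1|b1] := leP `|b| 1.
  have avg1 (F : 'I_M -> R) (C : R) : (forall m, F m <= C) -> \sum_(m < M) F m <= M%:R * C.
    by move=> H; rewrite mulr_natl -[X in _ *+ X]card_ord -sumr_const; apply: ler_sum.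
  apply: avg1 => m; apply: le_inv_sqrt1; first by rewrite divr_ge0// ltW// growth_gt0.
  rewrite exprMn growth_sqr; have := normr_ge0 (a + b * (1 + gridpt sigma M m)).
  set t := `|_|; set u := `|b| in b1 *; move=> t0.
  have : 2 <= 8 * q / sigma * 2^-1 ^+ 2.
    have -> : 8 * q / sigma * 2^-1 ^+ 2 = 2 * q / sigma by field; rewrite gt_eqF.
    by rewrite ler_pdivlMr//; lra.
  by rewrite qE; set c := _ * 2^-1 ^+ 2; move=> c2; nra.
have b0 : 0 < `|b| by lra.
apply: (@le_trans _ _ (M%:R * (16 / Num.sqrt (sigma * `|b|)))).
  have [bp|bn] := leP 0 b.
    by rewrite ger0_norm// in b1 bM b0 *; exact: grid_sum_pos.
  rewrite ltr0_norm// in b1 bM b0 *.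
  have := @grid_sum_pos (- a) (- b) sigma M s0 M0 b0 bM.
  apply: le_trans; rewrite le_eqVlt; apply/orP; left; apply/eqP.
  by apply: eq_bigr => m _; rewrite -inv_sqrt1N opprD mulNr.
rewrite ler_wpM2l// /inv_sqrt1.
have p1 : 0 < Num.sqrt (sigma * `|b|) by rewrite sqrtr_gt0 mulr_gt0.
have p2 : 0 < Num.sqrt (1 + `|b|) by rewrite sqrtr_gt0; lra.
rewrite ler_pdivrMr// mulrAC ler_pdivlMr//.
have K0 : 0 <= growth sigma / 2 by rewrite divr_ge0// ltW// growth_gt0.
apply: ler_of_sqr; first by rewrite mulr_ge0// ltW.
have e1 : Num.sqrt (1 + `|b|) ^+ 2 = 1 + `|b| by rewrite sqr_sqrtr//; lra.
have e2 : Num.sqrt (sigma * `|b|) ^+ 2 = sigma * `|b| by rewrite sqr_sqrtr// mulr_ge0// ltW.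
rewrite !exprMn growth_sqr e1 e2.
rewrite qE.
have -> : 8 * q / sigma * 2^-1 ^+ 2 * (sigma * `|b|) = 2 * q * `|b| by field; rewrite gt_eqF.
nra.
Qed.

(** If |b| >= |a| / 4, the slope estimate applies and its spare factor 1/2 pays for replacing b by
    a. Otherwise the perturbation is below |a| / 2, so every single term is small enough. *)
Lemma grid_avg_intercept (a b : R) : sigma * `|b| <= M%:R ->
  \sum_(m < M) inv_sqrt1 (a + b * (1 + gridpt sigma M m)) <=
  M%:R * (growth sigma * inv_sqrt1 a).
Proof.
move: (s0) (s2) => sg0 sg2 bM; have K0 := growth_gt0.
have [ba|ba] := leP (`|a| / 4) `|b|.
  apply: le_trans (grid_avg_slope _ bM) _; rewrite ler_wpM2l//.
  have -> : growth sigma * inv_sqrt1 a = growth sigma / 2 * (2 * inv_sqrt1 a) by field.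
  rewrite ler_wpM2l ?divr_ge0 ?(ltW K0)//.
  by apply: le_inv_sqrt1 => //; have := normr_ge0 a; have := normr_ge0 b; lra.
have avg1 (F : 'I_M -> R) (C : R) : (forall m, F m <= C) -> \sum_(m < M) F m <= M%:R * C.
  by move=> H; rewrite mulr_natl -[X in _ *+ X]card_ord -sumr_const; apply: ler_sum.
apply: avg1 => m; apply: le_inv_sqrt1; first exact: ltW.
have /andP[g1 g2] := gridpt_bounds (ltn_ord m).
have MR : 0 < M%:R :> R by rewrite ltr0n.
have : 0 <= 2 * sigma / M%:R by rewrite divr_ge0// ltW// mulr_gt0.
move=> sM.
have nb : `|b * (1 + gridpt sigma M m)| <= `|b| * 2.
  by rewrite normrM ler_wpM2l// ler_norml; apply/andP; split; lra.
have tri : `|a| <= `|a + b * (1 + gridpt sigma M m)| + `|b * (1 + gridpt sigma M m)|.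
  by rewrite -[X in `|X| <= _](addrK (b * (1 + gridpt sigma M m))) ler_normB.
have a0 := normr_ge0 a.
rewrite growth_sqr.
have q1 : 1 <= 16 ^+ 2 :> R by rewrite expr_ge1// ler1n.
have : 4 <= 8 * 16 ^+ 2 / sigma by rewrite ler_pdivlMr//; lra.
set c := _ / _ => c4.
have t0 : `|a| / 2 <= `|a + b * (1 + gridpt sigma M m)| by lra.
nra.
Qed.

End Grid.
End AntiConcentration.

(** * Eliminating the variables of a polynomial on the grid *)

Section Cells.
Variables (R : realType) (n M : nat) (sigma : R).
Hypotheses (s0 : 0 < sigma) (s2 : sigma < 2^-1) (M0 : (0 < M)%N).
Implicit Types (j : 'I_n) (x z : cube n) (T : {set 'I_n}).

Definition cell := {ffun 'I_n -> 'I_M}.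
Implicit Type c : cell.

Definition set_cell c j (m : 'I_M) : cell := [ffun i => if i == j then m else c i].

Definition corner c j : R := 1 + gridpt sigma M (c j).

(** Fubini in one coordinate: exchanging the resampled coordinate with the original one is an
    involution on the pairs. *)
Lemma sum_set_cell (Phi : cell -> R) j :
  \sum_c \sum_(m < M) Phi (set_cell c j m) = M%:R * \sum_c Phi c.
Proof.
rewrite pair_big /=.
pose swap (q : cell * 'I_M) : cell * 'I_M := (set_cell q.1 j q.2, q.1 j).
have swapK : involutive swap.
  move=> [c m]; rewrite /swap /=; congr (_, _); last by rewrite ffunE eqxx.
  by apply/ffunP => i; rewrite !ffunE; case: eqP => // ->.
rewrite (reindex_inj (inv_inj swapK)) /=.
rewrite (eq_bigr (fun q => Phi q.1)) => [|[c m] _]; last first.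
  congr Phi; apply/ffunP => i; rewrite !ffunE; case: eqP => // ->//.
rewrite -(pair_big xpredT xpredT (fun c (_ : 'I_M) => Phi c)) /= mulr_sumr.
by apply: eq_bigr => c _; rewrite sumr_const card_ord mulr_natl.
Qed.

Variable w : cube n -> R.

(* The coefficient, in the polynomial [c |-> \sum_x w x * \prod_(x j) corner c j],
   of the monomial prescribed by [z] on the coordinates in [T]. *)
Definition coefficient T z c : R :=
  \sum_(x | agree T z x) w x * \prod_(j | j \notin T) (if x j then corner c j else 1).

Lemma coefficient_split T z c j : j \notin T ->
  coefficient T z c = coefficient (j |: T) (set_coord z j false) c +
    coefficient (j |: T) (set_coord z j true) c * corner c j.
Proof.
move=> jT; rewrite /coefficient (bigID (fun x : cube n => x j)) /= addrC.
have agE b x : agree (j |: T) (set_coord z j b) x = agree T z x && (x j == b).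
  rewrite agreeU agree1 ffunE eqxx andbC; congr (_ && _).
  apply: eq_forallb_in => i iT; rewrite ffunE ifN//.
  by apply: contraNneq jT => <-.
have prodE x : \prod_(i | i \notin T) (if x i then corner c i else 1) =
    (if x j then corner c j else 1) *
    \prod_(i | i \notin j |: T) (if x i then corner c i else 1).
  rewrite (bigD1 j)//=; congr (_ * _); apply: eq_bigl => i.
  by rewrite !inE negb_or andbC.
congr (_ + _).
  apply: eq_big => [x|x /andP[_ xj]]; first by rewrite agE eqbF_neg.
  by rewrite prodE (negbTE xj) mul1r.
rewrite mulr_suml; apply: eq_big => [x|x /andP[_ xj]]; first by rewrite agE eqb_id.
by rewrite prodE xj mulrA mulrAC.
Qed.

Lemma coefficient_set_cell T z c j m : j \in T ->
  coefficient T z (set_cell c j m) = coefficient T z c.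
Proof.
move=> jT; apply: eq_bigr => x _; congr (_ * _); apply: eq_bigr => i iT.
case: (x i) => //; rewrite /corner ffunE ifN//.
by apply: contraNneq iT => ->.
Qed.

Variable t : cell -> R.
Hypothesis t0 : forall c, 0 < t c.

(** The scale must not see coordinate j: along it the quotient is then a + b y with a and b fixed,
    as the grid averages require. The last hypothesis is their bound on the slope. *)
Lemma coefficient_step T z j : j \notin T ->
  (forall c m, t (set_cell c j m) = t c) ->
  (forall z' c, sigma * `|coefficient (j |: T) z' c| <= M%:R * t c) ->
  \sum_c inv_sqrt1 (coefficient T z c / t c) <=
  growth sigma * \sum_c inv_sqrt1 (coefficient (j |: T) z c / t c).
Proof.
move=> jT tj tM; have MR : 0 < M%:R :> R by rewrite ltr0n.
rewrite -(ler_pM2l MR) -(sum_set_cell (fun c => inv_sqrt1 (coefficient T z c / t c)) j).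
rewrite mulrCA mulr_sumr mulr_sumr; apply: ler_sum => c _.
rewrite (eq_bigr (fun m : 'I_M =>
   inv_sqrt1 (coefficient (j |: T) (set_coord z j false) c / t c +
     (coefficient (j |: T) (set_coord z j true) c / t c) * (1 + gridpt sigma M m)))); last first.
  move=> m _; rewrite (coefficient_split _ _ jT) !coefficient_set_cell ?inE ?eqxx//.
  by rewrite tj /corner ffunE eqxx mulrDl mulrAC.
have bnd : sigma * `|coefficient (j |: T) (set_coord z j true) c / t c| <= M%:R.
  by rewrite normrM normfV (gtr0_norm (t0 c)) mulrA ler_pdivrMr.
have zE : z = set_coord z j (z j).
  by apply/ffunP => i; rewrite ffunE; case: eqP => // ->.
(* The bit of z at j says which coefficient is to survive: the slope if it is true, the intercept
   otherwise. *)
rewrite mulrCA; case zj : (z j) in zE.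
  rewrite -zE; rewrite -zE in bnd.
  apply: (le_trans (grid_avg_slope s0 s2 M0 _ bnd)).
  rewrite ler_wpM2l// ler_wpM2r ?inv_sqrt1_ge0//.
  by have := growth_gt0 s0; lra.
by rewrite -zE; apply: grid_avg_intercept.
Qed.

Lemma coefficient_bound T z :
  (forall c j m, j \in T -> t (set_cell c j m) = t c) ->
  (forall T' z' c, T' \subset T -> sigma * `|coefficient T' z' c| <= M%:R * t c) ->
  \sum_c inv_sqrt1 (coefficient finset.set0 z c / t c) <=
  growth sigma ^+ #|T| * \sum_c inv_sqrt1 (coefficient T z c / t c).
Proof.
move=> tT tM.
suff H r : uniq r -> {subset r <= T} ->
    \sum_c inv_sqrt1 (coefficient finset.set0 z c / t c) <=
    growth sigma ^+ size r * \sum_c inv_sqrt1 (coefficient [set j in r] z c / t c).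
  have := H (enum T) (enum_uniq T) (fun j => _).
  rewrite -cardE (_ : [set j in enum T] = T); last by apply/setP => j; rewrite inE mem_enum.
  by apply=> j; rewrite mem_enum.
elim: r => [|j r IH] /=.
  move=> _ _; rewrite expr0 mul1r le_eqVlt; apply/orP; left; apply/eqP.
  by congr (\sum_c inv_sqrt1 (coefficient _ z c / t c)); apply/setP => j; rewrite !inE.
move=> /andP[jr ur] sub; have sub' : {subset r <= T} by move=> i ir; rewrite sub// inE ir orbT.
apply: le_trans (IH ur sub') _; rewrite exprS -mulrA mulrCA ler_wpM2l//.
  by rewrite exprn_ge0// ltW// growth_gt0.
rewrite [in leRHS](_ : [set i in j :: r] = j |: [set i in r]); last first.
  by apply/setP => i; rewrite !inE.
apply: coefficient_step; first by rewrite inE.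
  by move=> c m; apply: tT; apply: sub; rewrite inE eqxx.
move=> z' c; apply: tM; apply/fintype.subsetP => i; rewrite !inE => /orP[/eqP->|ir].
  by apply: sub; rewrite inE eqxx.
exact: sub'.
Qed.

(** Markov's inequality: on the counted cells [inv_sqrt1] is at least 2^{-1/2}, while the
    coefficient at T is everywhere at least t / eps, which bounds its [inv_sqrt1] by eps^{1/2}. *)
Lemma coefficient_small T z (eps : R) :
  (forall c j m, j \in T -> t (set_cell c j m) = t c) ->
  (forall T' z' c, T' \subset T -> sigma * `|coefficient T' z' c| <= M%:R * t c) ->
  0 < eps -> (forall c, t c <= eps * `|coefficient T z c|) ->
  #|[set c | `|coefficient finset.set0 z c| <= t c]|%:R <=
  (Num.sqrt (2 * eps) * growth sigma ^+ #|T|) * #|{: cell}|%:R.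
Proof.
move=> tT tM e0 tc; have := coefficient_bound z tT tM.
have up : \sum_c inv_sqrt1 (coefficient T z c / t c) <= Num.sqrt eps * #|{: cell}|%:R.
  rewrite mulr_natr -sumr_const; apply: ler_sum => c _.
  have h : eps^-1 <= `|coefficient T z c / t c|.
    rewrite normrM normfV (gtr0_norm (t0 c)) ler_pdivlMr// ler_pdivrMl//.
  have p1 : 0 < Num.sqrt (1 + `|coefficient T z c / t c|) by rewrite sqrtr_gt0 ltr_pwDl.
  rewrite /inv_sqrt1 -[leLHS]mul1r ler_pdivrMr// -sqrtrM ?(ltW e0)// -[leLHS]sqrtr1.
  have h2 : 1 <= eps * `|coefficient T z c / t c| by rewrite -ler_pdivrMl// mulr1.
  by rewrite ler_sqrt mulrDr mulr1; lra.
have lo : #|[set c | `|coefficient finset.set0 z c| <= t c]|%:R <=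
    Num.sqrt 2 * \sum_c inv_sqrt1 (coefficient finset.set0 z c / t c).
  rewrite cardsE -sum1_card natr_sum big_mkcond /= mulr_sumr; apply: ler_sum => c _.
  case: ifP => [ic|_]; last by rewrite mulr_ge0 ?sqrtr_ge0// inv_sqrt1_ge0.
  have q1 : `|coefficient finset.set0 z c / t c| <= 1.
    by rewrite normrM normfV (gtr0_norm (t0 c)) ler_pdivrMr// mul1r.
  rewrite /inv_sqrt1 ler_pdivlMr ?mul1r ?ler_sqrt; [lra|lra|].
  by rewrite sqrtr_gt0 ltr_pwDl.
move=> mid; apply: (le_trans lo).
rewrite sqrtrM// -!mulrA ler_wpM2l ?sqrtr_ge0//.
apply: (le_trans mid); rewrite mulrCA ler_wpM2l// exprn_ge0// ltW//.
exact: growth_gt0.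
Qed.

End Cells.

(** * The smoothing argument *)

Section Smoothing.
Variables (R : realType) (n : nat) (psi : mpoly n R) (lambda sigma : R).
Variables (f : cube n -> bool) (S V : {set 'I_n}) (i : 'I_n) (z : cube n).
Hypotheses (s0 : 0 < sigma) (s2 : sigma < 2^-1).
Hypothesis psil : forall j, norm1 (mderiv j psi) <= lambda.
Hypothesis fS : forall x y, agree S x y -> f x = f y.
Hypotheses (fz : derivative R f i z != 0).
Variable M : nat.
Hypothesis M0 : (0 < M)%N.
Implicit Types (c : cell n M) (x : cube n) (T : {set 'I_n}).
Local Notation crn := (corner sigma).

(** Lower bound for the conditional probability of either value of a coordinate, given any values of
    other coordinates: (1 + L)^{-1} with the L of [weight_flipc]. *)
Definition kappa : R := (1 + 2 * expR lambda)^-1.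

Lemma kappa_gt0 : 0 < kappa.
Proof. by rewrite invr_gt0 ltr_pwDl// mulr_ge0// expR_ge0. Qed.

Lemma kappa_le1 : kappa <= 1.
Proof. by rewrite invf_le1 ?lerDl ?mulr_ge0 ?expR_ge0// ltr_pwDl// mulr_ge0// expR_ge0. Qed.

(** The variables of the polynomial to be bounded: relevant, different from i, and not fixed by the
    restriction on V. *)
Definition free_coords : {set 'I_n} := (S :\ i) :\: V.
Local Notation T0 := free_coords.

(** Setting the free variables to 1 makes the comparison mass independent of them, so it can serve
    as the scale t of the elimination. *)
Definition frozen_corner c j : R := if j \in T0 then 1 else crn c j.

Definition frozen_mass c : R := prob (weight psi (frozen_corner c)) (agree V z).

Definition local_weight x : R :=
  if agree V z x then expR (energy psi x) * derivative R f i x else 0.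

Lemma corner_bounds c j : 2^-1 <= crn c j <= 2.
Proof.
move: (s0) (s2) => ss0 ss2; have /andP[g1 g2] := gridpt_bounds s0 M0 (ltn_ord (c j)).
have : 0 <= 2 * sigma / M%:R by rewrite divr_ge0// ltW// mulr_gt0.
by rewrite /corner; lra.
Qed.

Lemma frozen_corner_bounds c j : 2^-1 <= frozen_corner c j <= 2.
Proof. by rewrite /frozen_corner; case: ifP => _; [lra|exact: corner_bounds]. Qed.

Lemma frozen_corner_gt0 c j : 0 < frozen_corner c j.
Proof. by have /andP[h _] := frozen_corner_bounds c j; apply: lt_le_trans h. Qed.

Lemma frozen_mass_gt0 c : 0 < frozen_mass c.
Proof. by apply: prob_agree_gt0 => x; apply/weight_gt0/frozen_corner_gt0. Qed.

Lemma weight_frozen c x : weight psi (frozen_corner c) x =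
  expR (energy psi x) * \prod_(j | j \notin T0) (if x j then crn c j else 1).
Proof.
rewrite /weight (bigID (fun j => j \in T0)) /= big1 ?mul1r.
  congr (_ * _); apply: eq_bigr => j jT; case: (x j) => //.
  by rewrite /frozen_corner (negbTE jT).
by move=> j jT; rewrite /frozen_corner jT; case: (x j).
Qed.

Lemma norm_derivative_le1 x : `|derivative R f i x| <= 1.
Proof.
by rewrite /derivative; case: (f _); case: (f _);
  rewrite ?subrr ?subr0 ?sub0r ?normrN ?normr0 ?normr1.
Qed.

Lemma norm_derivative_z : `|derivative R f i z| = 1.
Proof.
by move: fz; rewrite /derivative; case: (f _); case: (f _);
  rewrite ?subrr ?eqxx// ?subr0 ?sub0r ?normrN ?normr1.
Qed.

Lemma derivative_agree x : agree (T0 :|: V) z x -> derivative R f i x = derivative R f i z.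
Proof.
move=> /agreeP H.
have E b : f (set_coord x i b) = f (set_coord z i b).
  apply/esym/fS/agreeP => j jS; rewrite !ffunE; case: eqP => // /eqP ji.
  by apply: H; rewrite !inE jS ji; case: (j \in V).
by rewrite /derivative !E.
Qed.

(** Agreement with z on the free coordinates and on V fixes every relevant coordinate except i, so
    D_i f has there its value 1 or -1 at z. The terms of this coefficient do not cancel. *)
Lemma norm_coefficient_free c :
  `|coefficient sigma local_weight T0 z c| = prob (weight psi (frozen_corner c)) (agree (T0 :|: V) z).
Proof.
have -> : coefficient sigma local_weight T0 z c =
    derivative R f i z * prob (weight psi (frozen_corner c)) (agree (T0 :|: V) z).
  rewrite /coefficient /prob mulr_sumr (bigID (agree V z)) /= [X in _ + X]big1; last first.
    by move=> x /andP[_ h]; rewrite /local_weight (negbTE h) mul0r.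
  rewrite addr0; apply: eq_big => [x|x /andP[h1 h2]]; first by rewrite agreeU.
  by rewrite /local_weight h2 weight_frozen derivative_agree ?agreeU ?h1// mulrCA !mulrA.
rewrite normrM norm_derivative_z mul1r ger0_norm//.
by apply/ltW/prob_agree_gt0 => x; apply/weight_gt0/frozen_corner_gt0.
Qed.

Lemma norm_coefficient_ge c :
  kappa ^+ #|S| * frozen_mass c <= `|coefficient sigma local_weight T0 z c|.
Proof.
rewrite norm_coefficient_free.
apply: (@le_trans _ _ (kappa ^+ #|T0| * frozen_mass c)).
  rewrite ler_wpM2r ?(ltW (frozen_mass_gt0 c))//.
  rewrite ler_wiXn2l ?(ltW kappa_gt0) ?kappa_le1//.
  by apply/subset_leq_card/fintype.subsetP => j; rewrite !inE => /and3P[].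
apply: prob_agree_ge.
- by move=> x; apply/ltW/weight_gt0/frozen_corner_gt0.
- by rewrite mulr_ge0// expR_ge0.
- by move=> j x; apply: weight_flipc => // l; apply: frozen_corner_bounds.
Qed.

Lemma prod_corner_le T c x : T \subset T0 ->
  0 <= \prod_(j | j \notin T) (if x j then crn c j else 1) <=
  2 ^+ #|S| * \prod_(j | j \notin T0) (if x j then crn c j else 1).
Proof.
have f0 j : 0 <= (if x j then crn c j else 1).
  by case: ifP => // _; have /andP[h _] := corner_bounds c j; apply: le_trans h.
move=> TT; rewrite prodr_ge0//= (bigID (fun j => j \in T0)) /= mulrC.
have -> : \prod_(j | (j \notin T) && (j \notin T0)) (if x j then crn c j else 1) =
    \prod_(j | j \notin T0) (if x j then crn c j else 1).
  apply: eq_bigl => j; rewrite andb_idl//; apply: contra; exact: (fintype.subsetP TT).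
rewrite [leRHS]mulrC ler_wpM2l ?prodr_ge0//.
apply: (@le_trans _ _ (\prod_(j in S) 2)); last by rewrite prodr_const.
rewrite big_mkcond [leRHS]big_mkcond /=; apply: ler_prod => j _.
case: ifPn => [/andP[_ jT]|_]; last by case: ifP => _; rewrite ?ler01 //= ler1n.
have jS : j \in S by move: jT; rewrite !inE => /and3P[].
rewrite jS f0/=; case: ifP => _; last by rewrite ler1n.
by case/andP: (corner_bounds c j).
Qed.

(** Supplies the slope bound of [coefficient_step]: each unfrozen coordinate contributes a factor of
    at most 2. *)
Lemma norm_coefficient_le T z' c : T \subset T0 ->
  `|coefficient sigma local_weight T z' c| <= 2 ^+ #|S| * frozen_mass c.
Proof.
move=> TT; apply: le_trans (ler_norm_sum _ _ _) _.
rewrite /frozen_mass /prob mulr_sumr big_mkcond [leRHS]big_mkcond; apply: ler_sum => x _.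
have /andP[p0 p1] := prod_corner_le c x TT.
have := weight_gt0 psi x (frozen_corner_gt0 c).
rewrite /local_weight weight_frozen => w0.
case: (agree V z x); last first.
  by rewrite mul0r normr0; case: ifP => _.
apply: (@le_trans _ _ (`|expR (energy psi x) * derivative R f i x * \prod_(j | j \notin T) (if x j then crn c j else 1)|)).
  by case: ifP => // _; rewrite normr_ge0.
rewrite !normrM (ger0_norm (expR_ge0 _)) (ger0_norm p0) mulrCA -mulrA.
rewrite ler_wpM2l ?expR_ge0//; apply: le_trans p1.
by rewrite ler_piMl// norm_derivative_le1.
Qed.

Lemma frozen_mass_set_cell c j m : j \in T0 ->
  frozen_mass (set_cell c j m) = frozen_mass c.
Proof.
move=> jT; apply: eq_bigr => x _; rewrite /weight; congr (_ * _); apply: eq_bigr => l _.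
congr (if _ then _ else _); rewrite /frozen_corner; case: ifPn => // lT.
by rewrite /corner ffunE ifN//; apply: contraNneq lT => ->.
Qed.

Definition mass (beta : 'I_n -> R) : R := prob (weight psi beta) (agree V z).
Definition signed_mass (beta : 'I_n -> R) : R :=
  \sum_(x | agree V z x) weight psi beta x * derivative R f i x.

Lemma coefficient0E c :
  coefficient sigma local_weight finset.set0 z c = signed_mass (crn c).
Proof.
rewrite /coefficient /signed_mass (eq_bigl xpredT); last first.
  by move=> x; apply/agreeP => j; rewrite inE.
rewrite [RHS]big_mkcond; apply: eq_bigr => x _; rewrite /local_weight.
case: ifP => _; last by rewrite mul0r.
rewrite /weight mulrAC; congr (_ * _ * _); apply: eq_bigl => j.
by rewrite inE.
Qed.

Lemma mass_corner_le c : mass (crn c) <= 2 ^+ #|S| * frozen_mass c.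
Proof.
rewrite /mass /frozen_mass /prob mulr_sumr; apply: ler_sum => x _.
have /andP[_ h] := prod_corner_le c x (finset.sub0set T0).
rewrite weight_frozen mulrCA /weight ler_wpM2l ?expR_ge0//.
have <- : \prod_(j | j \notin (finset.set0 : {set 'I_n})) (if x j then crn c j else 1) =
    \prod_j (if x j then crn c j else 1) by apply: eq_bigl => j; rewrite inE.
exact: h.
Qed.

(* [growth sigma ^+ k] is the loss of [coefficient_bound] when eliminating k
   variables; its square enters because Markov's inequality is applied to the
   power -1/2. *)
Definition small_ratio (eps : R) (k : nat) : R :=
  kappa ^+ k * (eps ^+ 2 / (2 * (growth sigma ^+ 2) ^+ k)).

Lemma growth_ge1 : 1 <= growth sigma.
Proof.
move: (s0) (s2) => ss0 ss2.
have [q qE q1] : exists2 q : R, 16 ^+ 2 = q & 1 <= q.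
  by exists (16 ^+ 2) => //; rewrite expr_ge1// ler1n.
apply: ler_of_sqr; first exact/ltW/growth_gt0.
by rewrite growth_sqr// qE ler_pdivlMr//; lra.
Qed.

Lemma small_ratio_gt0 eps k : 0 < eps -> 0 < small_ratio eps k.
Proof.
move=> e0; rewrite mulr_gt0 ?exprn_gt0 ?kappa_gt0// divr_gt0 ?exprn_gt0//.
by rewrite mulr_gt0// !exprn_gt0// growth_gt0.
Qed.

Lemma small_ratio_le1 eps k : 0 < eps <= 1 -> small_ratio eps k <= 1.
Proof.
move=> /andP[e0 e1].
have g1 : 1 <= (growth sigma ^+ 2) ^+ k by rewrite !exprn_ege1// growth_ge1.
have g0 : 0 < 2 * (growth sigma ^+ 2) ^+ k by lra.
have k0 : 0 <= kappa ^+ k by rewrite exprn_ge0// ltW// kappa_gt0.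
have q0 : 0 <= eps ^+ 2 / (2 * (growth sigma ^+ 2) ^+ k) by rewrite divr_ge0 ?sqr_ge0// ltW.
have k1 : kappa ^+ k <= 1 by rewrite exprn_ile1 ?kappa_le1// ltW// kappa_gt0.
have q1 : eps ^+ 2 / (2 * (growth sigma ^+ 2) ^+ k) <= 1.
  rewrite ler_pdivrMr// mul1r.
  by have : eps ^+ 2 <= 1 by [rewrite expr_le1// ltW]; lra.
exact: mulr_ile1.
Qed.

Definition bad_cells (eps : R) : {set cell n M} :=
  [set c | `|signed_mass (crn c)| <= small_ratio eps #|S| * frozen_mass c].

(** The hypothesis on M is the slope condition relative to the scale [small_ratio] times
    [frozen_mass]. *)
Lemma card_bad_cells (eps : R) : 0 < eps -> 2 ^+ #|S| <= M%:R * small_ratio eps #|S| ->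
  #|bad_cells eps|%:R <= eps * #|{: cell n M}|%:R.
Proof.
move=> e0 hM; set t0 := small_ratio eps #|S|.
have t0p : 0 < t0 by apply: small_ratio_gt0.
have kp : 0 < kappa ^+ #|S| by rewrite exprn_gt0// kappa_gt0.
have gp : 0 < growth sigma ^+ #|S| by rewrite exprn_gt0// growth_gt0.
have := @coefficient_small R n M sigma s0 s2 M0 local_weight (fun c => t0 * frozen_mass c)
  (fun c => mulr_gt0 t0p (frozen_mass_gt0 c)) T0 z (t0 / kappa ^+ #|S|).
rewrite (_ : [set c | `|coefficient sigma local_weight finset.set0 z c| <= t0 * frozen_mass c] = bad_cells eps); last first.
  by apply/setP => c; rewrite !inE coefficient0E.
move=> /(_ _ _ _ _)/le_trans; apply.
- by move=> c j m jT; rewrite frozen_mass_set_cell.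
- move=> T z' c TT.
  apply: (@le_trans _ _ (1 * `|coefficient sigma local_weight T z' c|)).
    by rewrite ler_wpM2r//; move: (s2); lra.
  rewrite mul1r mulrA; apply: le_trans (norm_coefficient_le _ _ TT) _.
  by rewrite ler_wpM2r// ltW// frozen_mass_gt0.
- by rewrite divr_gt0.
- move=> c; rewrite -mulrA ler_pM2l// mulrC ler_pdivlMr// mulrC.
  exact: norm_coefficient_ge.
rewrite ler_wpM2r//.
apply: (@le_trans _ _ (Num.sqrt (2 * (t0 / kappa ^+ #|S|)) * growth sigma ^+ #|S|)).
  rewrite ler_wpM2l ?sqrtr_ge0//; apply: ler_weXn2l; first exact: growth_ge1.
  by apply/subset_leq_card/fintype.subsetP => j; rewrite !inE => /and3P[].
(* [small_ratio] is chosen to make this a perfect square, so that the powers of [growth] cancel and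
   eps remains. *)
have -> : 2 * (t0 / kappa ^+ #|S|) = (eps / growth sigma ^+ #|S|) ^+ 2.
  rewrite /t0 /small_ratio exprAC; field; by rewrite !gt_eqF.
by rewrite sqrtr_sqr ger0_norm ?divr_ge0 ?(ltW e0) ?(ltW gp)// divfK ?gt_eqF.
Qed.

Section Perturbation.
Variables (c : cell n M) (alpha : 'I_n -> R) (eta : R).
Hypothesis near : forall j, crn c j <= 1 + alpha j <= crn c j + 2 * sigma / M%:R.
Hypothesis eta1 : (1 + 2 / M%:R) ^+ n <= 1 + eta.

Lemma weight_perturb x :
  weight psi (crn c) x <= weight psi (fun j => 1 + alpha j) x <= (1 + eta) * weight psi (crn c) x.
Proof.
move: (s0) (s2) => ss0 ss2; have MR : 0 < M%:R :> R by rewrite ltr0n.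
have cb0 j : 0 < crn c j.
  by have /andP[h _] := corner_bounds c j; apply: lt_le_trans h.
have pc0 : 0 <= \prod_j (if x j then crn c j else 1).
  by apply: prodr_ge0 => j _; case: ifP => // _; exact: ltW.
rewrite /weight mulrCA; apply/andP; split.
  rewrite ler_wpM2l ?expR_ge0//; apply: ler_prod => j _.
  by case/andP: (near j) => h1 _; case: (x j); rewrite ?lexx ?ler01// h1 ltW.
rewrite ler_wpM2l ?expR_ge0//.
apply: (@le_trans _ _ ((1 + 2 / M%:R) ^+ n * \prod_j (if x j then crn c j else 1))).
  have -> : (1 + 2 / M%:R) ^+ n = \prod_(j < n) (1 + 2 / M%:R : R) by rewrite prodr_const card_ord.
  rewrite -big_split /=; apply: ler_prod => j _.
  have m0 : 0 <= 2 / M%:R :> R by rewrite divr_ge0// ltW.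
  case: (x j); last by rewrite ler01 mulr1 lerDl.
  have /andP[h1 h2] := near j; have /andP[b1 _] := corner_bounds c j.
  rewrite (le_trans (ltW (cb0 j)) h1)/=; apply: (le_trans h2).
  (* A corner is at least 1/2 and sigma < 1/2, so the cell width 2 sigma / M is at most 2 / M times
     the corner. *)
  rewrite [leRHS]mulrDl mul1r lerD2l [leRHS]mulrAC ler_wpM2r ?invr_ge0 ?(ltW MR)//; lra.
by rewrite ler_wpM2r.
Qed.

Lemma signed_mass_perturb (r : R) : 0 < r <= 1 -> eta <= r / 4 ->
  r * mass (crn c) <= `|signed_mass (crn c)| ->
  r / 4 * mass (fun j => 1 + alpha j) <= `|signed_mass (fun j => 1 + alpha j)|.
Proof.
move=> /andP[r0 r1] er h.
have W x := weight_perturb x.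
have mc0 : 0 <= mass (crn c).
  apply: sumr_ge0 => x _; apply/ltW/weight_gt0 => j.
  by have /andP[b _] := corner_bounds c j; apply: lt_le_trans b.
have m1 : mass (fun j => 1 + alpha j) <= (1 + eta) * mass (crn c).
  by rewrite /mass /prob mulr_sumr; apply: ler_sum => x _; case/andP: (W x).
have d1 : `|signed_mass (fun j => 1 + alpha j) - signed_mass (crn c)| <= eta * mass (crn c).
  rewrite /signed_mass -sumrB; apply: le_trans (ler_norm_sum _ _ _) _.
  rewrite /mass /prob mulr_sumr; apply: ler_sum => x _.
  rewrite -mulrBl normrM; have /andP[w1 w2] := W x.
  rewrite ger0_norm ?subr_ge0//.
  apply: (@le_trans _ _ ((weight psi (fun j => 1 + alpha j) x - weight psi (crn c) x) * 1)).
    by rewrite ler_wpM2l ?subr_ge0// norm_derivative_le1.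
  by rewrite mulr1; lra.
have tri : `|signed_mass (crn c)| - eta * mass (crn c) <= `|signed_mass (fun j => 1 + alpha j)|.
  rewrite lerBlDr; apply: (@le_trans _ _ (`|signed_mass (fun j => 1 + alpha j)| +
    `|signed_mass (fun j => 1 + alpha j) - signed_mass (crn c)|)); last by rewrite lerD2l.
  rewrite distrC addrC -[X in `|X| <= _](subrK (signed_mass (fun j => 1 + alpha j))).
  exact: ler_normD.
(* Up to the mass, it remains that r / 4 (1 + eta) <= r - eta, which follows from eta <= r / 4 <= 1
   / 4. *)
apply: le_trans tri.
apply: (@le_trans _ _ (r / 4 * ((1 + eta) * mass (crn c)))).
  by rewrite ler_wpM2l// divr_ge0// ltW.
apply: (@le_trans _ _ (r / 4 * ((1 + 1 / 4) * mass (crn c)))).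
  by rewrite ler_wpM2l ?divr_ge0 ?(ltW r0)// ler_wpM2r//; lra.
have : eta * mass (crn c) <= r / 4 * mass (crn c) by rewrite ler_wpM2r.
nra.
Qed.

End Perturbation.

Lemma good_cell_influence (eps eta : R) c (alpha : 'I_n -> R) :
  0 < eps <= 1 ->
  (forall j, crn c j <= 1 + alpha j <= crn c j + 2 * sigma / M%:R) ->
  (1 + 2 / M%:R) ^+ n <= 1 + eta ->
  eta <= small_ratio eps #|S| / 2 ^+ #|S| / 4 ->
  c \notin bad_cells eps ->
  small_ratio eps #|S| / 2 ^+ #|S| / 4 * mass (fun j => 1 + alpha j) <=
    `|signed_mass (fun j => 1 + alpha j)|.
Proof.
move=> e01 near eta1 eta2; rewrite inE -ltNge => h.
have /andP[e0 _] := e01.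
have t0 := small_ratio_gt0 #|S| e0; have t1 := small_ratio_le1 #|S| e01.
have p0 : 0 < 2 ^+ #|S| :> R by rewrite exprn_gt0.
have p1 : 1 <= 2 ^+ #|S| :> R by rewrite exprn_ege1// ler1n.
apply: (signed_mass_perturb near eta1) => //.
  rewrite divr_gt0//= ler_pdivrMr// mul1r; exact: le_trans p1.
apply: le_trans (ltW h); rewrite -mulrA ler_wpM2l ?(ltW t0)//.
by rewrite ler_pdivrMl// mass_corner_le.
Qed.

End Smoothing.

(** * From the grid to uniform random variables *)

Section IntegralBound.
Local Open Scope classical_set_scope.
Import HBNNSimple.
Context d (T : measurableType d) (R : realType) (mu : {measure set T -> \bar R}).

(** The integral of a nonnegative function is a supremum over simple functions below it, and v times
    the indicator of the union of the good sets is one of them. *)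
Lemma integral_ge_disjoint (I : finType) (Good : {set I}) (B : I -> set T)
    (F : T -> \bar R) (v : R) :
  (forall x, 0 <= F x)%E -> (forall i, measurable (B i)) ->
  (forall i j x, B i x -> B j x -> i = j) -> 0 <= v ->
  (forall i x, i \in Good -> B i x -> (v%:E <= F x)%E) ->
  (v%:E * \sum_(i in Good) mu (B i) <= \int[mu]_x F x)%E.
Proof.
move=> F0 mB dB v0 vF; pose E := \bigcup_(i in [set` enum Good]) B i.
have mE : measurable E.
  by apply: fin_bigcup_measurable => // i _; exact: mB.
have muE : mu E = (\sum_(i in Good) mu (B i))%E.
  rewrite /E measure_fin_bigcup//.
  - by rewrite -fsbig_seq ?enum_uniq// big_enum.
  - by move=> i j _ _ [x [Bi Bj]]; exact: dB Bi Bj.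
rewrite -muE ge0_integralTE//.
have -> : (v%:E * mu E = sintegral mu (scale_nnsfun (indic_nnsfun R mE) v0))%E.
  by rewrite sintegralrM sintegral_indic.
apply: ereal_sup_ubound; exists (scale_nnsfun (indic_nnsfun R mE) v0) => // x /=.
rewrite measurable_realfun.mindicE; case: (boolP (x \in E)) => [|_]; last by rewrite mulr0.
by rewrite inE mulr1 => -[i /= iG Bx]; apply: vF Bx; rewrite mem_enum in iG.
Qed.

End IntegralBound.

Section Boxes.
Local Open Scope classical_set_scope.
Variables (R : realType) (n M : nat) (sigma : R) (sigma0 : 0 < sigma).
Hypothesis M0 : (0 < M)%N.
Context (d : measure_display) (Omega : measurableType d) (P : probability Omega R).
Variable alpha : 'I_n -> {RV P >-> R}.
Hypothesis unif : iid_uniform sigma0 alpha.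

(** Half-open, so that the cells are disjoint; of the interval only the endpoint sigma is left
    uncovered. *)
Definition grid_cell (m : nat) : set R :=
  `[gridpt sigma M m, gridpt sigma M m + 2 * sigma / M%:R[.

Lemma uniform_grid_cell (m : nat) : (m < M)%N ->
  uniform_prob (ltN_self sigma0) (grid_cell m) = (M%:R^-1)%:E.
Proof.
move=> mM; have MR : 0 < M%:R :> R by rewrite ltr0n.
have /andP[g1 g2] := gridpt_bounds sigma0 M0 mM.
have w0 : 0 < 2 * sigma / M%:R by rewrite divr_gt0// mulr_gt0.
rewrite /uniform_prob (eq_integral (fun=> ((2 * sigma)^-1)%:E)); last first.
  move=> x; rewrite inE /grid_cell/= in_itv/= => /andP[x1 x2].
  rewrite /uniform_pdf ifT; last by apply/andP; split; lra.
  by congr (_^-1)%:E; ring.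
rewrite integral_cst/=; last exact: measurable_itv.
rewrite lebesgue_measure_itv/= lte_fin ltrDl w0 -EFinD -EFinM.
by congr EFin; field; rewrite !gt_eqF.
Qed.

Definition box (c : cell n M) : set Omega := [set w | forall j, grid_cell (c j) (alpha j w)].

Lemma measurable_box c : measurable (box c).
Proof.
rewrite (_ : box c = \bigcap_(j in [set: 'I_n]) (alpha j @^-1` grid_cell (c j))); last first.
  by apply/seteqP; split => [w H j _|w H j]; exact: H.
apply: fin_bigcap_measurable => // j _; rewrite -[X in measurable X]setTI.
by apply: measurable_funP => //; exact: measurable_itv.
Qed.

Lemma prob_box c : P (box c) = ((M%:R ^+ n)^-1)%:E.
Proof.
have [unif1 indep] := unif.
rewrite /box (indep (fun j => grid_cell (c j))) => [|j]; last exact: measurable_itv.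
congr EFin; rewrite (eq_bigr (fun=> M%:R^-1)).
  by rewrite prodr_const card_ord exprVn.
move=> j _; have := unif1 j (grid_cell (c j)) (measurable_itv _).
by rewrite uniform_grid_cell// /distribution /pushforward => ->.
Qed.

Lemma box_disjoint c c' w : box c w -> box c' w -> c = c'.
Proof.
have MR : 0 < M%:R :> R by rewrite ltr0n.
move=> H H'; apply/ffunP => j; apply/val_inj => /=.
have w0 : 0 < 2 * sigma / M%:R by rewrite divr_gt0// mulr_gt0.
have gE m : gridpt sigma M m = - sigma + m%:R * (2 * sigma / M%:R).
  by rewrite /gridpt; congr (_ + _); ring.
have := H j; have := H' j; rewrite /grid_cell /= !in_itv/= !gE.
set a := alpha j w; set h := 2 * sigma / M%:R in w0 *.
move=> /andP[h1 h2] /andP[h3 h4].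
have l1 : (c j : nat)%:R * h < (c' j).+1%:R * h by rewrite -natr1 mulrDl mul1r; lra.
have l2 : (c' j : nat)%:R * h < (c j).+1%:R * h by rewrite -natr1 mulrDl mul1r; lra.
move: l1 l2; rewrite !ltr_pM2r// !ltr_nat !ltnS => l1 l2.
by apply/eqP; rewrite eqn_leq; apply/andP; split; [exact: l1|exact: l2].
Qed.

(** All boxes have probability M^{-n} and are disjoint, so the proportion of good cells is a
    probability. *)
Lemma integral_ge_boxes (Good : {set cell n M}) (F : Omega -> \bar R) (v : R) :
  (forall x, 0 <= F x)%E -> 0 <= v ->
  (forall c w, c \in Good -> box c w -> (v%:E <= F w)%E) ->
  ((v * (#|Good|%:R / #|{: cell n M}|%:R))%:E <= \int[P]_x F x)%E.
Proof.
move=> F0 v0 vF.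
have := @integral_ge_disjoint _ _ _ P _ Good box F v F0 measurable_box box_disjoint v0 vF.
apply: le_trans; rewrite le_eqVlt; apply/orP; left; apply/eqP.
rewrite (eq_bigr (fun=> ((M%:R ^+ n)^-1)%:E)) => [|c _]; last exact: prob_box.
rewrite sumEFin -EFinM sumr_const card_ffun !card_ord natrX.
by congr EFin; rewrite mulr_natl.
Qed.

Lemma box_near c w : box c w ->
  forall j, corner sigma c j <= 1 + alpha j w <= corner sigma c j + 2 * sigma / M%:R.
Proof.
move=> H j; have := H j; rewrite /grid_cell /corner/= in_itv/= => /andP[h1 h2].
by apply/andP; split; lra.
Qed.

Lemma box_range c w : box c w -> forall j, - sigma <= alpha j w <= sigma.
Proof.
move=> H j; have := H j; rewrite /grid_cell/= in_itv/= => /andP[h1 h2].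
have /andP[g1 g2] := gridpt_bounds sigma0 M0 (ltn_ord (c j)).
by apply/andP; split; lra.
Qed.

End Boxes.

(** * Samples *)

Section Sensitive.
Variables (n : nat) (f : {ffun cube n -> bool}).
Implicit Types (x y : cube n) (i j : 'I_n).

(** The set given with a junta may contain coordinates that never matter. This one is the smallest
    on which f depends, and the target of the search. *)
Definition sensitive_coords : {set 'I_n} := [set i | [exists x, f (flipc i x) != f x]].

Lemma not_sensitive i x : i \notin sensitive_coords -> f (flipc i x) = f x.
Proof.
by rewrite inE negb_exists => /forallP/(_ x); rewrite negbK => /eqP.
Qed.

(** Induction on the Hamming distance: x and y differ only at insensitive coordinates, which can be
    flipped one at a time. *)
Lemma depends_only_sensitive x y : agree sensitive_coords x y -> f x = f y.
Proof.
move: {2}#|[set j | x j != y j]| (erefl #|[set j | x j != y j]|) => m.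
elim: m x => [|m IH] x.
  move=> /eqP; rewrite cards_eq0 => /eqP D _; congr (f _); apply/ffunP => j.
  by apply/eqP/negPn; have := finset.in_set0 j; rewrite -D inE => ->.
move=> D axy; have : [set j | x j != y j] != finset.set0 by rewrite -cards_eq0 D.
move=> /set0Pn[j]; rewrite inE => xyj.
have jS : j \notin sensitive_coords.
  by apply: contraNN xyj => /(agreeP _ _ _ axy)->.
rewrite -(not_sensitive x jS); apply: IH.
  have -> : [set l | flipc j x l != y l] = [set l | x l != y l] :\ j.
    apply/setP => l; rewrite !inE; have [->|lj] := eqVneq l j.
      by rewrite flipc_i; move: xyj; case: (x j); case: (y j).
    by rewrite flipc_ne.
  by move: D; rewrite (cardsD1 j) inE xyj => -[].
apply/agreeP => l lS; rewrite flipc_ne; first exact: (agreeP _ _ _ axy).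
by apply: contraNneq jS => <-.
Qed.

Lemma sensitive_sub (S : {set 'I_n}) :
  (forall x y, agree S x y -> f x = f y) -> sensitive_coords \subset S.
Proof.
move=> fS; apply/fintype.subsetP => i; rewrite inE => /existsP[x]; apply: contraNT => iS.
by apply/eqP/esym/fS; rewrite agree_flipc// agree_refl.
Qed.

End Sensitive.

Section Samples.
Variables (R : realType) (n : nat) (mu : cube n -> R) (f : {ffun cube n -> bool}).
Variables (G : rel 'I_n) (Sj : {set 'I_n}).
Hypothesis fSj : forall x y, agree Sj x y -> f x = f y.
Implicit Types (x : cube n) (z : example n) (i j : 'I_n) (V : {set 'I_n}).

Definition statistic i (c : nat) z : R :=
  match c with 0 => 1 | 1 => (z.2)%:R | 2 => (z.1 i)%:R
  | _ => (z.2)%:R * (z.1 i)%:R end.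

Definition local_statistic V x i c z : R := (agree V x z.1)%:R * statistic i c z.

Lemma statistic01 i c z : 0 <= statistic i c z <= 1.
Proof.
by case: c => [|[|[|c]]] /=; case: z.2; case: (z.1 i);
  rewrite ?mulr1 ?mulr0 ?lexx ?ler01.
Qed.

Lemma local_statistic01 V x i c z : 0 <= local_statistic V x i c z <= 1.
Proof.
rewrite /local_statistic; have /andP[? ?] := statistic01 i c z.
by case: agree; rewrite ?mul1r ?mul0r ?lexx ?ler01//; apply/andP.
Qed.

Definition empirical N (S : N.-tuple (example n)) (h : example n -> R) : R :=
  \sum_(j < N) h (tnth S j).

Definition expected (h : example n -> R) : R := \sum_z labelled mu f z * h z.

Lemma expectedE h : expected h = \sum_x mu x * h (x, f x).
Proof.
rewrite /expected (eq_bigr (fun z => labelled mu f (z.1, z.2) * h (z.1, z.2))) => [|[] //].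
rewrite -(pair_bigA _ (fun x b => labelled mu f (x, b) * h (x, b))) /=.
apply: eq_bigr => x _; rewrite big_bool /labelled /=.
by case: (f x) => /=; rewrite ?mulr1 ?mulr0 ?mul0r ?addr0 ?add0r.
Qed.

Lemma expected_local V x i c :
  expected (local_statistic V x i c) = \sum_(u | agree V x u) mu u * statistic i c (u, f u).
Proof.
rewrite expectedE [RHS]big_mkcond; apply: eq_bigr => u _; rewrite /local_statistic /=.
by case: agree; rewrite ?mul1r ?mul0r ?mulr0.
Qed.

Lemma empirical_local N (S : N.-tuple (example n)) V x i c :
  empirical S (local_statistic V x i c) = \sum_(z <- S | agree V x z.1) statistic i c z.
Proof.
rewrite /empirical [RHS]big_mkcond big_tuple; apply: eq_bigr => j _.
by rewrite /local_statistic; case: agree; rewrite ?mul1r ?mul0r.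
Qed.

Definition conditional_covariance i x : R :=
  let A := agree (nbrs G i) x in
  let p := prob mu A in
  (\sum_(u | A u) mu u * ((f u)%:R * (u i)%:R)) / p
    - (\sum_(u | A u) mu u * (f u)%:R) / p * ((\sum_(u | A u) mu u * (u i)%:R) / p).

(** The error is ((A - N a) p - a (P - N p)) / (P p). Its numerator is at most 2 N eps p, and eps <=
    p0 / 2 keeps P above N p0 / 2. *)
Lemma ratio_error (N p0 p a P A eps : R) : 0 < N -> 0 < p0 -> p0 <= p -> 0 <= a <= p ->
  eps <= p0 / 2 -> `|A - N * a| <= N * eps -> `|P - N * p| <= N * eps ->
  `|A / P - a / p| <= 4 * eps / p0.
Proof.
move=> N0 p00 p0p /andP[a0 ap] e2 hA hP.
have pp : 0 < p by lra.
have Pl : N * p0 / 2 <= P.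
  move: hP; rewrite ler_norml => /andP[h _].
  have : N * eps <= N * (p0 / 2) by rewrite ler_pM2l.
  have : N * p0 <= N * p by rewrite ler_pM2l.
  lra.
have Np0 : 0 < N * p0 by rewrite mulr_gt0.
have P0 : 0 < P by lra.
have -> : A / P - a / p = ((A - N * a) * p - a * (P - N * p)) / (P * p).
  by field; rewrite !gt_eqF.
rewrite normrM normfV (gtr0_norm (mulr_gt0 P0 pp)) ler_pdivrMr ?mulr_gt0//.
have h1 : `|(A - N * a) * p - a * (P - N * p)| <= 2 * (N * eps) * p.
  apply: le_trans (ler_normB _ _) _; rewrite !normrM (gtr0_norm pp) (ger0_norm a0).
  have : `|A - N * a| * p <= N * eps * p by rewrite ler_pM2r.
  have : a * `|P - N * p| <= p * (N * eps) by apply: ler_pM.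
  lra.
apply: (le_trans h1).
have e0 : 0 <= eps.
  by have := le_trans (normr_ge0 _) hA; rewrite pmulr_rge0.
have -> : 4 * eps / p0 * (P * p) = (4 * eps * p) * (P / p0) by field; rewrite gt_eqF.
have : N / 2 <= P / p0 by rewrite ler_pdivlMr//; lra.
have q0 : 0 <= 4 * eps * p by rewrite mulr_ge0 ?mulr_ge0// ltW.
by move=> /(ler_wpM2l q0); lra.
Qed.

Section Concentrated.
Variables (N : nat) (S : N.-tuple (example n)).
Variables (kap eps tau : R) (d k : nat).
Hypotheses (mu_gt0 : forall x, 0 < mu x) (mu1 : \sum_x mu x = 1).
Hypotheses (kap0 : 0 < kap <= 1) (tau0 : 0 < tau <= 1).
Hypothesis mu_kap : forall V x, kap ^+ #|V| <= prob mu (agree V x).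
Hypotheses (degG : max_degree_le G d) (cardSj : #|Sj| = k).
Hypotheses (eps0 : 0 < eps) (epsd : eps <= kap ^+ d * tau / 12) (epsk : eps <= kap ^+ k).
Hypothesis N0 : (0 < N)%N.
Hypothesis labels : forall z, z \in (S : seq (example n)) -> z.2 = f z.1.
Hypothesis conc1 : forall i x c, (c < 4)%N ->
  `|empirical S (local_statistic (nbrs G i) x i c)
    - N%:R * expected (local_statistic (nbrs G i) x i c)| < N%:R * eps.
Hypothesis conc2 : forall i x,
  `|empirical S (local_statistic Sj x i 0) - N%:R * expected (local_statistic Sj x i 0)|
    < N%:R * eps.
Hypothesis cov_sensitive : forall i, i \in sensitive_coords f ->
  exists x, 3 * tau <= `|conditional_covariance i x|.
Hypothesis cov_insensitive : forall i x, i \notin sensitive_coords f -> conditional_covariance i x = 0.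

Lemma influence_error i x :
  `|influence R S i (project (nbrs G i) x) - `|conditional_covariance i x| | <= tau.
Proof.
apply: le_trans (ler_dist_dist _ _) _.
move: (kap0) (tau0) (eps0) (epsd) => /andP[k0 k1] /andP[t0 t1] e0 ed.
pose p0 := kap ^+ d.
have p00 : 0 < p0 by rewrite exprn_gt0.
pose V := nbrs G i.
pose E c := expected (local_statistic V x i c).
pose F c := empirical S (local_statistic V x i c).
have NR : 0 < N%:R :> R by rewrite ltr0n.
have E0 : E 0%N = prob mu (agree V x).
  by rewrite /E expected_local; apply: eq_bigr => u _; rewrite mulr1.
have p0E : p0 <= E 0%N.
  rewrite E0; apply: le_trans (mu_kap _ _); apply: ler_wiXn2l; rewrite ?(ltW k0)//; exact: degG.
have eps2 : eps <= p0 / 2.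
  apply: (le_trans ed); rewrite -/p0.
  have : p0 * tau <= p0 * 1 by rewrite ler_pM2l.
  lra.
have Er c : 0 <= E c <= E 0%N.
  rewrite /E !expected_local sumr_ge0/=; last first.
    by move=> u _; rewrite mulr_ge0 ?(ltW (mu_gt0 u))//; case/andP: (statistic01 i c (u, f u)).
  apply: ler_sum => u _; rewrite ler_wpM2l ?(ltW (mu_gt0 u))//.
  by case/andP: (statistic01 i c (u, f u)).
have Fr c : 0 <= F c <= F 0%N.
  rewrite /F !empirical_local sumr_ge0/=; last first.
    by move=> u _; case/andP: (statistic01 i c u).
  by apply: ler_sum => u _; case/andP: (statistic01 i c u).
have err c : (c < 4)%N -> `|F c / F 0%N - E c / E 0%N| <= 4 * eps / p0.
  move=> c4; apply: (ratio_error NR p00 p0E (Er c) eps2).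
  - by apply: ltW; exact: (conc1 i x c4).
  - by apply: ltW; exact: (@conc1 i x 0%N isT).
have -> : average (Defs.restrict S (project V x)) (fun z => (z.2)%:R * (z.1 i)%:R : R) -
   average (Defs.restrict S (project V x)) (fun z => (z.2)%:R : R) *
   average (Defs.restrict S (project V x)) (fun z => (z.1 i)%:R) =
   F 3 / F 0%N - F 1%N / F 0%N * (F 2 / F 0%N).
  have consE (g : example n -> R) : \sum_(z <- S | consistent (project V x) z.1) g z =
      \sum_(z <- S | agree V x z.1) g z.
    by apply: eq_bigl => z; rewrite consistent_project.
  by rewrite !average_restrict !consE /F !empirical_local.
have -> : conditional_covariance i x = E 3 / E 0%N - E 1%N / E 0%N * (E 2 / E 0%N).
  by rewrite /conditional_covariance -/V -E0 /E !expected_local.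
have r1 := err 1%N isT; have r2 := err 2 isT; have r3 := err 3 isT.
have range c (X : nat -> R) : 0 <= X c <= X 0%N -> 0 <= X c / X 0%N <= 1.
  move=> /andP[h1 h2]; rewrite divr_ge0//=; last exact: le_trans h2.
  have [X0|X0] := ltP 0 (X 0%N); first by rewrite ler_pdivrMr// mul1r.
  have -> : X c = 0 by apply/eqP; rewrite eq_le h1 (le_trans h2).
  by rewrite mul0r.
have /andP[F1 F1'] := range 1%N F (Fr 1%N); have /andP[G2 G2'] := range 2 E (Er 2).
move: r1 r2 r3 F1 F1' G2 G2'.
set a1 := F 1%N / _; set a2 := F 2 / _; set a3 := F 3 / _.
set b1 := E 1%N / _; set b2 := E 2 / _; set b3 := E 3 / _.
move: a1 a2 a3 b1 b2 b3 => a1 a2 a3 b1 b2 b3 r1 r2 r3 F1 F1' G2 G2'.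
(* Three ratios, each off by at most 4 eps / p0, with multipliers in [0, 1]: this is the 12 in the
   hypothesis on eps. *)
have -> : a3 - a1 * a2 - (b3 - b1 * b2) = (a3 - b3) - (a1 * (a2 - b2) + b2 * (a1 - b1)) by ring.
apply: le_trans (ler_normB _ _) _.
have t1' : `|a1 * (a2 - b2) + b2 * (a1 - b1)| <= 4 * eps / p0 + 4 * eps / p0.
  apply: le_trans (ler_normD _ _) _; rewrite !normrM (ger0_norm F1) (ger0_norm G2).
  apply: lerD; [apply: le_trans r2|apply: le_trans r1];
    by rewrite ler_piMl.
apply: le_trans (lerD r3 t1') _.
have -> : 4 * eps / p0 + (4 * eps / p0 + 4 * eps / p0) = 12 * eps / p0 by ring.
by rewrite ler_pdivrMr//; rewrite -/p0 in ed; lra.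
Qed.

(** An insensitive variable has empirical influence at most tau, a sensitive one at least 3 tau -
    tau for some restriction. *)
Lemma find_relevant_sensitive : find_relevant_variables S G tau = sensitive_coords f.
Proof.
move: (tau0) => /andP[t0 t1]; apply/setP => i; rewrite inE.
have [iS|iS] := boolP (i \in sensitive_coords f).
  have [x cx] := cov_sensitive iS; apply/existsP; exists (project (nbrs G i) x).
  rewrite rsupp_project eqxx/=; have := influence_error i x.
  by rewrite ler_norml => /andP[h _]; lra.
apply/negbTE; rewrite negb_exists; apply/forallP => rho.
apply/negP => /andP[/eqP supp].
(* Every restriction with this support is the projection of a point, obtained by filling the stars
   with false. *)
have -> : rho = project (nbrs G i) [ffun j => rho j == Some true].
  apply/ffunP => j; rewrite -supp !ffunE inE.
  by case: (rho j) => [[]|].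
have := influence_error i [ffun j => rho j == Some true].
rewrite cov_insensitive// normr0 subr0 ler_norml => /andP[_ h] h'.
by have := lt_le_trans h' h; rewrite ltxx.
Qed.

Lemma sample_covers x : exists2 z, z \in (S : seq (example n)) & agree Sj x z.1.
Proof.
have [/hasP[z zS za]|nh] := boolP (has (fun z : example n => agree Sj x z.1) S).
  by exists z.
(* [conc2] is indexed by a coordinate; for n = 0 there is none, and any sample agrees vacuously. *)
have [i|noi] := pickP (fun _ : 'I_n => true).
  move=> _; have := conc2 i x.
  have -> : empirical S (local_statistic Sj x i 0) = 0.
    rewrite empirical_local big_seq_cond big_pred0// => z.
    apply/negbTE; rewrite negb_and -implybE; apply/implyP => zS.
    by have /hasPn/(_ z zS) := nh.
  rewrite sub0r normrN.
  have -> : expected (local_statistic Sj x i 0) = prob mu (agree Sj x).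
    by rewrite expected_local; apply: eq_bigr => u _; rewrite mulr1.
  have NR : 0 < N%:R :> R by rewrite ltr0n.
  rewrite ger0_norm ?mulr_ge0 ?(ltW NR)//; last by apply/ltW/prob_agree_gt0.
  rewrite ltr_pM2l// => h; have := lt_le_trans h epsk; rewrite -cardSj => h'.
  by have := lt_le_trans h' (mu_kap Sj x); rewrite ltxx.
exists (tnth S (Ordinal N0)); first exact: mem_tnth.
by apply/agreeP => j; have := noi j.
Qed.

(** f itself is admissible and has risk 0, so h is correct on all samples. Every point agrees on
    [Sj], hence on the sensitive coordinates, with a sample, and both functions depend only on the
    latter. *)
Lemma learn_junta_unique (h : {ffun cube n -> bool}) : learn_junta S G tau h -> h = f.
Proof.
rewrite /learn_junta find_relevant_sensitive => /andP[/depends_onlyP dh /forallP erm].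
have df : depends_only (sensitive_coords f) f.
  by apply/depends_onlyP; exact: depends_only_sensitive.
have := implyP (erm f) df; rewrite /empirical_risk /average.
have -> : \sum_(z <- S) ((f z.1 != z.2)%:R : R) = 0.
  by rewrite big_seq big1// => z /labels ->; rewrite eqxx.
rewrite mul0r pmulr_lle0 ?invr_gt0 ?ltr0n ?size_tuple//.
move=> risk0.
have hS z : z \in (S : seq (example n)) -> h z.1 = f z.1.
  move=> zS; rewrite -labels//; apply/eqP/negPn/negP => hz.
  have : \sum_(z <- S) ((h z.1 != z.2)%:R : R) > 0.
    rewrite (big_rem z)//= hz ltr_pwDl//; exact: sumr_ge0.
  by rewrite ltNge risk0.
apply/ffunP => x; have [z zS az] := sample_covers x.
have as' : agree (sensitive_coords f) x z.1 by apply: agree_sub az; exact: sensitive_sub.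
by rewrite (dh _ _ as') hS//; apply/esym/depends_only_sensitive.
Qed.

End Concentrated.

Section Success.
Variables (N : nat) (kap eps tau : R) (d k : nat).
Hypotheses (mu_gt0 : forall x, 0 < mu x) (mu1 : \sum_x mu x = 1).
Hypotheses (kap0 : 0 < kap <= 1) (tau0 : 0 < tau <= 1).
Hypothesis mu_kap : forall V x, kap ^+ #|V| <= prob mu (agree V x).
Hypotheses (degG : max_degree_le G d) (cardSj : #|Sj| = k).
Hypotheses (eps0 : 0 < eps) (epsd : eps <= kap ^+ d * tau / 12) (epsk : eps <= kap ^+ k).
Hypotheses (N0 : (0 < N)%N) (n0 : (0 < n)%N).
Hypothesis cov_sensitive : forall i, i \in sensitive_coords f ->
  exists x, 3 * tau <= `|conditional_covariance i x|.
Hypothesis cov_insensitive : forall i x, i \notin sensitive_coords f -> conditional_covariance i x = 0.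

Definition deviates (S : N.-tuple (example n)) (h : example n -> R) : bool :=
  N%:R * eps <= `|empirical S h - N%:R * expected h|.

(** Patterns on V are indexed by the subsets of V, which keeps the union bound at 2^|V| events
    instead of one per point of the cube. *)
Definition set_pattern (A : {set 'I_n}) : cube n := [ffun j => j \in A].

Lemma agree_set_pattern V x : agree V (set_pattern [set j in V | x j]) =1 agree V x.
Proof.
by move=> u; apply: eq_forallb_in => j jV; rewrite ffunE inE jV.
Qed.

Lemma labelled_ge0 z : 0 <= labelled mu f z.
Proof. by rewrite mulr_ge0// ltW. Qed.

Lemma sum_labelled : \sum_z labelled mu f z = 1.
Proof.
rewrite -mu1; transitivity (expected (fun=> 1)).
  by apply: eq_bigr => z _; rewrite mulr1.
by rewrite expectedE; apply: eq_bigr => x _; rewrite mulr1.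
Qed.

Lemma prob_deviates h : (forall z, 0 <= h z <= 1) ->
  \sum_(S | deviates S h) iid (labelled mu f) S <= 2 * expR (- (N%:R * eps ^+ 2 / 8)).
Proof.
move=> h01; apply: (hoeffding labelled_ge0 sum_labelled N h01).
rewrite eps0/=; apply: (le_trans epsk); case/andP: kap0 => k0 k1.
have : kap ^+ k <= 1 by rewrite exprn_ile1// ltW.
lra.
Qed.

(** Union bound over four statistics for each of n variables and at most 2^d patterns on its
    neighbours, and one for each of the 2^k patterns on [Sj]. *)
Lemma success_ge :
  1 - (4 * n%:R * 2 ^+ d + 2 ^+ k) * (2 * expR (- (N%:R * eps ^+ 2 / 8))) <=
  \sum_(S : N.-tuple (example n) | [forall h, learn_junta S G tau h ==> (h == f)])
     iid (labelled mu f) S.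
Proof.
pose W (S : N.-tuple (example n)) := iid (labelled mu f) S.
have W0 S : 0 <= W S by apply: prodr_ge0 => j _; exact: labelled_ge0.
have W1 : \sum_S W S = 1.
  by rewrite /W /iid (sum_tuple_prod N (labelled mu f)) sum_labelled expr1n.
set Q := expR _.
pose i0 := Ordinal n0.
pose ev1 i A c := local_statistic (nbrs G i) (set_pattern A) i c.
pose ev2 A := local_statistic Sj (set_pattern A) i0 0.
rewrite lerBlDr -[leLHS]W1 (bigID (fun S : N.-tuple (example n) => [forall h, learn_junta S G tau h ==> (h == f)])) /= lerD2l.
apply: (@le_trans _ _ (\sum_i \sum_(A in powerset (nbrs G i)) \sum_(c < 4)
     (\sum_(S | deviates S (ev1 i A c)) W S) +
   \sum_(A in powerset Sj) \sum_(S | deviates S (ev2 A)) W S)); last first.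
  apply: (@le_trans _ _ (\sum_(i < n) (2 ^+ d * 4 * (2 * Q)) + 2 ^+ k * (2 * Q))); last first.
    by rewrite sumr_const card_ord -mulr_natl le_eqVlt; apply/orP; left; apply/eqP; ring.
  apply: lerD.
    apply: ler_sum => i _.
    apply: (@le_trans _ _ (\sum_(A in powerset (nbrs G i)) (4 * (2 * Q)))).
      apply: ler_sum => A _; apply: (@le_trans _ _ (\sum_(c < 4) (2 * Q))).
        by apply: ler_sum => c _; apply: prob_deviates => z; exact: local_statistic01.
      by rewrite sumr_const card_ord -[leLHS]mulr_natl.
    rewrite sumr_const card_powerset -[leLHS]mulr_natl natrX -mulrA.
    rewrite ler_wpM2r ?mulr_ge0 ?expR_ge0//; apply: ler_weXn2l; first by rewrite ler1n.
    exact: degG.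
  apply: (@le_trans _ _ (\sum_(A in powerset Sj) (2 * Q))).
    by apply: ler_sum => A _; apply: prob_deviates => z; exact: local_statistic01.
  by rewrite sumr_const card_powerset cardSj -[leLHS]mulr_natl natrX.
rewrite big_mkcond /=.
rewrite (eq_bigr (fun i => \sum_S \sum_(A in powerset (nbrs G i)) \sum_(c < 4)
    (if deviates S (ev1 i A c) then W S else 0))); last first.
  move=> i _; rewrite [RHS]exchange_big; apply: eq_bigr => A _; rewrite [RHS]exchange_big.
  by apply: eq_bigr => c _; rewrite [LHS]big_mkcond.
rewrite exchange_big [X in _ <= _ + X](eq_bigr (fun A => \sum_S (if deviates S (ev2 A) then W S else 0))); last first.
  by move=> A _; rewrite [LHS]big_mkcond.
rewrite [X in _ <= _ + X]exchange_big -big_split /=; apply: ler_sum => S _.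
have t1 (b : bool) : 0 <= (if b then W S else 0) by case: b.
have s1 : 0 <= \sum_i \sum_(A in powerset (nbrs G i)) \sum_(c < 4) (if deviates S (ev1 i A c) then W S else 0).
  by apply: sumr_ge0 => i _; apply: sumr_ge0 => A _; apply: sumr_ge0.
have s2 : 0 <= \sum_(A in powerset Sj) (if deviates S (ev2 A) then W S else 0).
  by apply: sumr_ge0.
case: ifPn => [fails|_]; last exact: addr_ge0.
(* Sample tuples carrying a wrong label have weight 0, so the labels may be assumed correct. *)
have [lab|] := boolP [forall j, (tnth S j).2 == f (tnth S j).1]; last first.
  rewrite negb_forall => /existsP[j nj].
  have WS : W S = 0.
    by rewrite /W /iid (bigD1 j)//= /labelled (negbTE nj) mulr0 mul0r.
  by rewrite [leLHS]WS; exact: addr_ge0.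
have [|nd1] := boolP [exists i, exists A in powerset (nbrs G i), exists c : 'I_4, deviates S (ev1 i A c)].
  move=> /existsP[i /existsP[A /andP[AV /existsP[c dev]]]].
  rewrite -[leLHS]addr0; apply: lerD => //.
  rewrite (bigD1 i)//= -[leLHS]addr0; apply: lerD; last first.
    by apply: sumr_ge0 => i' _; apply: sumr_ge0 => A' _; apply: sumr_ge0.
  rewrite (bigD1 A)//= -[leLHS]addr0; apply: lerD; last first.
    by apply: sumr_ge0 => A' _; apply: sumr_ge0.
  by rewrite (bigD1 c)//= dev lerDl; apply: sumr_ge0.
have [|nd2] := boolP [exists A in powerset Sj, deviates S (ev2 A)].
  move=> /existsP[A /andP[AV dev]].
  rewrite -[leLHS]add0r; apply: lerD => //.
  by rewrite (bigD1 A)//= dev lerDl; apply: sumr_ge0.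
case/negP: fails; apply/forallP => h; apply/implyP => lh; apply/eqP.
have sub_pow V x : [set j in V | x j] \in powerset V.
  by rewrite powersetE; apply/fintype.subsetP => j; rewrite inE => /andP[].
have statE V x i c : local_statistic V x i c =1
    local_statistic V (set_pattern [set j in V | x j]) i c.
  by move=> z; rewrite /local_statistic agree_set_pattern.
have empE V x i c : empirical S (local_statistic V x i c) =
    empirical S (local_statistic V (set_pattern [set j in V | x j]) i c).
  by apply: eq_bigr => j _; rewrite statE.
have expE V x i c : expected (local_statistic V x i c) =
    expected (local_statistic V (set_pattern [set j in V | x j]) i c).
  by apply: eq_bigr => j _; rewrite statE.
apply: (learn_junta_unique mu_gt0 kap0 tau0 mu_kap degG cardSj eps0 epsd epsk N0 _ _ _ cov_sensitive cov_insensitive lh).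
- move=> z /tnthP[j ->]; exact/eqP/(forallP lab).
- move=> i x c c4; rewrite ltNge; apply/negP => dev; case/negP: nd1.
  apply/existsP; exists i; apply/existsP; exists [set j in nbrs G i | x j].
  rewrite sub_pow/=; apply/existsP; exists (Ordinal c4).
  by rewrite /deviates /ev1 -empE -expE.
- move=> i x; rewrite ltNge; apply/negP => dev; case/negP: nd2.
  apply/existsP; exists [set j in Sj | x j].
  by rewrite sub_pow/= /deviates /ev2 -empE -expE.
Qed.

End Success.
End Samples.

(** * Success probability and sample size *)

Section Success.
Variables (R : realType) (n k d : nat) (lambda sigma delta : R).
Hypotheses (n0 : (0 < n)%N) (sigma0 : 0 < sigma) (sigma2 : sigma < 2^-1).
Hypotheses (delta01 : 0 < delta < 1).

(* The confidence allotted to each of the at most [k <= 2 ^ k] relevant variables. *)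
Definition variable_confidence (delta : R) (k : nat) : R := delta / 2 / 2 ^+ k.

Definition influence_gap (delta lambda sigma : R) (k : nat) : R :=
  small_ratio lambda sigma (variable_confidence delta k) k / 2 ^+ k / 4.

(** A third of the covariance [kappa]^2 gap guaranteed for a sensitive variable, which leaves an
    error of tau on either side of the test. *)
Definition threshold (delta lambda sigma : R) (k d : nat) : R :=
  kappa lambda ^+ 2 * influence_gap delta lambda sigma k / 3.

(** Two requirements are met at once: accurate ratios on up to d neighbours, and at least one sample
    for each pattern on k coordinates. *)
Definition precision (delta lambda sigma : R) (k d : nat) : R :=
  kappa lambda ^+ (d + k) * threshold delta lambda sigma k d / 12.

Local Notation conf := (variable_confidence delta k).
Local Notation gap := (influence_gap delta lambda sigma k).
Local Notation tau := (threshold delta lambda sigma k d).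
Local Notation eps := (precision delta lambda sigma k d).

Lemma conf_gt0 : 0 < conf.
Proof.
by case/andP: delta01 => d0 _; rewrite divr_gt0 ?exprn_gt0// divr_gt0.
Qed.

Lemma conf_le1 : conf <= 1.
Proof.
move: (delta01) => /andP[d0 d1]; rewrite ler_pdivrMr ?exprn_gt0// mul1r.
have : 1 <= 2 ^+ k :> R by rewrite exprn_ege1// ler1n.
lra.
Qed.

Lemma gap_gt0 : 0 < gap.
Proof.
rewrite divr_gt0// divr_gt0 ?exprn_gt0//; apply: small_ratio_gt0 => //.
exact: conf_gt0.
Qed.

Lemma gap_le1 : gap <= 1.
Proof.
have s1 : small_ratio lambda sigma conf k <= 1.
  by apply: small_ratio_le1; rewrite ?conf_gt0 ?conf_le1.
have p1 : 1 <= 2 ^+ k :> R by rewrite exprn_ege1// ler1n.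
rewrite ler_pdivrMr// ler_pdivrMr ?exprn_gt0//; lra.
Qed.

Lemma threshold_gt0 : 0 < tau.
Proof. by rewrite divr_gt0// mulr_gt0 ?gap_gt0// exprn_gt0// kappa_gt0. Qed.

Lemma threshold_le1 : tau <= 1.
Proof.
rewrite ler_pdivrMr// mul1r; have g0 := gap_gt0; have g1 := gap_le1.
have k0 : 0 <= kappa lambda ^+ 2 by apply: sqr_ge0.
have k1 : kappa lambda ^+ 2 <= 1.
  by rewrite exprn_ile1 ?kappa_le1// ltW// kappa_gt0.
have : kappa lambda ^+ 2 * gap <= 1 by apply: mulr_ile1 => //; exact: ltW.
lra.
Qed.

Lemma precision_gt0 : 0 < eps.
Proof. by rewrite divr_gt0// mulr_gt0 ?threshold_gt0// exprn_gt0// kappa_gt0. Qed.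

Lemma precision_le_restriction : eps <= kappa lambda ^+ d * tau / 12.
Proof.
rewrite /precision ler_wpM2r ?invr_ge0// ler_wpM2r ?(ltW threshold_gt0)//.
by apply: ler_wiXn2l; rewrite ?(ltW (kappa_gt0 _)) ?kappa_le1// leq_addr.
Qed.

Lemma precision_le_pattern : eps <= kappa lambda ^+ k.
Proof.
have h : kappa lambda ^+ (d + k) <= kappa lambda ^+ k.
  by apply: ler_wiXn2l; rewrite ?(ltW (kappa_gt0 _)) ?kappa_le1// leq_addl.
have t0 := threshold_gt0; have t1 := threshold_le1.
have p0 : 0 < kappa lambda ^+ (d + k) by rewrite exprn_gt0// kappa_gt0.
have : kappa lambda ^+ (d + k) * tau <= kappa lambda ^+ (d + k).
  by rewrite ger_pMr.
by rewrite /precision; lra.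
Qed.

Section Model.
Variables (psi : mpoly n R) (G : rel 'I_n) (f : {ffun cube n -> bool}) (Sj : {set 'I_n}).
Hypothesis psil : forall j, norm1 (mderiv j psi) <= lambda.
Hypotheses (irrG : irreflexive G) (degG : max_degree_le G d).
Hypothesis depG : forall alpha : 'I_n -> R, (forall i, - sigma <= alpha i <= sigma) ->
  dependency_graph (mrf (smoothed psi alpha)) G.
Hypotheses (cardSj : #|Sj| = k) (fSj : forall x y, agree Sj x y -> f x = f y).
Variable N : nat.
Hypothesis N0 : (0 < N)%N.
Hypothesis sampleN :
  (4 * n%:R * 2 ^+ d + 2 ^+ k) * (2 * expR (- (N%:R * eps ^+ 2 / 8))) <= delta / 2.

Lemma success_of_gap (alpha : 'I_n -> R) (w : 'I_n -> cube n) :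
  (forall i, - sigma <= alpha i <= sigma) ->
  (forall i, i \in sensitive_coords f ->
     gap * mass psi (nbrs G i) (w i) (fun j => 1 + alpha j) <=
     `|signed_mass psi f (nbrs G i) i (w i) (fun j => 1 + alpha j)|) ->
  1 - delta / 2 <=
  \sum_(S : N.-tuple (example n) | [forall h, learn_junta S G tau h ==> (h == f)])
     iid (labelled (mrf (smoothed psi alpha)) f) S.
Proof.
move: (sigma0) (sigma2) => s0 s2 ar hgap.
have b0 j : 0 < 1 + alpha j by have /andP[? ?] := ar j; lra.
pose beta j := 1 + alpha j; pose Z := \sum_z weight psi beta z.
have bb j : 2^-1 <= beta j <= 2 by rewrite /beta; have /andP[? ?] := ar j; apply/andP; split; lra.
pose mu := mrf (smoothed psi alpha).
have muE x : mu x = weight psi beta x / Z by exact: mrf_smoothedE.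
have w0 x : 0 < weight psi beta x by apply: weight_gt0.
have Z0 : 0 < Z.
  by rewrite /Z (bigD1 (w (Ordinal n0)))//= ltr_pwDl// sumr_ge0// => x _; exact: ltW.
have mu0 x : 0 < mu x by rewrite muE divr_gt0.
have mu1 : \sum_x mu x = 1.
  by rewrite (eq_bigr _ (fun x _ => muE x)) -mulr_suml divff// gt_eqF.
have L0 : 0 <= 2 * expR lambda by rewrite mulr_ge0// expR_ge0.
have muL i x : mu (flipc i x) <= 2 * expR lambda * mu x.
  by rewrite !muE mulrA ler_wpM2r ?invr_ge0 ?(ltW Z0)//; exact: weight_flipc.
have kap01 : 0 < kappa lambda <= 1 by rewrite kappa_gt0 kappa_le1.
have mu_kap (V : {set 'I_n}) x : kappa lambda ^+ #|V| <= prob mu (agree V x).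
  have := @prob_agree_ge R n mu _ (fun u => ltW (mu0 u)) L0 muL finset.set0 V x.
  rewrite finset.setU0.
  have -> : prob mu (agree finset.set0 x) = 1.
    by rewrite -mu1; apply: eq_bigl => u; apply/agreeP => j; rewrite inE.
  by rewrite mulr1.
have dep : dependency_graph mu G by exact: depG.
have t01 : 0 < tau <= 1 by rewrite threshold_gt0 threshold_le1.
have sens i : i \in sensitive_coords f -> exists x, 3 * tau <= `|conditional_covariance mu f G i x|.
  move=> iS; exists (w i); have m0 : 0 < mass psi (nbrs G i) (w i) beta.
    exact: prob_agree_gt0.
  apply: le_trans (covariance_ge mu0 irrG dep L0 muL f i (w i)).
  have -> : (\sum_(u | agree (nbrs G i) (w i) u) mu u * derivative R f i u) /
      prob mu (agree (nbrs G i) (w i)) =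
      signed_mass psi f (nbrs G i) i (w i) beta / mass psi (nbrs G i) (w i) beta.
    have -> : prob mu (agree (nbrs G i) (w i)) = mass psi (nbrs G i) (w i) beta / Z.
      by rewrite /mass /prob mulr_suml; apply: eq_bigr => u _; rewrite muE.
    have -> : \sum_(u | agree (nbrs G i) (w i) u) mu u * derivative R f i u =
        signed_mass psi f (nbrs G i) i (w i) beta / Z.
      by rewrite /signed_mass mulr_suml; apply: eq_bigr => u _; rewrite muE mulrAC.
    by field; rewrite !gt_eqF.
  have -> : 3 * tau = kappa lambda ^+ 2 * gap by rewrite /threshold; field.
  rewrite -/(kappa lambda) ler_wpM2l ?sqr_ge0//.
  rewrite normrM normfV (gtr0_norm m0) ler_pdivlMr//; exact: hgap.
have insens i x : i \notin sensitive_coords f -> conditional_covariance mu f G i x = 0.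
  move=> iS; rewrite /conditional_covariance covariance_derivative//.
  rewrite [X in _ * (X / _)]big1 ?mul0r ?mulr0// => u _.
  have fl b : f (set_coord u i b) = f u.
    have [<-|ub] := eqVneq (u i) b.
      by congr (f _); apply/ffunP => j; rewrite ffunE; case: eqP => // ->.
    rewrite -(not_sensitive u iS); congr (f _); rewrite /flipc; congr set_coord.
    by move: ub; case: (u i); case: b.
  by rewrite /derivative !fl subrr mulr0.
apply: le_trans (success_ge fSj mu0 mu1 kap01 t01 mu_kap degG cardSj precision_gt0
  precision_le_restriction precision_le_pattern N0 n0 sens insens).
by rewrite lerD2l lerN2.
Qed.

Lemma fine_grid (c e : R) : 0 < c -> 0 < e ->
  exists M : nat, [/\ (0 < M)%N, 2 ^+ k <= M%:R * c & (1 + 2 / M%:R) ^+ n <= 1 + e].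
Proof.
move=> c0 e0; have nR : 0 < n%:R :> R by rewrite ltr0n.
(* The three terms ensure, in this order, the slope condition, y <= 1/2 and 2 y <= e for y = 2 n /
   M. Then (1 + 2 / M)^n <= exp y <= 1 + y + 2 y^2 <= 1 + 2 y. *)
pose B := 2 ^+ k / c + 4 * n%:R + 4 * n%:R / e.
have B1 : 0 <= 2 ^+ k / c by rewrite divr_ge0 ?exprn_ge0// ltW.
have B2 : 0 <= 4 * n%:R / e by rewrite divr_ge0 ?mulr_ge0// ltW.
have B0 : 0 < B by rewrite /B; lra.
have [M BM] : exists M : nat, B < M%:R.
  by exists (Num.trunc B).+1; exact: Num.Theory.truncnS_gt.
have MR : 0 < M%:R :> R by lra.
exists M; split; first by rewrite -(ltr0n R).
  by rewrite -ler_pdivrMr//; move: BM; rewrite /B; lra.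
pose y : R := 2 / M%:R * n%:R.
have y0 : 0 <= y by rewrite mulr_ge0// divr_ge0// ltW.
have yE : y * M%:R = 2 * n%:R by rewrite /y; field; rewrite gt_eqF.
have y2 : y <= 2^-1.
  rewrite -(ler_pM2r MR) yE; move: BM; rewrite /B; lra.
apply: (@le_trans _ _ (expR (2 / M%:R) ^+ n)).
  have q0 : 0 <= 1 + 2 / M%:R :> R by rewrite addr_ge0// divr_ge0// ltW.
  by apply: lerXn2r; rewrite ?nnegrE ?expR_ge0 ?expR_ge1Dx.
rewrite -expRM_natr -/y; apply: (le_trans (expR_le_quadratic _)).
  by rewrite ger0_norm.
have y1 : 2 * y <= e.
  rewrite -(ler_pM2r MR) -mulrA yE.
  have : 4 * n%:R / e * e <= M%:R * e by rewrite ler_pM2r//; move: BM; rewrite /B; lra.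
  rewrite divfK ?gt_eqF//; lra.
nra.
Qed.

(** Half of delta pays for the bad cells, half for unlucky samples, and (1 - delta / 2)^2 >= 1 -
    delta. *)
Lemma success_probability_ge (disp : measure_display) (Omega : measurableType disp)
    (P : probability Omega R) (alpha : 'I_n -> {RV P >-> R}) :
  iid_uniform sigma0 alpha ->
  ((1 - delta)%:E <= success_probability N psi G f tau alpha)%E.
Proof.
move=> unif; move: (delta01) => /andP[d0 d1].
(* The restriction that reveals a sensitive i is the one induced on its neighbours by a point where
   D_i f does not vanish. *)
have [w hw] : exists w : 'I_n -> cube n, forall i, i \in sensitive_coords f ->
    derivative R f i (w i) != 0.
  apply: (@fin_all_exists _ _ (fun i x => i \in sensitive_coords f -> derivative R f i x != 0)) => i.
  have [|iS] := boolP (i \in sensitive_coords f); last by exists [ffun=> false].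
  rewrite inE => /existsP[x fx]; exists x => _; apply: contra fx.
  have h b : set_coord x i b = if b == x i then x else flipc i x.
    case: eqP => [->|/eqP bx]; first by apply/ffunP => j; rewrite ffunE; case: eqP => // ->.
    by rewrite /flipc; congr set_coord; move: bx; case: b; case: (x i).
  rewrite /derivative !h; case: (x i) => /=; case: (f x); case: (f (flipc i x)) => //=;
    by rewrite ?subr0 ?sub0r ?oppr_eq0 oner_eq0.
have c0 := conf_gt0.
have sr0 : 0 < small_ratio lambda sigma conf #|Sj| by apply: small_ratio_gt0.
have [M [M0 hM hMn]] := fine_grid sr0 gap_gt0.
pose bad i := bad_cells psi lambda sigma f Sj (nbrs G i) i (w i) M conf.
pose Good : {set cell n M} := [set c | [forall i in sensitive_coords f, c \notin bad i]].
have cells0 : 0 < #|{: cell n M}|%:R :> R.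
  by rewrite ltr0n card_ffun !card_ord expn_gt0 M0.
have cardGood : 1 - delta / 2 <= #|Good|%:R / #|{: cell n M}|%:R.
  rewrite ler_pdivlMr//.
  have cb i : i \in sensitive_coords f -> #|bad i|%:R <= conf * #|{: cell n M}|%:R.
    by move=> iS; apply: card_bad_cells => //; [exact: hw|rewrite cardSj in hM *].
  have cover : (#|~: Good| <= \sum_(i in sensitive_coords f) #|bad i|)%N.
    apply: (@leq_trans #|\bigcup_(i in sensitive_coords f) bad i|).
      apply/subset_leq_card/fintype.subsetP => c; rewrite !inE negb_forall.
      move=> /existsP[i]; rewrite negb_imply negbK => /andP[iS ci].
      by apply/finset.bigcupP; exists i.
    elim/big_ind2: _ => //; first by rewrite cards0.
    move=> A a B b hA hB; apply: leq_trans (leq_add hA hB).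
    by rewrite cardsU leq_subr.
  have bd : #|~: Good|%:R <= delta / 2 * #|{: cell n M}|%:R.
    apply: (@le_trans _ _ (\sum_(i in sensitive_coords f) (conf * #|{: cell n M}|%:R))).
      apply: (@le_trans _ _ (\sum_(i in sensitive_coords f) #|bad i|)%:R).
        by rewrite ler_nat.
      by rewrite natr_sum; apply: ler_sum => i iS; exact: cb.
    rewrite sumr_const -[leLHS]mulr_natl mulrA ler_wpM2r ?(ltW cells0)//.
    rewrite /variable_confidence mulrA ler_pdivrMr ?exprn_gt0// mulrC.
    rewrite ler_wpM2l ?divr_ge0 ?(ltW d0)// -natrX ler_nat.
    apply: leq_trans (ltnW (ltn_expl k (ltnSn 1))).
    by rewrite -cardSj; apply/subset_leq_card/sensitive_sub.
  have : (#|Good| + #|~: Good|)%:R = #|{: cell n M}|%:R :> R by rewrite cardsC.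
  by rewrite natrD mulrBl mul1r; lra.
have v0 : 0 <= 1 - delta / 2 by lra.
rewrite /success_probability.
apply: (@le_trans _ _ ((1 - delta / 2) * (#|Good|%:R / #|{: cell n M}|%:R))%:E).
  rewrite lee_fin; apply: (@le_trans _ _ ((1 - delta / 2) * (1 - delta / 2))).
    by have := sqr_ge0 delta; rewrite expr2; lra.
  by rewrite ler_wpM2l.
apply: (integral_ge_boxes M0 unif) => //.
  move=> x; rewrite lee_fin; apply: sumr_ge0 => S _; apply: prodr_ge0 => j _.
  rewrite mulr_ge0// /mrf divr_ge0 ?expR_ge0//; apply: sumr_ge0 => y _; exact: expR_ge0.
move=> c om cG bom; rewrite lee_fin.
have cnear := box_near bom.
apply: (@success_of_gap (fun i => alpha i om) w); first exact: (box_range sigma0 M0 bom).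
move=> i iS; rewrite /influence_gap -cardSj.
apply: (@good_cell_influence R n psi lambda sigma f Sj (nbrs G i) i (w i) sigma0 sigma2 M M0
  (variable_confidence delta #|Sj|) (influence_gap delta lambda sigma #|Sj|) c) => //.
- by rewrite cardSj conf_gt0 conf_le1.
- by rewrite cardSj.
- by move: cG; rewrite inE cardSj => /forall_inP; apply.
Qed.

End Model.
End Success.

(** * Polynomial bound on the required sample size *)

Section SampleSize.
Variables (R : realType) (n k d : nat) (lambda sigma delta : R).
Hypotheses (n0 : (0 < n)%N) (k0 : (0 < k)%N) (lambda0 : 0 <= lambda).
Hypotheses (sigma0 : 0 < sigma) (sigma2 : sigma < 2^-1) (delta01 : 0 < delta < 1).

Local Notation E := (expR (lambda * (d + k)%N%:R)).
Local Notation c := (2 ^+ (d + k)%N : R).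

(** As lambda >= 0, 1 + 2 exp lambda <= 4 exp lambda. The power 4 (d + k) of the latter is c^8
    E^4. *)
Lemma kappa_pow_ge (m : nat) : (m <= 4 * (d + k))%N ->
  (c ^+ 8 * E ^+ 4)^-1 <= kappa lambda ^+ m.
Proof.
move=> hm; have e1 : 1 <= expR lambda by have := expR_ge1Dx lambda; move: (lambda0); lra.
have e0 : 0 < expR lambda by exact: expR_gt0.
apply: (@le_trans _ _ (kappa lambda ^+ (4 * (d + k)))); last first.
  by apply: ler_wiXn2l; rewrite ?(ltW (kappa_gt0 _)) ?kappa_le1.
have -> : (c ^+ 8 * E ^+ 4)^-1 = (4 * expR lambda)^-1 ^+ (4 * (d + k)).
  rewrite exprVn; congr (_^-1); rewrite mulnC exprM.
  have -> : 4 = 2 ^+ 2 :> R by rewrite -natrX.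
  have -> : E = expR lambda ^+ (d + k) by rewrite mulrC expRM_natl.
  have -> : c ^+ 8 = ((2 ^+ 2) ^+ (d + k)) ^+ 4 by rewrite -!exprM; congr (_ ^+ _); lia.
  by rewrite !exprMn.
have i0 : 0 <= (4 * expR lambda)^-1 by rewrite invr_ge0; lra.
apply: lerXn2r; rewrite ?nnegrE ?(ltW (kappa_gt0 _))//.
by rewrite /kappa lef_pV2 ?posrE; lra.
Qed.

Lemma precision_ge :
  1 <= precision delta lambda sigma k d *
       (2 ^+ 11 * (c ^+ 22 * E ^+ 4 * sigma ^- k * delta^-1 ^+ 2)).
Proof.
move: (delta01) => /andP[d0 d1]; pose u : R := 2 ^+ k.
have u1 : 1 <= u by rewrite exprn_ege1// ler1n.
have u0 : 0 < u by apply: lt_le_trans u1.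
have uc : u <= c by rewrite ler_eXn2l ?leq_addl// ltr1n.
have c0 : 0 < c by rewrite exprn_gt0.
have E0 : 0 < E by exact: expR_gt0.
have s0 : 0 < sigma ^+ k by rewrite exprn_gt0.
pose A := kappa lambda ^+ (d + k + 2 + k).
have A1 : (c ^+ 8 * E ^+ 4)^-1 <= A by apply: kappa_pow_ge; lia.
(* The exponent 14 of 2^k collects 11 from [growth], as 8 times 16^2 is 2^11, 2 from the square of
   [variable_confidence] and 1 from [influence_gap]. With the 8 of [kappa_pow_ge] this makes 22. The
   numerical denominators 3, 12, 4, 2 and 4 multiply to 9 times 2^7. *)
have eE : precision delta lambda sigma k d = A * (delta ^+ 2 * sigma ^+ k / u ^+ 14) / (9 * 2 ^+ 7).
  rewrite /precision /threshold /influence_gap /small_ratio /variable_confidence.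
  rewrite growth_sqr// -/u.
  have -> : (8 * 16 ^+ 2 / sigma) ^+ k = u ^+ 11 / sigma ^+ k.
    rewrite expr_div_n; congr (_ / _); rewrite /u -exprM mulnC exprM; congr (_ ^+ _).
    by rewrite -!natrX -natrM.
  rewrite /A !exprD; move: (kappa lambda ^+ d) (kappa lambda ^+ k) => q1 q2.
  by field; rewrite !gt_eqF.
rewrite eE.
have h1 : (c ^+ 8 * E ^+ 4)^-1 * (c ^+ 14 / u ^+ 14) * (2 ^+ 11 / (9 * 2 ^+ 7)) * c ^+ 8 * E ^+ 4 <=
  A * (c ^+ 14 / u ^+ 14) * (2 ^+ 11 / (9 * 2 ^+ 7)) * c ^+ 8 * E ^+ 4.
  have pos : 0 <= (c ^+ 14 / u ^+ 14) * (2 ^+ 11 / (9 * 2 ^+ 7)) * (c ^+ 8 * E ^+ 4).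
    by rewrite !mulr_ge0 ?invr_ge0 ?mulr_ge0 ?exprn_ge0 ?(ltW E0) ?(ltW c0) ?(ltW u0).
  by have := ler_wpM2r pos A1; rewrite !mulrA.
have h2 : 1 <= (c ^+ 8 * E ^+ 4)^-1 * (c ^+ 14 / u ^+ 14) * (2 ^+ 11 / (9 * 2 ^+ 7)) * c ^+ 8 * E ^+ 4.
  have -> : (c ^+ 8 * E ^+ 4)^-1 * (c ^+ 14 / u ^+ 14) * (2 ^+ 11 / (9 * 2 ^+ 7)) * c ^+ 8 * E ^+ 4 =
    (c / u) ^+ 14 * (2 ^+ 4 / 9).
    by rewrite expr_div_n; field; rewrite !gt_eqF.
  have q1 : 1 <= c / u by rewrite ler_pdivlMr// mul1r.
  have q2 : 1 <= (c / u) ^+ 14 by rewrite exprn_ege1.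
  have q3 : 1 <= 2 ^+ 4 / 9 :> R by rewrite ler_pdivlMr// mul1r -natrX ler_nat.
  by rewrite -[leLHS]mul1r; apply: ler_pM.
apply: (le_trans h2); apply: (le_trans h1); rewrite le_eqVlt; apply/orP; left; apply/eqP.
by field; rewrite !gt_eqF.
Qed.

(** The factor 2^25 = 8 (2^11)^2 makes the Hoeffding exponent at least ln n + 2^5 c / delta, by
    [precision_ge]. The bound exp x >= x lets c / delta stand in for its logarithm, as any
    polynomial will do. *)
Lemma sample_size (N : nat) :
  2 ^+ 25 * (ln n%:R + 2 ^+ 5 * c * delta^-1) *
    (c ^+ 22 * E ^+ 4 * sigma ^- k * delta^-1 ^+ 2) ^+ 2 <= N%:R ->
  (0 < N)%N /\
  (4 * n%:R * 2 ^+ d + 2 ^+ k) *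
    (2 * expR (- (N%:R * precision delta lambda sigma k d ^+ 2 / 8))) <= delta / 2.
Proof.
move: (delta01) => /andP[d0 d1]; set B := _ * delta^-1 ^+ 2 => hN.
have c1 : 1 <= c by rewrite exprn_ege1// ler1n.
have nR : 1 <= n%:R :> R by rewrite ler1n.
have L0 : 0 <= ln n%:R :> R by exact: ln_ge0.
have cD : 0 < 2 ^+ 5 * c * delta^-1.
  by rewrite mulr_gt0 ?invr_gt0// mulr_gt0 ?exprn_gt0.
pose y := ln n%:R + 2 ^+ 5 * c * delta^-1.
have y0 : 0 < y by rewrite /y; lra.
have eB := precision_ge; rewrite -/B in eB.
set eps := precision _ _ _ _ _ in eB *.
have eps0 : 0 < eps by apply: precision_gt0.
have B0 : 0 < B.
  by have := lt_le_trans ltr01 eB; rewrite pmulr_rgt0// pmulr_rgt0 ?exprn_gt0.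
have Ny : y <= N%:R * eps ^+ 2 / 8.
  rewrite ler_pdivlMr//; apply: (@le_trans _ _ (2 ^+ 25 * y * B ^+ 2 * eps ^+ 2)); last first.
    by rewrite ler_wpM2r ?sqr_ge0.
  have -> : 2 ^+ 25 * y * B ^+ 2 * eps ^+ 2 = y * 8 * (eps * (2 ^+ 11 * B)) ^+ 2 by ring.
  by rewrite ler_peMr ?exprn_ege1// mulr_ge0// ltW.
split.
  rewrite -(ltr0n R); apply: lt_le_trans hN.
  by rewrite -/y; apply: mulr_gt0; rewrite ?exprn_gt0// mulr_gt0 ?exprn_gt0.
have ey : expR (- (N%:R * eps ^+ 2 / 8)) <= delta / (n%:R * (2 ^+ 5 * c)).
  apply: (@le_trans _ _ (expR (- y))); first by rewrite ler_expR lerN2.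
  rewrite expRN /y expRD lnK ?posrE; last lra.
  have -> : delta / (n%:R * (2 ^+ 5 * c)) = (n%:R * (2 ^+ 5 * c * delta^-1))^-1.
    by field; rewrite ?gt_eqF//; lra.
  have n1 : 0 < n%:R :> R by lra.
  rewrite lef_pV2 ?posrE; [|exact: mulr_gt0 (expR_gt0 _)|exact: mulr_gt0].
  rewrite ler_wpM2l ?(ltW n1)//; have := expR_ge1Dx (2 ^+ 5 * c * delta^-1); lra.
have cnt : 4 * n%:R * 2 ^+ d + 2 ^+ k <= 5 * (n%:R * c).
  have h1 : 2 ^+ d <= c by rewrite ler_eXn2l ?leq_addr// ltr1n.
  have h2 : 2 ^+ k <= c by rewrite ler_eXn2l ?leq_addl// ltr1n.
  have : n%:R * 2 ^+ d <= n%:R * c by rewrite ler_wpM2l.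
  have : 1 * c <= n%:R * c by rewrite ler_wpM2r//; lra.
  lra.
have nc : 0 < n%:R * c by rewrite mulr_gt0//; lra.
apply: (@le_trans _ _ (5 * (n%:R * c) * (2 * (delta / (n%:R * (2 ^+ 5 * c)))))).
  have x0 : 0 <= 4 * n%:R * 2 ^+ d + 2 ^+ k :> R.
    by apply: addr_ge0; rewrite ?exprn_ge0// mulr_ge0 ?exprn_ge0 ?mulr_ge0.
  have z0 : 0 <= 2 * expR (- (N%:R * eps ^+ 2 / 8)) by rewrite mulr_ge0 ?expR_ge0.
  by apply: (ler_pM x0 z0 cnt); rewrite ler_wpM2l.
(* Origin of 2^5: at most 5 n c events, each with bound 2 delta / (2^5 n c), leave 10 / 2^5 <= 1/2
   of delta. *)
have -> : 5 * (n%:R * c) * (2 * (delta / (n%:R * (2 ^+ 5 * c)))) = delta * (5 / 2 ^+ 4).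
  by field; rewrite ?gt_eqF//; lra.
rewrite ler_wpM2l ?(ltW d0)// ler_pdivrMr ?exprn_gt0//.
by rewrite (_ : 2^-1 * 2 ^+ 4 = 8); [rewrite ler_nat|field].
Qed.

End SampleSize.

(** * Polynomials with nonnegative coefficients *)

Section Polynomials.
Variables (R : realType) (m : nat).
Implicit Types p q : mpoly m R.

Lemma nonneg_coeffsC (a : R) : 0 <= a -> nonneg_coeffs (mpolyC m a).
Proof. by move=> a0 u; rewrite mcoeffC mulr_ge0. Qed.

Lemma nonneg_coeffsX i : nonneg_coeffs (mvar R i : mpoly m R).
Proof. by move=> u; rewrite mcoeffX. Qed.

Lemma nonneg_coeffsD p q : nonneg_coeffs p -> nonneg_coeffs q -> nonneg_coeffs (p + q).
Proof. by move=> hp hq u; rewrite mcoeffD addr_ge0. Qed.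

Lemma nonneg_coeffsM p q : nonneg_coeffs p -> nonneg_coeffs q -> nonneg_coeffs (p * q).
Proof. by move=> hp hq u; rewrite mcoeffM sumr_ge0// => l _; rewrite mulr_ge0. Qed.

Lemma nonneg_coeffsXn p e : nonneg_coeffs p -> nonneg_coeffs (p ^+ e).
Proof.
move=> hp; elim: e => [|e IH]; last by rewrite exprS; exact: nonneg_coeffsM.
by rewrite expr0 => u; rewrite mcoeff1.
Qed.

Lemma mevalXn v p e : meval v (p ^+ e) = meval v p ^+ e.
Proof.
by elim: e => [|e IH]; rewrite ?expr0 ?meval1// !exprS mevalM IH.
Qed.

End Polynomials.

(** * Assembly, and the regime where d and k are O(log n) *)

Section MainTheorem.
Variable R : realType.

Definition sample_poly : mpoly 5 R :=
  let L := mvar R (@Ordinal 5 0 isT) in let E := mvar R (@Ordinal 5 1 isT) in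
  let c := mvar R (@Ordinal 5 2 isT) in let s := mvar R (@Ordinal 5 3 isT) in
  let D := mvar R (@Ordinal 5 4 isT) in
  mpolyC 5 (2 ^+ 25) * (L + mpolyC 5 (2 ^+ 5) * c * D) *
    (c ^+ 22 * E ^+ 4 * s * D ^+ 2) ^+ 2.

Lemma nonneg_sample_poly : nonneg_coeffs sample_poly.
Proof.
repeat (first [apply: nonneg_coeffsM | apply: nonneg_coeffsD | apply: nonneg_coeffsXn
  | apply: nonneg_coeffsX | apply: nonneg_coeffsC; apply: exprn_ge0; exact: ler0n]).
Qed.

Lemma eval_sample_poly (L E c s D : R) :
  eval5 sample_poly L E c s D =
  2 ^+ 25 * (L + 2 ^+ 5 * c * D) * (c ^+ 22 * E ^+ 4 * s * D ^+ 2) ^+ 2.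
Proof. by rewrite /eval5 /sample_poly !(mevalM, mevalD, mevalXn, mevalC, mevalXU). Qed.

Local Notation X0 := (mvar R (@Ordinal 2 0 isT)).
Local Notation X1 := (mvar R (@Ordinal 2 1 isT)).

(** The bound of [program_costs] with r in place of the sample size: the second variable itself, or
    a polynomial sample bound in n and 1/delta. *)
Definition time_poly (r : mpoly 2 R) : mpoly 2 R :=
  mpolyC 2 400%:R * ((1 + X0) ^+ 2 * (1 + r) ^+ 2).

Lemma eval_time_poly r (a b : R) :
  eval2 (time_poly r) a b = 400%:R * ((1 + a) ^+ 2 * (1 + eval2 r a b) ^+ 2).
Proof. by rewrite /eval2 /time_poly !(mevalM, mevalD, mevalXn, mevalC, mevalXU, meval1). Qed.

Lemma learns_within_time (n k d : nat) (lambda sigma : R) (sigma0 : 0 < sigma)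
    (delta T : R) (N : nat) :
  (1 <= n)%N -> (1 <= k)%N -> sigma < 2^-1 -> 0 < delta < 1 ->
  sample_bound sample_poly n k d lambda sigma delta <= N%:R ->
  (400 * ((1 + n) ^ 2 * (1 + N) ^ 2))%:R <= T ->
  learns_within learn_cmd predict_cmd n k d lambda sigma0 delta
    (threshold delta lambda sigma k d) N T.
Proof.
move=> n0 k0 sigma2 delta01; rewrite /sample_bound eval_sample_poly => hN hT.
move=> psi G f _ psil [_ irrG] degG depG [Sj [cardSj [g fg]]].
(* lambda bounds a norm, and n >= 1 provides a variable to read this from. *)
have lambda0 : 0 <= lambda.
  by apply: le_trans (psil (Ordinal n0)); apply: sumr_ge0.
have [N0 sampleN] := sample_size n0 k0 lambda0 sigma0 sigma2 delta01 hN.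
have fSj x y : agree Sj x y -> f x = f y.
  move=> /agreeP axy; rewrite !fg; congr g; apply/ffunP => j; rewrite !ffunE.
  by apply/esym/axy/enum_valP.
split=> [S|disp Omega P alpha unif].
  have [c1 c2] := program_costs S; rewrite size_tuple in c1 c2.
  apply: implements_learn_junta.
  - exact/ltW/threshold_gt0.
  - by apply: le_trans hT; rewrite ler_nat.
  - by apply: le_trans hT; rewrite ler_nat.
exact: (success_probability_ge n0 sigma2 delta01 psil irrG degG depG cardSj fSj N0 sampleN unif).
Qed.

(** A base to the power O(log n) is polynomial in n, since |B| <= exp |B| and exp (1 + ln n) = e
    n. *)
Lemma pow_le_poly (B C : R) : exists m : nat, forall n j : nat, (1 <= n)%N ->
  j%:R <= C * (1 + ln n%:R) -> `|B| ^+ j <= (expR 1 * n%:R) ^+ m.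
Proof.
exists (Num.trunc (`|B| * `|C|)).+1 => n j n0 hj; set m := _.+1.
have hm : `|B| * `|C| <= m%:R by apply/ltW/Num.Theory.truncnS_gt.
have nR : 1 <= n%:R :> R by rewrite ler1n.
have L0 : 0 <= ln n%:R :> R by exact: ln_ge0.
have -> : expR 1 * n%:R = expR (1 + ln n%:R) :> R.
  by rewrite expRD lnK// posrE; lra.
rewrite -expRM_natl; apply: (@le_trans _ _ (expR `|B| ^+ j)).
  apply: lerXn2r; rewrite ?nnegrE ?expR_ge0//.
  by have := expR_ge1Dx `|B|; lra.
rewrite -expRM_natl ler_expR.
apply: (@le_trans _ _ (`|C| * (1 + ln n%:R) * `|B|)).
  rewrite ler_wpM2r//; apply: (le_trans hj); rewrite ler_wpM2r ?ler_norm//; lra.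
rewrite mulrAC [X in X * _]mulrC ler_wpM2r//; lra.
Qed.

Lemma sample_bound_mono (L E c s D L' E' c' s' : R) :
  0 <= L <= L' -> 0 <= E <= E' -> 0 <= c <= c' -> 0 <= s <= s' -> 0 <= D ->
  2 ^+ 25 * (L + 2 ^+ 5 * c * D) * (c ^+ 22 * E ^+ 4 * s * D ^+ 2) ^+ 2 <=
  2 ^+ 25 * (L' + 2 ^+ 5 * c' * D) * (c' ^+ 22 * E' ^+ 4 * s' * D ^+ 2) ^+ 2.
Proof.
move=> /andP[L0 LL] /andP[E0 EE] /andP[c0 cc] /andP[s0 ss] D0.
have c0' := le_trans c0 cc; have E0' := le_trans E0 EE; have s0' := le_trans s0 ss.
have L0' := le_trans L0 LL.
have pos2 e : 0 <= 2 ^+ e :> R by rewrite exprn_ge0.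
have X p x y : 0 <= x -> x <= y -> x ^+ p <= y ^+ p :> R.
  by move=> x0 xy; apply: lerXn2r; rewrite ?nnegrE// (le_trans x0).
have h1 : 2 ^+ 5 * c * D <= 2 ^+ 5 * c' * D by rewrite ler_wpM2r// ler_wpM2l.
have p1 : 0 <= 2 ^+ 5 * c * D by rewrite !mulr_ge0.
have q : c ^+ 22 * E ^+ 4 * s <= c' ^+ 22 * E' ^+ 4 * s'.
  apply: ler_pM => //; first by rewrite mulr_ge0 ?exprn_ge0.
  by apply: ler_pM; rewrite ?exprn_ge0 ?X.
have q0 : 0 <= c ^+ 22 * E ^+ 4 * s by rewrite !mulr_ge0 ?exprn_ge0.
apply: ler_pM; rewrite ?exprn_ge0 ?mulr_ge0 ?addr_ge0 ?exprn_ge0//.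
- by rewrite ler_wpM2l// lerD.
- by apply: X; rewrite ?mulr_ge0 ?exprn_ge0// ler_wpM2r ?exprn_ge0.
Qed.

(** The summand 1 leaves room for rounding the bound up to an integer sample size. *)
Lemma polynomial_sample_bound (lambda sigma C : R) : 0 < sigma ->
  exists r : mpoly 2 R, forall (n k d : nat) (delta : R),
    (1 <= n)%N -> 0 < delta ->
    d%:R <= C * (1 + ln n%:R) -> k%:R <= C * (1 + ln n%:R) ->
    1 + sample_bound sample_poly n k d lambda sigma delta <= eval2 r n%:R delta^-1.
Proof.
move=> sigma0.
have [m1 h1] := pow_le_poly (expR `|lambda|) (2 * C).
have [m2 h2] := pow_le_poly 2 (2 * C).
have [m3 h3] := pow_le_poly sigma^-1 C.
pose e : mpoly 2 R := mpolyC 2 (expR 1) * X0.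
exists (1 + mpolyC 2 (2 ^+ 25) * (X0 + mpolyC 2 (2 ^+ 5) * e ^+ m2 * X1) *
    ((e ^+ m2) ^+ 22 * (e ^+ m1) ^+ 4 * e ^+ m3 * X1 ^+ 2) ^+ 2).
move=> n k d delta n0 d0 hd hk.
have nR : 1 <= n%:R :> R by rewrite ler1n.
have L0 : 0 <= ln n%:R :> R by exact: ln_ge0.
have hdk : (d + k)%N%:R <= 2 * C * (1 + ln n%:R) by rewrite natrD; lra.
rewrite /sample_bound eval_sample_poly /eval2 /e.
rewrite !(mevalM, mevalD, mevalXn, mevalC, mevalXU, meval1) /tnth /= lerD2l.
apply: sample_bound_mono.
- rewrite L0/=; have : ln (1 + (n%:R - 1)) <= n%:R - 1 :> R by apply: le_ln1Dx; lra.
  by rewrite (_ : 1 + (n%:R - 1) = n%:R); [lra|ring].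
- rewrite expR_ge0/=; have := h1 n _ n0 hdk; rewrite (ger0_norm (expR_ge0 _)).
  apply: le_trans; rewrite -expRM_natl ler_expR mulrC ler_wpM2l//.
  exact: ler_norm.
- by rewrite exprn_ge0//=; have := h2 n _ n0 hdk; rewrite ger0_norm.
- rewrite invr_ge0 exprn_ge0 ?(ltW sigma0)//=; have := h3 n _ n0 hk.
  by rewrite ger0_norm ?invr_ge0 ?(ltW sigma0)// exprVn.
- by rewrite invr_ge0 ltW.
Qed.


End MainTheorem.

Lemma time_poly_ge (R : realType) (n N : nat) (x : R) : N%:R <= x ->
  (400 * ((1 + n) ^ 2 * (1 + N) ^ 2))%:R <= 400%:R * ((1 + n%:R) ^+ 2 * (1 + x) ^+ 2).
Proof.
move=> hN; rewrite natrM [((1 + n) ^ 2 * _)%:R]natrM !natrX !natrD ler_wpM2l ?ler0n// ler_wpM2l ?sqr_ge0//.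
apply: lerXn2r; rewrite ?nnegrE ?lerD2l// addr_ge0//.
exact: le_trans hN.
Qed.


Unset Implicit Arguments.

Theorem theorem1p3 (R : realType) :
  exists p : mpoly 5 R, nonneg_coeffs p /\
  exists (q : mpoly 2 R) (learn predict : cmd) (tau : R -> R -> R -> nat -> nat -> R),
    (forall (n k d : nat) (lambda sigma : R) (sigma0 : 0 < sigma) (delta : R) (N : nat),
       (1 <= n)%N -> (1 <= k)%N -> sigma < 2^-1 -> 0 < delta < 1 ->
       sample_bound p n k d lambda sigma delta <= N%:R ->
       learns_within learn predict n k d lambda sigma0 delta
         (tau delta lambda sigma k d) N (eval2 q n%:R N%:R))
    /\
    (forall (lambda sigma : R) (sigma0 : 0 < sigma) (C : R), sigma < 2^-1 ->
       exists r t : mpoly 2 R,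
       forall (n k d : nat) (delta : R),
         (1 <= n)%N -> (1 <= k)%N -> 0 < delta < 1 ->
         d%:R <= C * (1 + ln n%:R) -> k%:R <= C * (1 + ln n%:R) ->
         exists N : nat,
           [/\ sample_bound p n k d lambda sigma delta <= N%:R,
               N%:R <= eval2 r n%:R delta^-1 &
               learns_within learn predict n k d lambda sigma0 delta
                 (tau delta lambda sigma k d) N (eval2 t n%:R delta^-1)]).
Proof.
exists (sample_poly R); split; first exact: nonneg_sample_poly.
exists (time_poly (mvar R (@Ordinal 2 1 isT))), learn_cmd, predict_cmd, (@threshold R); split.
  move=> n k d lambda sigma sigma0 delta N n0 k0 sigma2 delta01 hN.
  apply: (learns_within_time sigma0 n0 k0 sigma2 delta01 hN).
  rewrite eval_time_poly; apply: time_poly_ge.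
  by rewrite /eval2 mevalXU.
move=> lambda sigma sigma0 C sigma2.
have [r hr] := polynomial_sample_bound lambda C sigma0.
exists r, (time_poly r) => n k d delta n0 k0 delta01 hd hk.
have /andP[delta0 _] := delta01.
have {}hr := hr n k d delta n0 delta0 hd hk.
pose b := sample_bound (sample_poly R) n k d lambda sigma delta.
have b0 : 0 <= b.
  rewrite /b /sample_bound eval_sample_poly.
  rewrite !mulr_ge0 ?exprn_ge0 ?addr_ge0 ?ln_ge0 ?mulr_ge0 ?exprn_ge0 ?invr_ge0 ?expR_ge0//;
    by rewrite ?ler1n ?exprn_ge0// ltW.
have hN : b <= (Num.trunc b).+1%:R by apply/ltW/Num.Theory.truncnS_gt.
have hN' : (Num.trunc b).+1%:R <= eval2 r n%:R delta^-1.
  apply: le_trans hr; rewrite -natr1 addrC lerD2l.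
  by have /andP[] := Num.Theory.truncn_itv b0.
exists (Num.trunc b).+1; split=> //.
apply: (learns_within_time sigma0 n0 k0 sigma2 delta01 hN).
by rewrite eval_time_poly; apply: time_poly_ge.
Qed.
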